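(* Let $r\ge 2$ and let $X=V(f)\subset\mathbb{P}^r$ be a strictly normal crossing hypersurface of degree $d$, with irreducible components $X_1,\dots,X_s$. Then $$H^0_{\mathbf{m}}(R(f))_{d-r-1}\cong\bigoplus_{i=1}^s H^0(X_i,\Omega^{r-1}_{X_i}).$$
   Context: Here $f\in P=\mathbb{C}[X_0,\dots,X_r]$ is a reduced homogeneous polynomial of degree $d$, $R(f)=P/J(f)$ is its jacobian ring, where $J(f)=\left(\frac{\partial f}{\partial X_0},\dots,\frac{\partial f}{\partial X_r}\right)$, $\mathbf{m}=(X_0,\dots,X_r)$ is the irrelevant ideal of $P$, and $H^0_{\mathbf{m}}(R(f))=J(f)^{sat}/J(f)$ is the $0$-th local cohomology module of $R(f)$ with respect to $\mathbf{m}$ ($J(f)^{sat}$ is the saturation); a subscript denotes the graded piece of that degree. A reduced divisor $X$ in an $r$-dimensional projective manifold $Z$ is a normal crossing divisor if for each $x\in X$ the local ring $\mathcal{O}_{X,x}$ is formally (or étale) equivalent to $\mathcal{O}_{Z,x}/(t_1\cdots t_k)$ for some $1\le k\le r$, where $t_1,\dots,t_k$ are part of a local system of coordinates. It is a strictly normal crossing divisor if in addition all its irreducible components are nonsingular. Here $Z=\mathbb{P}^r$. *)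

(* Defs.v *)
From mathcomp Require Import all_boot all_order all_algebra.
From mathcomp Require Import boolp classical_sets functions reals.
From mathcomp Require Import complex mpoly.

Set Implicit Arguments.
Unset Strict Implicit.
Unset Printing Implicit Defensive.

Import GRing.Theory.
Local Open Scope classical_set_scope.
Local Open Scope ring_scope.

(* The quotient vector spaces V / W and V' / W' are isomorphic, for subspaces
   W of V and W' of V'; phi lifts an isomorphism to representatives, and its
   values outside V are irrelevant. *)
Definition subquotient_iso (K : fieldType) (E E' : lmodType K)
    (V W : set E) (V' W' : set E') : Prop :=
  exists phi : E -> E',
    [/\ forall x, V x -> V' (phi x),
        forall (a : K) x y, V x -> V y ->
          W' (phi (a *: x + y) - (a *: phi x + phi y)),
        forall x, V x -> (W x <-> W' (phi x)) &
        forall y, V' y -> exists2 x, V x & W' (y - phi x)].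

(* Below, O stands for (the carrier of) a subring of A, and I, m for ideals of
   O; O = setT gives the ideals of A itself. *)
Section Ideals.
Context {A : comNzRingType}.
Implicit Types (O I J m : set A) (u v : nat -> A).

Definition ideal_gen O (T : finType) (t : T -> A) : set A :=
  [set x | exists2 c : T -> A, (forall i, O (c i)) & x = \sum_i c i * t i].

Definition ideal_pow O m (n : nat) : set A :=
  [set x | exists N (c : 'I_N -> A) (a : 'I_N -> 'I_n -> A),
     [/\ forall j, O (c j), forall j i, m (a j i) &
         x = \sum_j c j * \prod_i a j i]].

Definition saturation I m : set A :=
  [set x | exists k, forall y, ideal_pow setT m k y -> I (y * x)].

(* The ideal I + m ^ n of O. *)
Definition filtration O m I (n : nat) : set A :=
  [set x | exists2 y, I y & ideal_pow O m n (x - y)].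

(* The m-adic completion of O / I, i.e. the projective limit of the rings
   O / (I + m ^ n), is the ring of coherent sequences modulo null ones. *)
Definition coherent O m I u : Prop :=
  (forall n, O (u n)) /\ (forall n, filtration O m I n (u n.+1 - u n)).

Definition null O m I u : Prop := forall n, filtration O m I n (u n).

(* The m-adic completions of O / I and O / J are isomorphic as algebras over
   the field K, which is embedded in O by iota. *)
Definition formally_equivalent (K : fieldType) (iota : K -> A) O m I J : Prop :=
  exists Phi : (nat -> A) -> (nat -> A),
    [/\ forall u, coherent O m I u -> coherent O m J (Phi u),
        forall u v, coherent O m I u -> coherent O m I v ->
          null O m J (Phi (u \+ v) \- (Phi u \+ Phi v))
          /\ null O m J (Phi (u \* v) \- (Phi u \* Phi v)),
        forall c : K, null O m J (Phi (fun=> iota c) \- (fun=> iota c)),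
        forall u, coherent O m I u -> (null O m I u <-> null O m J (Phi u)) &
        forall v, coherent O m J v ->
          exists2 u, coherent O m I u & null O m J (v \- Phi u)].

End Ideals.

Section ProjectiveSpace.
Context {K : fieldType} {r : nat}.
Local Notation P := {mpoly K[r.+1]}.

Definition coords := 'I_r.+1 -> K.

Definition nonzero (x : coords) : Prop := exists i, x i != 0.

(* Subsets of the projective space are represented by the sets of all
   (nonzero) vectors of homogeneous coordinates of their points. *)
Definition zariski_closed (Y : set coords) : Prop :=
  exists2 S : set P, (forall p, S p -> exists n, p \is n.-homog)
    & Y = [set x | nonzero x /\ forall p, S p -> p.@[x] = 0].

Definition irreducible_closed (Y : set coords) : Prop :=
  [/\ zariski_closed Y, Y !=set0 &
      forall A B, zariski_closed A -> zariski_closed B ->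
        Y = A `|` B -> Y = A \/ Y = B].

Definition irreducible_component (Z Y : set coords) : Prop :=
  [/\ irreducible_closed Y, Y `<=` Z &
      forall Y', irreducible_closed Y' -> Y `<=` Y' -> Y' `<=` Z -> Y' = Y].

Definition zero_locus (f : P) : set coords :=
  [set x | nonzero x /\ f.@[x] = 0].

Definition vanishing_ideal (Y : set coords) : set P :=
  [set p | forall x, Y x -> p.@[x] = 0].

(* Rational functions of degree 0: quotients of forms of the same degree. *)
Record hfrac := HFrac {
  hdeg : nat;
  hnum : P;
  hden : P;
  hnum_homog : hnum \is hdeg.-homog;
  hden_homog : hden \is hdeg.-homog }.

Definition frac (u : hfrac) : {fraction P} := tofrac (hnum u) / tofrac (hden u).

Definition hval (u : hfrac) (y : coords) : K := (hnum u).@[y] / (hden u).@[y].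

(* The differential at y of u, applied to the vector v. *)
Definition hdiff (u : hfrac) (y v : coords) : K :=
  (\sum_k ((hnum u)^`M(k).@[y] * (hden u).@[y]
           - (hnum u).@[y] * (hden u)^`M(k).@[y]) * v k) / (hden u).@[y] ^+ 2.

(* The stalk at x of the ideal sheaf attached to a homogeneous ideal I. *)
Definition ideal_at (I : set P) (x : coords) : set {fraction P} :=
  [set g | exists u, [/\ I (hnum u), (hden u).@[x] != 0 & g = frac u]].

Definition local_ring (x : coords) : set {fraction P} := ideal_at setT x.

Definition local_max (x : coords) : set {fraction P} :=
  ideal_at [set p | p.@[x] = 0] x.

Definition local_coordinates (x : coords) (t : 'I_r -> {fraction P}) : Prop :=
  local_max x = ideal_gen (local_ring x) t.

Definition const_frac (c : K) : {fraction P} := tofrac c%:MP.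

Definition normal_crossing (f : P) : Prop :=
  forall x, zero_locus f x ->
    exists (k : nat) (t : 'I_r -> {fraction P}),
      [/\ (1 <= k <= r)%N, local_coordinates x t &
          formally_equivalent const_frac (local_ring x) (local_max x)
            (ideal_at (ideal_gen setT (fun _ : 'I_1 => f)) x)
            (ideal_gen (local_ring x)
               (fun _ : 'I_1 => \prod_(i < r | (i < k)%N) t i))].

(* For Y (with its reduced structure) of pure dimension e: the local rings of
   Y are regular, i.e. their maximal ideals are generated by e elements. *)
Definition nonsingular (e : nat) (Y : set coords) : Prop :=
  forall x, Y x -> exists t : 'I_e -> {fraction P},
    (forall i, local_max x (t i)) /\
    (forall g, local_max x g -> exists2 h, ideal_at (vanishing_ideal Y) x h
       & ideal_gen (local_ring x) t (g - h)).

(* Irreducible components of a hypersurface have dimension r - 1. *)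
Definition strictly_normal_crossing (f : P) : Prop :=
  normal_crossing f /\
  (forall Y, irreducible_component (zero_locus f) Y -> nonsingular r.-1 Y).

Definition squarefree (f : P) : Prop :=
  f != 0 /\ (forall g h : P, f = g ^+ 2 * h -> exists c : K, g = c%:MP).

Definition jacobian_ideal (f : P) : set P := ideal_gen setT (fun i => f^`M(i)).

Definition irrelevant_ideal : set P :=
  ideal_gen setT (fun i : 'I_r.+1 => ('X_i : P)).

Definition graded_piece (I : set P) (e : int) : set P :=
  [set p | I p /\ (if e is Posz n then p \is n.-homog else p == 0)].

(* The Zariski tangent space at y of the cone over Y; its quotient by the line
   spanned by y is the tangent space of Y (up to the choice of the
   representative y). *)
Definition tangent (Y : set coords) (y : coords) : set coords :=
  [set v | forall p, vanishing_ideal Y p -> \sum_k p^`M(k).@[y] * v k = 0].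

(* Global sections of the sheaf of regular p-forms on a nonsingular Y: families
   of alternating p-linear forms w y on the tangent spaces which, near each
   point x of Y, can be written as finite sums of products
     g_j * d h_(j, 1) /\ ... /\ d h_(j, p)
   with g_j, h_(j, k) regular on the open subset q <> 0 of Y.
   The differential of a function of degree 0 kills y, so that w y factors
   through the tangent space of Y. Since w y v only makes sense when y is in Y
   and the v k are tangent vectors, it is normalized to 0 otherwise. *)
Definition regular_form (p : nat) (Y : set coords)
    (w : coords -> ('I_p -> coords) -> K^o) : Prop :=
  (forall y v, ~ (Y y /\ forall k, tangent Y y (v k)) -> w y v = 0) /\
  (forall x, Y x ->
     exists (e : nat) (q : P) (N : nat)
       (g : 'I_N -> hfrac) (h : 'I_N -> 'I_p -> hfrac),
     [/\ q \is e.-homog, q.@[x] != 0 &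
         forall y, Y y -> q.@[y] != 0 ->
           [/\ forall j, (hden (g j)).@[y] != 0,
               forall j k, (hden (h j k)).@[y] != 0 &
               forall v, (forall k, tangent Y y (v k)) ->
                 w y v = \sum_j hval (g j) y *
                           \det (\matrix_(k, l) hdiff (h j k) y (v l))]]).

End ProjectiveSpace.

Arguments coords : clear implicits.
Arguments irrelevant_ideal : clear implicits.

(* Main.v *)
Require Import Defs.
From HB Require Import structures.
From mathcomp Require Import all_boot all_order all_algebra.
From mathcomp Require Import boolp classical_sets functions reals.
From mathcomp Require Import complex mpoly zify ring perm.

Set Implicit Arguments.
Unset Strict Implicit.
Unset Printing Implicit Defensive.

Import GRing.Theory.
Local Open Scope classical_set_scope.
Local Open Scope ring_scope.

(** Write r = m + 2 and let f be the product of the irreducible forms F i, of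
   degree e i, with X i = zero_locus (F i); let Q i be the product of the other
   F j. Both sides of the isomorphism are parametrized by the tuples G of forms
   G i of degree e i - r - 1 (zero when this is negative): G corresponds to the
   polynomial \sum_i G i * Q i on the left, and on the right to the family of
   the Poincare residues of G i * Omega / F i along X i, where Omega is the
   contraction of the volume form with the position vector.

   On the left, the partial derivatives of f are combinations of the Q i, and
   the ideal of the Q i is saturated because two general linear forms are a
   regular sequence modulo each F i (cofactor_ideal_saturated); so every element
   of the saturation of J(f) is \sum_i G i * Q i, uniquely by degree reasons
   since F i does not divide Q i. Conversely each Q i is in the saturation: at a
   point where the F l that vanish there have independent differentials,
   Cramer's rule applied to the derivatives of f along dual vectors gives a form
   q with q * Q i in J(f) and q nonzero at the point, and the projective
   Nullstellensatz turns these q into powers of the variables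
   (jacobian_saturation_cofactor). Finally J(f) vanishes in degree d - r - 1,
   being generated in degree d - 1.

   The independence of the differentials comes from the normal crossing
   condition, which is formal. Pulling back the formal coordinates to elements
   v j of the maximal ideal of the point (formal_coordinates), a product of k of
   the v j lies in the ideal of f up to order k + 1. The lowest order terms then
   show that the product of the differentials of the F l through the point
   divides a product of distinct members of a basis of linear forms, and unique
   factorization makes these differentials proportional to distinct members of
   this basis (normal_crossing_dual_vectors). Smoothness of the components makes
   them nonzero (nonsingular_gradient), by order of vanishing again.

   On the right, an identity between determinants (frame_det_pairing) compares
   the exterior products of differentials of functions of degree 0 with the
   residue of Omega / F i. It shows that residues are regular forms, and that a
   regular form is locally A / B times the residue of Omega / F i, with A and B
   homogeneous. Since the denominators B have no common zero, powers of two
   general linear forms are denominators, and their regularity modulo F i makes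
   A / B a polynomial modulo F i, of the right degree (regular_form_residue).

   The tools are that polynomial rings are factorial, from which the
   Nullstellensatz for hypersurfaces follows by a Bezout relation in one
   variable, and the projective Nullstellensatz, proved by elimination with
   resultants. Homogeneous components, Taylor expansions and orders of vanishing
   are all read on the morphism expand x. *)

(** * Divisibility, prime elements and the Gauss lemma *)

Section Divides.
Context {R : comNzRingType}.
Implicit Types a b c : R.

Definition divides a b := exists c, b = c * a.

Lemma dividesxx a : divides a a.
Proof. by exists 1; rewrite mul1r. Qed.

Lemma divides0 a : divides a 0.
Proof. by exists 0; rewrite mul0r. Qed.

Lemma divides_mull a b c : divides a b -> divides a (c * b).
Proof. by move=> [e ->]; exists (c * e); rewrite mulrA. Qed.

Lemma divides_mulr a b c : divides a b -> divides a (b * c).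
Proof. by rewrite mulrC; apply: divides_mull. Qed.

Lemma dividesD a b c : divides a b -> divides a c -> divides a (b + c).
Proof. by move=> [e ->] [e' ->]; exists (e + e'); rewrite mulrDl. Qed.

Lemma dividesN a b : divides a b -> divides a (- b).
Proof. by move=> [e ->]; exists (- e); rewrite mulNr. Qed.

Lemma dividesB a b c : divides a b -> divides a c -> divides a (b - c).
Proof. by move=> ? ?; apply: dividesD => //; apply: dividesN. Qed.

Lemma divides_trans a b c : divides a b -> divides b c -> divides a c.
Proof. by move=> ab [e ->]; apply: divides_mull. Qed.

Lemma divides_sum (I : Type) (s : seq I) (p : pred I) (F : I -> R) a :
  (forall i, p i -> divides a (F i)) -> divides a (\sum_(i <- s | p i) F i).
Proof.
move=> dF; elim/big_rec: _ => [|i x pi dx]; first exact: divides0.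
by apply: dividesD => //; apply: dF.
Qed.

End Divides.

Lemma divides_morph (R S : comNzRingType) (phi : {rmorphism R -> S}) (a b : R) :
  divides a b -> divides (phi a) (phi b).
Proof. by move=> [c ->]; exists (phi c); rewrite rmorphM. Qed.

Section PrimeElements.
Context {R : idomainType}.
Implicit Types a b p : R.

Definition prime_element p :=
  [/\ p != 0, p \isn't a GRing.unit &
      forall a b, divides p (a * b) -> divides p a \/ divides p b].

Definition irreducible_element p :=
  [/\ p != 0, p \isn't a GRing.unit &
      forall a b, p = a * b -> a \is a GRing.unit \/ b \is a GRing.unit].

Definition factorial_domain :=
  forall a, a != 0 -> exists u (l : seq R),
    [/\ u \is a GRing.unit, forall p, p \in l -> prime_element p &
        a = u * \prod_(p <- l) p].

Lemma divides_unit a u : u \is a GRing.unit -> divides a u ->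
  a \is a GRing.unit.
Proof. by move=> uu [c E]; move: uu; rewrite E unitrM => /andP[]. Qed.

Lemma prime_divides_prod (I : eqType) (s : seq I) (F : I -> R) p :
  prime_element p -> divides p (\prod_(i <- s) F i) ->
  exists2 i, i \in s & divides p (F i).
Proof.
move=> [p0 pu pM]; elim: s => [|i s IH].
  by rewrite big_nil => d1; rewrite (divides_unit (unitr1 R) d1) in pu.
rewrite big_cons => /pM[d|/IH[j js d]]; first by exists i; rewrite ?mem_head.
by exists j; rewrite ?in_cons ?js ?orbT.
Qed.

Lemma factorial_irreducible_prime p :
  factorial_domain -> irreducible_element p -> prime_element p.
Proof.
move=> fR [p0 pu irr]; have [u [l [uu lP E]]] := fR p p0.
case: l lP E => [|q l] lP E.
  by rewrite E big_nil mulr1 uu in pu.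
have qP : prime_element q by apply: lP; rewrite mem_head.
have [q0 qu qM] := qP.
rewrite big_cons mulrCA in E; set w := _ * \prod_(_ <- _) _ in E.
have wu : w \is a GRing.unit by case: (irr _ _ E) => // qU; rewrite qU in qu.
have dE a : divides p a <-> divides q a.
  split=> [[c ->]|[c ->]]; first by exists (c * w); rewrite E -mulrA [w * _]mulrC.
  by exists (c / w); rewrite E -mulrA [q * w]mulrC mulKr.
split=> // a b /dE/qM[/dE ?|/dE ?]; [by left|by right].
Qed.

End PrimeElements.

Section GaussLemma.
Context {S : idomainType}.
Implicit Types (c s : S) (A B C P : {poly S}).

Lemma divides_polyC s A : (forall i, divides s A`_i) -> divides s%:P A.
Proof.
move=> dA; have [F FE] := choice dA.
exists (\poly_(i < size A) F i); apply/polyP=> i.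
rewrite coefMC coef_poly; case: ltnP => [_|le]; first exact: FE.
by rewrite nth_default ?mul0r.
Qed.

(** Induction on the sizes of two factors A and B of a multiple of s: s
   divides one of the two leading coefficients, and the corresponding
   leading term can be removed. *)
Lemma prime_polyC s : prime_element s -> prime_element s%:P.
Proof.
move=> [s0 su sM].
split; rewrite ?polyC_eq0 //.
  by rewrite poly_unitE coefC size_polyC s0 eqxx.
move=> A B; have [n] := ubnP (size A + size B); elim: n A B => // n IH A B.
rewrite ltnS => le [C E].
have [->|A0] := eqVneq A 0; first by left; apply: divides0.
have [->|B0] := eqVneq B 0; first by right; apply: divides0.
have split_lead (D : {poly S}) : D != 0 ->
    exists2 D' : {poly S}, (size D' < size D)%N
      & D = D' + (lead_coef D)%:P * 'X^((size D).-1).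
  rewrite -size_poly_gt0 => D0.
  exists (D - (lead_coef D)%:P * 'X^((size D).-1)); last by rewrite subrK.
  rewrite -[X in (_ < X)%N](prednK D0) ltnS.
  apply/leq_sizeP => j; rewrite leq_eqVlt => /orP[/eqP <-|lt].
    by rewrite coefB coefCM coefXn eqxx mulr1 subrr.
  rewrite coefB coefCM coefXn gtn_eqF // mulr0 subr0 nth_default //.
  by rewrite -(prednK D0).
have : divides s (lead_coef A * lead_coef B).
  by rewrite -lead_coefM E lead_coefM lead_coefC; exists (lead_coef C).
have key (D : {poly S}) e : divides s e -> divides s%:P (e%:P * D).
  by move=> [c ->]; apply: divides_mulr; exists c%:P; rewrite polyCM.
case/sM => [dA|dB].
  have [A' ltA EA] := split_lead _ A0.
  have : divides s%:P (A' * B).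
    have -> : A' * B = A * B - (lead_coef A)%:P * ('X^((size A).-1) * B).
      by rewrite {1}EA mulrDl mulrA addrK.
    by apply: dividesB; [exists C|apply: key].
  case/IH; first by apply: leq_trans le; rewrite ltn_add2r.
    by move=> d; left; rewrite EA; apply: dividesD => //; apply: key.
  by right.
have [B' ltB EB] := split_lead _ B0.
have : divides s%:P (A * B').
  have -> : A * B' = A * B - (lead_coef B)%:P * ('X^((size B).-1) * A).
    by rewrite {1}EB mulrDr [A * (_ * _)]mulrC mulrA addrK.
  by apply: dividesB; [exists C|apply: key].
case/IH; first by apply: leq_trans le; rewrite ltn_add2l.
  by left.
by move=> d; right; rewrite EB; apply: dividesD => //; apply: key.
Qed.

Lemma polyC_unit s : (s%:P \is a GRing.unit) = (s \is a GRing.unit).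
Proof.
by rewrite poly_unitE coefC size_polyC; have [->|] := eqVneq s 0; rewrite ?unitr0.
Qed.

Lemma irreducible_polyC_inv s : irreducible_element s%:P -> irreducible_element s.
Proof.
move=> [s0 su irr]; split.
- by move: s0; rewrite polyC_eq0.
- by move: su; rewrite polyC_unit.
move=> a b E; by have := irr a%:P b%:P; rewrite !polyC_unit; apply; rewrite E polyCM.
Qed.

(** The constant c of a Bezout relation between P and A vanishes wherever P
   and A acquire a common root, so that specializations with phi c <> 0 have
   none. *)
Lemma coprimep_common_zero P A : coprimep P A ->
  exists2 c : S, c != 0 & forall (F : fieldType) (phi : {rmorphism S -> F}) a,
    (map_poly phi P).[a] = 0 -> (map_poly phi A).[a] = 0 -> phi c = 0.
Proof.
move=> /Bezout_coprimepP[[U V] /= /eqp_size].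
rewrite size_poly1 => /eqP/size_poly1P[c c0 E]; exists c => // F phi a Pa Aa.
have := congr1 (fun Q => (map_poly phi Q).[a]) E.
rewrite /= rmorphD !rmorphM /= hornerD !hornerM Pa Aa !mulr0 addr0.
by rewrite map_polyC hornerC.
Qed.

Hypothesis factS : @factorial_domain S.

(** A scalar that divides B * C can be distributed over B and C one prime
   factor at a time, since these primes remain prime in {poly S}. *)
Lemma clear_content s A B C : s != 0 -> s%:P * A = B * C ->
  exists s1 s2 B' C',
    [/\ s1 != 0, s2 != 0, B = s1%:P * B', C = s2%:P * C' & A = B' * C'].
Proof.
move=> s0; have [u [l [uu lP E]]] := factS s0.
elim: l s s0 lP E A B C => [|p l IH] s s0 lP E A B C EA.
  rewrite big_nil mulr1 in E; rewrite {}E in EA.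
  exists u, 1, (u^-1%:P * B), C; rewrite oner_neq0 polyC1 mul1r; split=> //.
  - by apply: contraTneq uu => ->; rewrite unitr0.
  - by rewrite mulrA -polyCM divrr // mul1r.
  - by rewrite -mulrA -EA mulrA -polyCM mulVr // mul1r.
have pP : prime_element p by apply: lP; rewrite mem_head.
have [p0 _ _] := pP; have [_ _ pM] := prime_polyC pP.
rewrite big_cons mulrCA in E; set s' := u * _ in E.
have s'0 : s' != 0 by apply: contra_neq s0 => e; rewrite E e mulr0.
have lP' q : q \in l -> prime_element q by move=> ql; apply: lP; rewrite in_cons ql orbT.
have pI : injective ( *%R p%:P) by apply: mulfI; rewrite polyC_eq0.
have : divides p%:P (B * C).
  by rewrite -EA E polyCM -mulrA; apply: divides_mulr; apply: dividesxx.
rewrite E polyCM -mulrA in EA.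
case/pM => -[D DE].
  have /(IH s' s'0 lP' erefl)[s1 [s2 [B' [C' [h1 h2 h3 h4 h5]]]]] : s'%:P * A = D * C.
    by apply: pI; rewrite EA DE mulrA [D * _]mulrC.
  exists (p * s1), s2, B', C'; split=> //; first by rewrite mulf_neq0.
  by rewrite DE h3 polyCM mulrC mulrA.
have /(IH s' s'0 lP' erefl)[s1 [s2 [B' [C' [h1 h2 h3 h4 h5]]]]] : s'%:P * A = B * D.
  by apply: pI; rewrite /= EA DE [D * _]mulrC mulrCA.
exists s1, (p * s2), B', C'; split=> //; first by rewrite mulf_neq0.
by rewrite DE h4 polyCM mulrC mulrA.
Qed.

(** The relation %| allows a scalar factor, that is, it is divisibility over
   the fraction field. The scalar is distributed over the two factors by
   clear_content, and P being irreducible receives a unit. *)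
Lemma irreducible_dvdp P A : irreducible_element P -> (1 < size P)%N ->
  P %| A -> divides P A.
Proof.
move=> [P0 Pu irr] sP /Pdiv.Idomain.dvdpP[[c Q] /= c0].
rewrite -mul_polyC => /(clear_content c0)[s1 [s2 [B [C [h1 h2 h3 h4 ->]]]]].
have [su|Cu] := irr _ _ h4.
  exists (B * s2%:P^-1); rewrite h4 -mulrA; congr (_ * _).
  by rewrite mulKr.
move: sP; rewrite h4 size_Cmul //.
by move: Cu; rewrite poly_unitE => /andP[/eqP-> ].
Qed.

(** A divisor of P over the fraction field is, up to a scalar, a divisor of
   P, so the gcd of P and A is constant or associate to P. *)
Lemma irreducible_dvd_or_coprime P A : irreducible_element P ->
  (1 < size P)%N -> divides P A \/ coprimep P A.
Proof.
move=> irrP sP; have [P0 Pu irr] := irrP.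
have /Pdiv.Idomain.dvdpP[[c Q] /= c0] := dvdp_gcdl P A.
rewrite -mul_polyC => /(clear_content c0)[s1 [s2 [Q' [g [h1 h2 h3 h4 EP]]]]].
case: (irr _ _ EP) => [Qu|gu].
  left; apply: irreducible_dvdp => //.
  have : gcdp P A %| A by apply: dvdp_gcdr.
  have -> : gcdp P A = (s2%:P * Q'^-1) * P by rewrite h4 EP -mulrA mulKr.
  by apply: dvdp_trans; apply: dvdp_mull.
right; rewrite /coprimep h4 size_Cmul //.
by move: gu; rewrite poly_unitE => /andP[/eqP-> ].
Qed.

(** A constant remains prime by prime_polyC. Otherwise, P is prime over the
   fraction field, and divisibility there implies divisibility by
   irreducible_dvdp. *)
Lemma gauss_irreducible_prime P : irreducible_element P -> prime_element P.
Proof.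
move=> irrP; have [P0 Pu irr] := irrP.
have [sP|sP] := leqP (size P) 1.
  have PE := size1_polyC sP; rewrite PE; apply: prime_polyC.
  apply: factorial_irreducible_prime => //.
  by apply: irreducible_polyC_inv; rewrite -PE.
split=> // A B dAB.
have [d|cop] := irreducible_dvd_or_coprime A irrP sP; [by left|right].
apply: irreducible_dvdp => //; rewrite -(Gauss_dvdpr _ cop).
by case: dAB => C ->; exact: dvdp_mull.
Qed.

End GaussLemma.

(** * Unique factorization of polynomials and hypersurfaces in affine space *)

Lemma mpoly_morph_ext (n : nat) (R : comNzRingType) (A : comNzRingType)
    (phi psi : {rmorphism {mpoly R[n]} -> A}) :
  (forall c, phi c%:MP = psi c%:MP) -> (forall i, phi 'X_i = psi 'X_i) ->
  phi =1 psi.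
Proof.
move=> hC hX p; rewrite (mpolyE p) !rmorph_sum; apply: eq_bigr => m _ /=.
rewrite -mul_mpolyC !rmorphM hC; congr (_ * _).
rewrite mpolyXE_id !rmorph_prod; apply: eq_bigr => i _.
by rewrite !rmorphXn hX.
Qed.

Section Univariate.
Context {n : nat} {R : comNzRingType}.
Local Notation widen := (widen_ord (leqnSn n)).

Lemma muniXmax : muni ('X_ord_max : {mpoly R[n.+1]}) = 'X.
Proof.
rewrite muniE msuppX big_seq1 mcoeffX eqxx scale1r mnm1E eqxx expr1.
set m := [multinom _ | _ < _]; suff -> : m = 0%MM by rewrite mpolyX0 scale1r.
apply/mnmP => i; rewrite mnmE mnm1E mnm0E; case: eqP => //.
by move=> /(congr1 val)/= E; have := ltn_ord i; rewrite -E ltnn.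
Qed.

Lemma muniXwiden i : muni ('X_(widen i) : {mpoly R[n.+1]}) = ('X_i)%:P.
Proof.
rewrite muniE msuppX big_seq1 mcoeffX eqxx scale1r mnm1E.
set m := [multinom _ | _ < _]; have -> : m = U_(i)%MM.
  by apply/mnmP => j; rewrite mnmE !mnm1E.
case: eqP => [/(congr1 val)/= E|_]; last by rewrite expr0 alg_polyC.
by have := ltn_ord i; rewrite E ltnn.
Qed.

Lemma ord_widen_max (i : 'I_n.+1) : i = ord_max \/ exists j, i = widen j.
Proof.
have [lt|] := ltnP i n; last first.
  by move=> le; left; apply/val_inj/eqP; rewrite eqn_leq le -ltnS ltn_ord.
by right; exists (Ordinal lt); apply/val_inj.
Qed.

(** The inverse of muni: the indeterminate is sent to the last variable. *)
Definition mmult (q : {poly {mpoly R[n]}}) : {mpoly R[n.+1]} :=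
  (map_poly (@mwiden n R) q).['X_ord_max].

Lemma mmult_is_zmod_morphism : zmod_morphism mmult.
Proof. by move=> p q; rewrite /mmult rmorphB hornerD hornerN. Qed.

Lemma mmult_is_monoid_morphism : monoid_morphism mmult.
Proof.
by split=> [|p q]; rewrite /mmult ?rmorph1 ?hornerC // rmorphM hornerM.
Qed.

HB.instance Definition _ :=
  GRing.isZmodMorphism.Build _ _ mmult mmult_is_zmod_morphism.
HB.instance Definition _ :=
  GRing.isMonoidMorphism.Build _ _ mmult mmult_is_monoid_morphism.

Lemma mmultD : {morph mmult : p q / p + q}.
Proof. exact: rmorphD. Qed.

Lemma mmultM : {morph mmult : p q / p * q}.
Proof. exact: rmorphM. Qed.

Lemma mmultC p : mmult p%:P = mwiden p.
Proof. by rewrite /mmult map_polyC hornerC. Qed.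

Lemma mmultX : mmult 'X = 'X_ord_max.
Proof. by rewrite /mmult map_polyX hornerX. Qed.

Lemma mwidenXU i : mwiden ('X_i : {mpoly R[n]}) = 'X_(widen i).
Proof. by rewrite mwidenX mnmwiden1. Qed.

Lemma mmultK : cancel (@muni n R) mmult.
Proof.
apply: (@mpoly_morph_ext _ _ _ (mmult \o @muni n R) idfun) => [c|i] /=.
  by rewrite muniC mmultC mwidenC.
have [->|[j ->]] := ord_widen_max i; first by rewrite muniXmax mmultX.
by rewrite muniXwiden mmultC mwidenXU.
Qed.

Lemma muni_expansion k p : (size (@muni n R p) <= k)%N ->
  p = \sum_(i < k) mwiden (muni p)`_i * 'X_ord_max ^+ i.
Proof.
move=> le; rewrite -{1}[p]mmultK /mmult (@horner_coef_wide _ k).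
  by apply: eq_bigr => i _; rewrite coef_map.
by apply: leq_trans le; apply: size_poly.
Qed.

Lemma muni_mwiden (p : {mpoly R[n]}) : muni (mwiden p) = p%:P.
Proof.
apply: (@mpoly_morph_ext _ _ _ (@muni n R \o @mwiden n R) (@polyC _)) => [c|i] /=.
  by rewrite mwidenC muniC.
by rewrite mwidenXU muniXwiden.
Qed.

Lemma muniK : cancel mmult (@muni n R).
Proof.
elim/poly_ind => [|q c IH]; first by rewrite !rmorph0.
by rewrite !(rmorphD, rmorphM) /= mmultX mmultC muniXmax muni_mwiden IH.
Qed.

Lemma meval_muni (v : 'I_n.+1 -> R) p :
  p.@[v] = (map_poly (meval (v \o widen)) (muni p)).[v ord_max].
Proof.
pose psi := (horner_eval (v ord_max) \o map_poly (meval (v \o widen))) \o @muni n R.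
apply: (@mpoly_morph_ext _ _ _ (meval v) psi) => [c|i]; rewrite /psi /= /horner_eval.
  by rewrite muniC map_polyC /= !mevalC hornerC.
rewrite mevalXU; have [->|[j ->]] := ord_widen_max i.
  by rewrite muniXmax map_polyX hornerX.
by rewrite muniXwiden map_polyC /= mevalXU hornerC.
Qed.

End Univariate.

Section IsoTransfer.
Context {R S : idomainType} (phi : {rmorphism R -> S}) (psi : {rmorphism S -> R}).
Hypotheses (phiK : cancel phi psi) (psiK : cancel psi phi).

Lemma iso_unit a : (phi a \is a GRing.unit) = (a \is a GRing.unit).
Proof.
apply/idP/idP => [/(rmorph_unit psi)|/(rmorph_unit phi)] //.
by rewrite phiK.
Qed.

Lemma iso_irreducible a : irreducible_element a -> irreducible_element (phi a).
Proof.
move=> [a0 au irr]; split; rewrite ?iso_unit //.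
  by apply: contra_neq a0 => E; rewrite -[a]phiK E rmorph0.
move=> b c E; have := irr (psi b) (psi c).
rewrite -rmorphM -E phiK => /(_ erefl).
by rewrite -(iso_unit (psi b)) -(iso_unit (psi c)) !psiK.
Qed.

Lemma iso_divides a b : divides (phi a) (phi b) -> divides a b.
Proof. by move/(divides_morph psi); rewrite !phiK. Qed.

Lemma iso_prime a : prime_element (phi a) -> prime_element a.
Proof.
move=> [a0 au aM]; split; rewrite -?iso_unit //.
  by apply: contra_neq a0 => ->; rewrite rmorph0.
move=> b c /(divides_morph phi); rewrite rmorphM.
by case/aM => /iso_divides; [left|right].
Qed.

End IsoTransfer.

Section MpolyFactorial.
Context {K : fieldType}.

Lemma mpoly_unitE n (p : {mpoly K[n]}) :
  (p \is a GRing.unit) = (msize p == 1%N).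
Proof.
apply/idP/msize_poly1P => [/andP[/eqP E u]|[c c0 ->]].
  by exists p@_0; rewrite // -unitfE.
by rewrite rmorph_unit // unitfE.
Qed.

Lemma mpoly_msize_gt1 n (p : {mpoly K[n]}) :
  p != 0 -> p \isn't a GRing.unit -> (1 < msize p)%N.
Proof.
by rewrite mpoly_unitE -msize_poly_eq0; case: (msize p) => [|[|]].
Qed.

Lemma mpoly_irreducible_factors n (p : {mpoly K[n]}) : p != 0 ->
  exists u (l : seq {mpoly K[n]}),
    [/\ u \is a GRing.unit, forall q, q \in l -> irreducible_element q &
        p = u * \prod_(q <- l) q].
Proof.
have [k] := ubnP (msize p); elim: k p => // k IH p; rewrite ltnS => lek p0.
have [pu|pu] := boolP (p \is a GRing.unit).
  by exists p, [::]; rewrite big_nil mulr1.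
have [irr|nirr] := pselect (irreducible_element p).
  exists 1, [:: p]; rewrite unitr1 big_seq1 mul1r; split=> // q.
  by rewrite inE => /eqP->.
have [a [b [E au bu]]] : exists a b, [/\ p = a * b, a \isn't a GRing.unit
    & b \isn't a GRing.unit].
  apply: contrapT => H; apply: nirr; split=> // a b E.
  have [au|au] := boolP (a \is a GRing.unit); [by left|right].
  by apply/negPn/negP => bu; apply: H; exists a, b.
have /andP[a0 b0] : (a != 0) && (b != 0) by rewrite -negb_or -mulf_eq0 -E.
have sa := mpoly_msize_gt1 a0 au; have sb := mpoly_msize_gt1 b0 bu.
have sp : msize p = (msize a + msize b).-1 by rewrite E msizeM.
have [|u [l [uu lP Ea]]] := IH a _ a0.
  by clear -sp lek sb sa; lia.
have [|u' [l' [uu' lP' Eb]]] := IH b _ b0.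
  by clear -sp lek sb sa; lia.
exists (u * u'), (l ++ l'); split; first by rewrite unitrM uu.
  by move=> q; rewrite mem_cat => /orP[/lP|/lP'].
by rewrite E Ea Eb big_cat /= mulrACA.
Qed.

(** Induction on the number of variables: irreducible factors exist by
   induction on the degree, are prime in n variables by hypothesis, and the
   Gauss lemma adds one variable. *)
Lemma mpoly_irreducible_prime n (p : {mpoly K[n]}) :
  irreducible_element p -> prime_element p.
Proof.
elim: n p => [|n IH] p irrp.
  have [p0 pu _] := irrp; have := mpoly_msize_gt1 p0 pu.
  rewrite -[p]mpolyKC msizeC; by case: (_ != _).
apply: (iso_prime (@mmultK n K)).
apply: gauss_irreducible_prime.
  move=> a a0; have [u [l [uu lP E]]] := mpoly_irreducible_factors a0.
  by exists u, l; split=> // q /lP/IH.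
exact: (iso_irreducible (@mmultK n K) (@muniK n K)).
Qed.

Lemma mpoly_factorial n : @factorial_domain {mpoly K[n]}.
Proof.
move=> a a0; have [u [l [uu lP E]]] := mpoly_irreducible_factors a0.
by exists u, l; split=> // q /lP/mpoly_irreducible_prime.
Qed.

End MpolyFactorial.

Section Vanishing.
Context {K : numClosedFieldType}.

Lemma poly_eq0_eval (p : {poly K}) : (forall a, p.[a] = 0) -> p = 0.
Proof.
move=> H; apply/eqP; apply: contraT => p0.
have := @max_poly_roots _ p [seq i%:R | i <- iota 0 (size p)] p0.
rewrite size_map size_iota ltnn; apply.
  by apply/allP => a _; rewrite /root H.
by rewrite map_inj_uniq ?iota_uniq // => i j /eqP; rewrite Num.Theory.eqr_nat => /eqP.
Qed.

Definition extend n (v : 'I_n -> K) (a : K) (i : 'I_n.+1) : K :=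
  if unlift ord_max i is Some j then v j else a.

Lemma extend_max n (v : 'I_n -> K) a : extend v a ord_max = a.
Proof. by rewrite /extend unlift_none. Qed.

Lemma extend_widen n (v : 'I_n -> K) a :
  extend v a \o widen_ord (leqnSn n) = v.
Proof.
apply/funext => i; rewrite /extend /=.
have -> : widen_ord (leqnSn n) i = lift ord_max i.
  by apply/val_inj; rewrite /= /bump leqNgt ltn_ord.
by rewrite liftK.
Qed.

Lemma meval_extend n (v : 'I_n -> K) a (p : {mpoly K[n.+1]}) :
  p.@[extend v a] = (map_poly (meval v) (muni p)).[a].
Proof. by rewrite meval_muni extend_widen extend_max. Qed.

Lemma mpoly_nonvanishing n (p : {mpoly K[n]}) : p != 0 -> exists v, p.@[v] != 0.
Proof.
elim: n p => [|n IH] p p0.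
  exists (fun=> 0); rewrite -[p]mpolyKC mevalC.
  by apply: contra_neq p0 => E; rewrite -[p]mpolyKC E mpolyC0.
have q0 : muni p != 0 by apply: contra_neq p0 => E; rewrite -[p]mmultK E rmorph0.
have [i ci] : exists i, (muni p)`_i != 0.
  by exists (size (muni p)).-1; rewrite -lead_coefE lead_coef_eq0.
have [v vi] := IH _ ci.
have [a ha] : exists a, (map_poly (meval v) (muni p)).[a] != 0.
  apply: contrapT => H; move: vi; rewrite -coef_map /= (poly_eq0_eval (p := map_poly _ _)) ?coef0 ?eqxx // => a.
  by apply/eqP/negPn/negP => ha; apply: H; exists a.
by exists (extend v a); rewrite meval_extend.
Qed.

(** Induction on n, the last variable being singled out. If p involves it and
   does not divide g, there is a nonzero c in the other variables that
   vanishes at all v over which p and g have a common root. Over a point v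
   where neither c nor the leading coefficient of p vanishes, p has a root,
   which is then a root of g: a contradiction. If p does not involve it,
   apply the induction hypothesis to the coefficients of g. *)
Lemma irreducible_nullstellensatz n (p g : {mpoly K[n]}) :
  irreducible_element p -> (forall v, p.@[v] = 0 -> g.@[v] = 0) -> divides p g.
Proof.
elim: n p g => [|n IH] p g irrp pg.
  have [p0 pu _] := irrp; have := mpoly_msize_gt1 p0 pu.
  rewrite -[p]mpolyKC msizeC; by case: (_ != _).
have [_ _ pM] := mpoly_irreducible_prime irrp.
have irrP := iso_irreducible (@mmultK n K) (@muniK n K) irrp.
suff : divides (muni p) (muni g).
  by move=> [C E]; exists (mmult C); rewrite -[g]mmultK E rmorphM /= mmultK.
set P := muni p in irrP *; set G := muni g.
have evE v a : (map_poly (meval v) P).[a] = 0 -> (map_poly (meval v) G).[a] = 0.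
  by have := @pg (extend v a); rewrite !meval_extend.
have [P0 Pu irr] := irrP.
have [sP|sP] := leqP (size P) 1.
  have PE := size1_polyC sP.
  have irrp0 : irreducible_element P`_0.
    by apply: irreducible_polyC_inv; rewrite -PE.
  rewrite PE; apply: divides_polyC => i; apply: IH irrp0 _ => v Pv.
  rewrite -coef_map /= (poly_eq0_eval (p := map_poly _ _)) ?coef0 // => a.
  by apply: evE; rewrite PE map_polyC /= Pv hornerC.
have [//|cop] := irreducible_dvd_or_coprime (@mpoly_factorial _ _) G irrP sP.
have [c c0 cE] := coprimep_common_zero cop.
have lP : lead_coef P != 0 by rewrite lead_coef_eq0.
have [v] := mpoly_nonvanishing (mulf_neq0 c0 lP).
rewrite mevalM mulf_eq0 negb_or => /andP[cv lv].
have sPv : size (map_poly (meval v) P) = size P by rewrite size_map_poly_id0.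
have /closed_rootP[a] : size (map_poly (meval v) P) != 1%N by rewrite sPv gtn_eqF.
rewrite /root => /eqP Pa; have Ga := evE _ _ Pa.
by rewrite (cE _ (meval v) a Pa Ga) eqxx in cv.
Qed.

End Vanishing.

(** * Taylor expansions and homogeneous components *)

(** The expansion of p at x + T z, a polynomial in T whose coefficients are
   polynomials in the direction z. At x = 0 its coefficients are the
   homogeneous components of p, and at any x those of its Taylor expansion. *)
HB.lock Definition expand (n : nat) (K : comNzRingType) (x : 'I_n -> K)
    (p : {mpoly K[n]}) : {poly {mpoly K[n]}} :=
  mmap (@polyC _ \o @mpolyC n K) (fun i => (x i)%:MP%:P + ('X_i)%:P * 'X) p.

Section Expansion.
Context {n : nat} {K : comNzRingType}.
Implicit Types (p q : {mpoly K[n]}) (x : 'I_n -> K).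

Lemma expand_is_zmod_morphism x : zmod_morphism (expand x).
Proof. by rewrite expand.unlock => p q; rewrite raddfB. Qed.

Lemma expand_is_monoid_morphism x : monoid_morphism (expand x).
Proof. by rewrite expand.unlock; split=> [|p q]; rewrite ?rmorph1 ?rmorphM. Qed.

HB.instance Definition _ x :=
  GRing.isZmodMorphism.Build _ _ (expand x) (expand_is_zmod_morphism x).
HB.instance Definition _ x :=
  GRing.isMonoidMorphism.Build _ _ (expand x) (expand_is_monoid_morphism x).

Lemma expandM x : {morph expand x : p q / p * q}.
Proof. exact: rmorphM. Qed.

Lemma expandD x : {morph expand x : p q / p + q}.
Proof. exact: rmorphD. Qed.

Lemma expandC x c : expand x c%:MP = c%:MP%:P.
Proof. by rewrite expand.unlock mmapC. Qed.

Lemma expandX x i : expand x 'X_i = (x i)%:MP%:P + ('X_i)%:P * 'X.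
Proof. by rewrite expand.unlock mmapX mmap1U. Qed.

Lemma expand_coef0 x p : (expand x p)`_0 = (p.@[x])%:MP.
Proof.
pose psi := (horner_eval 0 \o expand x).
have E := @mpoly_morph_ext _ _ _ psi (@mpolyC n K \o meval x).
rewrite -horner_coef0; apply: E => [c|i] /=.
  by rewrite /psi /= /horner_eval expandC hornerC mevalC.
by rewrite /psi /= /horner_eval expandX mevalXU !hornerE ?mulr0 ?addr0.
Qed.

Lemma expand0X (m : 'X_{1..n}) : expand (fun=> 0 : K) 'X_[m] = ('X_[m])%:P * 'X^(mdeg m).
Proof.
rewrite mpolyXE_id !rmorph_prod /= mdegE expr_sum -big_split /=.
apply: eq_bigr => i _; rewrite !rmorphXn /= expandX mpolyC0 polyC0 add0r.
by rewrite exprMn.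
Qed.

(** Since expand is a ring morphism, this reduces products of homogeneous
   components to products of univariate polynomials. *)
Lemma coef_expand0 p i : (expand (fun=> 0) p)`_i = pihomog mdeg i p.
Proof.
rewrite {1}(mpolyE p) rmorph_sum coef_sum /pihomog [RHS]big_mkcond /=.
apply: eq_bigr => m _; rewrite -mul_mpolyC expandM expandC expand0X.
rewrite mulrA -polyCM coefCM coefXn eq_sym.
by case: eqP => _; rewrite ?mulr1 ?mulr0.
Qed.

Lemma pihomogM p q k :
  pihomog mdeg k (p * q) =
  \sum_(i < k.+1) pihomog mdeg i p * pihomog mdeg (k - i) q.
Proof.
rewrite -coef_expand0 expandM coefM; apply: eq_bigr => i _.
by congr (_ * _); exact: coef_expand0.
Qed.

Lemma expand0_homog d p : p \is d.-homog -> expand (fun=> 0) p = p%:P * 'X^d.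
Proof.
move=> hp; apply/polyP => i; rewrite coef_expand0 coefCM coefXn.
have [->|ne] := eqVneq i d; first by rewrite mulr1 pihomog_dE.
by rewrite mulr0 (pihomog_ne0 _ hp) // eq_sym.
Qed.

Lemma pihomogM_homog p q d k : q \is d.-homog ->
  pihomog mdeg (k + d) (p * q) = pihomog mdeg k p * q.
Proof.
move=> hq; rewrite -coef_expand0 expandM /= (expand0_homog hq).
rewrite mulrA coefMXn ltnNge leq_addl addnK /= mulrC coefCM mulrC.
by rewrite coef_expand0.
Qed.

Lemma pihomogM_homog_lt p q d k : q \is d.-homog -> (k < d)%N ->
  pihomog mdeg k (p * q) = 0.
Proof.
move=> hq lt; rewrite -coef_expand0 expandM /= (expand0_homog hq).
by rewrite mulrA coefMXn lt.
Qed.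

Lemma mpoly_sum_pihomog p : p = \sum_(i < msize p) pihomog mdeg i p.
Proof. exact: pihomog_partitionE. Qed.

Lemma homog_mdeg d p m : p \is d.-homog -> m \in msupp p -> mdeg m = d.
Proof. by move=> /dhomogP hp /hp. Qed.

Lemma meval_homogZ d p c x : p \is d.-homog ->
  p.@[fun i => c * x i] = c ^+ d * p.@[x].
Proof.
move=> hp; rewrite !mevalE big_distrr /= !big_seq.
apply: eq_bigr => m /(homog_mdeg hp) <-; rewrite mulrCA; congr (_ * _).
rewrite mdegE expr_sum -big_split /=; apply: eq_bigr => i _.
by rewrite exprMn.
Qed.

Lemma meval_homog0 d p : p \is d.+1.-homog -> p.@[fun=> 0] = 0.
Proof.
move=> hp; have := @meval_homogZ d.+1 p 0 (fun=> 0) hp.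
by rewrite exprS !mul0r.
Qed.

Lemma homog0_const p : p \is 0.-homog -> p = (p@_0)%:MP.
Proof.
move=> hp; apply: msize1_polyC; rewrite msizeE.
by apply/bigmax_leqP_seq => m /(homog_mdeg hp) ->.
Qed.

Lemma euler_homog d p : p \is d.-homog ->
  \sum_i 'X_i * p^`M(i) = p *+ d.
Proof.
move=> hp; rewrite [p in RHS]mpolyE -sumrMnl.
rewrite (eq_bigr (fun i => \sum_(m <- msupp p) (p@_m *: 'X_[m]) *+ m i)).
  rewrite exchange_big /= !big_seq; apply: eq_bigr => m /(homog_mdeg hp) <-.
  by rewrite mdegE -sumrMnr.
move=> i _; rewrite {1}(mpolyE p) raddf_sum big_distrr /=.
apply: eq_bigr => m _; rewrite mderivZ mderivX scaler_nat -scalerAr mulrnAr.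
rewrite -mpolyXD -scalerMnr; have [->|mi] := posnP (m i); first by rewrite !mulr0n.
by rewrite addmC submK // lep1mP -lt0n.
Qed.

Lemma dhomog_deriv d p i : p \is d.-homog -> p^`M(i) \is d.-1.-homog.
Proof.
move=> hp; apply/dhomogP => m; rewrite mcoeff_msupp mcoeff_deriv => ne.
have /(homog_mdeg hp) : (m + U_(i))%MM \in msupp p.
  by rewrite mcoeff_msupp; apply: contra_neq ne => ->; rewrite mul0rn.
by rewrite mdegD mdeg1 addn1 => <-.
Qed.

End Expansion.

Section HomogeneousFactors.
Context {n : nat} {K : idomainType}.

Lemma monomial_factor (R : idomainType) (A B : {poly R}) c d :
  c != 0 -> A * B = c%:P * 'X^d -> exists a i, A = a%:P * 'X^i.
Proof.
move=> c0; elim: d A B => [|d IH] A B.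
  rewrite expr0 mulr1 => E; exists (A`_0), 0%N; rewrite expr0 mulr1.
  have AB0 : A * B != 0 by rewrite E polyC_eq0.
  have [A0 B0] : A != 0 /\ B != 0 by apply/andP; rewrite -negb_or -mulf_eq0.
  have : size (A * B) = 1%N by rewrite E size_polyC c0.
  rewrite size_mul // => sAB; apply: size1_polyC.
  by move: A0 B0 sAB; rewrite -!size_poly_gt0; lia.
have XI : injective (fun P : {poly R} => P * 'X) by apply: mulIf; rewrite polyX_eq0.
have fX (P : {poly R}) : P`_0 = 0 -> exists Q, P = Q * 'X.
  move=> P0; have /factor_theorem[Q] : root P 0 by rewrite /root horner_coef0 P0.
  by rewrite subr0; exists Q.
move=> E; have : (A * B)`_0 = 0 by rewrite E exprSr mulrA coefMX.
rewrite coefM big_ord1 /= => /eqP; rewrite mulf_eq0 => /orP[] /eqP /fX[Q EQ].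
  have : Q * B = c%:P * 'X^d.
    by apply: XI; rewrite -[RHS]mulrA -exprSr -E EQ -!mulrA [B * _]mulrC.
  by case/IH => a [i Ei]; exists a, i.+1; rewrite EQ Ei exprSr mulrA.
by apply: (IH A Q); apply: XI; rewrite -[RHS]mulrA -exprSr -E EQ mulrA.
Qed.

(** The expansion of a form at 0 is a monomial in T, hence so are the
   expansions of its factors. *)
Lemma homog_factor (a b : {mpoly K[n]}) d : a * b != 0 ->
  a * b \is d.-homog -> exists e, a \is e.-homog.
Proof.
move=> ab0 hab; have := expand0_homog hab; rewrite expandM.
case/(monomial_factor ab0) => c [i E]; exists i.
suff {1}-> : a = c.
  by have := pihomogP mdeg i a; rewrite -coef_expand0 /= E coefCM coefXn eqxx mulr1.
pose psi := (horner_eval 1 \o @expand n K (fun=> 0)).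
have aE : psi =1 @idfun {mpoly K[n]}.
  apply: mpoly_morph_ext => [e|j]; rewrite /psi /= /horner_eval.
    by rewrite expandC hornerC.
  by rewrite expandX mpolyC0 polyC0 add0r !hornerE.
by rewrite -[LHS]aE /psi /= /horner_eval E !hornerE expr1n mulr1.
Qed.

End HomogeneousFactors.

(** * The projective Nullstellensatz *)

Section IdealSets.
Context {A : comNzRingType}.
Implicit Types (I : set A) (a b : A).

Definition is_ideal I :=
  [/\ I 0, forall a b, I a -> I b -> I (a + b) & forall c a, I a -> I (c * a)].

Definition radical I a := exists N, I (a ^+ N).

Lemma ideal_sum I (T : Type) (s : seq T) (p : pred T) (F : T -> A) :
  is_ideal I -> (forall i, p i -> I (F i)) -> I (\sum_(i <- s | p i) F i).
Proof. by move=> [I0 ID _] IF; elim/big_rec: _ => // i x pi; apply: ID; apply: IF. Qed.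

Lemma idealB I a b : is_ideal I -> I a -> I b -> I (a - b).
Proof. by move=> [_ ID IM] Ia Ib; apply: ID => //; rewrite -mulN1r; apply: IM. Qed.

Lemma ideal_expr_le I a (m n : nat) :
  is_ideal I -> I (a ^+ m) -> (m <= n)%N -> I (a ^+ n).
Proof. by move=> [_ _ IM] Ia le; rewrite -(subnK le) exprD; apply: IM. Qed.

Lemma radical_ideal I : is_ideal I -> is_ideal (radical I).
Proof.
move=> hI; have [I0 ID IM] := hI; split; first by exists 1%N; rewrite expr1.
  move=> a b [N IN] [M IMb]; exists (N + M)%N; rewrite exprDn.
  apply: ideal_sum => // i _; rewrite -mulr_natl; apply: (IM).
  have [le|lt] := leqP M i; first by apply: (IM); apply: ideal_expr_le IMb le.
  rewrite mulrC; apply: IM; apply: ideal_expr_le IN _ => //.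
  by have := ltn_ord i; lia.
by move=> c a [N IN]; exists N; rewrite exprMn; apply: IM.
Qed.

Lemma sub_radical I a : I a -> radical I a.
Proof. by exists 1%N; rewrite expr1. Qed.

Lemma radical_expr I a k : radical I (a ^+ k) -> radical I a.
Proof. by move=> [N IN]; exists (k * N)%N; rewrite exprM. Qed.

Lemma ideal_gen_is_ideal (T : finType) (t : T -> A) :
  is_ideal (ideal_gen setT t).
Proof.
split.
- by exists (fun=> 0) => //; rewrite big1 // => i _; rewrite mul0r.
- move=> a b [c _ ->] [c' _ ->]; exists (fun i => c i + c' i) => //.
  by rewrite -big_split; apply: eq_bigr => i _; rewrite mulrDl.
move=> e a [c _ ->]; exists (fun i => e * c i) => //.
by rewrite big_distrr; apply: eq_bigr => i _; rewrite /= mulrA.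
Qed.

Lemma ideal_gen_mem (T : finType) (t : T -> A) i : ideal_gen setT t (t i).
Proof.
exists (fun j => (j == i)%:R) => //; rewrite (bigD1 i) //= eqxx mul1r.
by rewrite big1 ?addr0 // => j /negbTE->; rewrite mul0r.
Qed.

End IdealSets.

(** A nonzero element of Q of minimal size generates Q, hence has no root. *)
Lemma poly_ideal_unit (K : fieldType) (Q : set {poly K}) : is_ideal Q ->
  (forall p : {poly K}, size p != 1%N -> exists a, root p a) ->
  (forall a, exists2 q : {poly K}, Q q & q.[a] != 0) -> Q 1.
Proof.
move=> hQ closedK nz; have [Q0 QD QM] := hQ.
have [q0 Qq0 q00] := nz 0.
have exn : exists n, `[< exists q : {poly K}, [/\ Q q, q != 0 & size q = n] >].
  exists (size q0); apply/asboolP; exists q0; split=> //.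
  by apply: contra_neq q00 => ->; rewrite horner0.
case: (ex_minnP exn) => n /asboolP[q [Qq qn0 sq]] minn.
have [s1|/closedK[a ra]] := eqVneq (size q) 1%N.
  have /eqP/size_poly1P[c c0 E] := s1.
  rewrite (_ : 1 = c^-1%:P * q); first exact: QM.
  by rewrite E -polyCM mulVf.
have [p Qp pa] := nz a.
have Qr : Q (p %% q).
  have -> : p %% q = p - p %/ q * q.
    by apply/eqP; rewrite eq_sym subr_eq addrC -divp_eq.
  by apply: idealB => //; apply: QM.
have r0 : p %% q = 0.
  apply: contrapT => /eqP r0; have /minn : `[< exists q' : {poly K}, [/\ Q q', q' != 0 & size q' = size (p %% q)] >].
    by apply/asboolP; exists (p %% q).
  by rewrite -sq leqNgt ltn_modp qn0.
by move: pa; rewrite (divp_eq p q) r0 addr0 hornerM (rootP ra) mulr0 eqxx.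
Qed.

#[local] Opaque muni mmult mwiden pihomog.

Section ProjectiveNullstellensatz.
Context {K : numClosedFieldType}.

Definition homogeneous_ideal n (I : set {mpoly K[n]}) :=
  is_ideal I /\ forall p i, I p -> I (pihomog mdeg i p).

Lemma mwidenX_ord n (m : 'X_{1..n}) : mdeg (mnmwiden m) = mdeg m.
Proof.
rewrite !mdegE big_ord_recr /= mnmwiden_ordmax addn0.
by apply: eq_bigr => i _; rewrite mnmwiden_widen.
Qed.

Lemma pihomog_mwiden n (p : {mpoly K[n]}) i :
  pihomog mdeg i (mwiden p) = mwiden (pihomog mdeg i p).
Proof.
elim/mpolyind: p => [|c m p _ _ IH]; first by rewrite !(mwiden0, pihomog0).
rewrite mwidenD !pihomogD mwidenD IH; congr (_ + _).
rewrite mwidenZ mwidenX !linearZ /= mwidenZ !pihomogX.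
by rewrite /= mwidenX_ord; case: (mdeg m == i); rewrite ?mwidenX ?mwiden0.
Qed.

Lemma coef_muni_homog n d (p : {mpoly K[n.+1]}) i : p \is d.-homog ->
  (i <= d)%N -> (muni p)`_i \is (d - i).-homog.
Proof.
move=> hp le; rewrite muniE coef_sum big_seq; apply: rpred_sum => m mp.
rewrite coefZ coefXn; case: eqP => [Ei|_]; last by rewrite mulr0 rpred0.
rewrite mulr1; apply: rpredZ; rewrite dhomogX /=.
have := homog_mdeg hp mp; rewrite !mdegE big_ord_recr /= -Ei => <-.
by rewrite addnK; apply/eqP/eq_bigr => j _; rewrite mnmE.
Qed.

Lemma size_muni_homog n d (p : {mpoly K[n.+1]}) : p \is d.-homog ->
  (size (muni p) <= d.+1)%N.
Proof.
move=> hp; apply/leq_sizeP => i lt; rewrite muniE coef_sum big_seq big1 //.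
move=> m mp; rewrite coefZ coefXn; case: eqP => [Ei|_]; last by rewrite mulr0.
by have := homog_mdeg hp mp; rewrite mdegE big_ord_recr /= -Ei; move: lt; lia.
Qed.

(** Evaluation at (0, ..., 0, 1) kills all the monomials of degree d except
   the power of the last variable. *)
Lemma muni_homog_lead n d (p : {mpoly K[n.+1]}) : p \is d.-homog ->
  let c := p.@[extend (fun=> 0) 1] in c != 0 ->
  size (muni p) = d.+1 /\ lead_coef (muni p) = c%:MP.
Proof.
move=> hp c c0; have sp := size_muni_homog hp.
have Ec : (muni p)`_d = c%:MP.
  have := coef_muni_homog hp (leqnn d); rewrite subnn => /homog0_const h.
  rewrite h; congr (_%:MP); rewrite /c meval_extend; set q := map_poly _ _.
  have le2 : (size q <= d.+1)%N by apply: leq_trans sp; apply: size_poly.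
  rewrite (horner_coef_wide _ le2) big_ord_recr /= big1 ?add0r.
    by rewrite expr1n mulr1 coef_map /= [in RHS]h mevalC.
  move=> i _; rewrite coef_map /= expr1n mulr1.
  have := coef_muni_homog hp (ltnW (ltn_ord i)).
  by rewrite -(prednK (_ : 0 < d - i)%N) ?subn_gt0 //; exact: meval_homog0.
have sE : size (muni p) = d.+1.
  apply/eqP; rewrite eqn_leq sp ltnNge; apply/negP => /leq_sizeP/(_ d (leqnn d)).
  by rewrite Ec => /eqP; rewrite mpolyC_eq0 (negbTE c0).
by rewrite lead_coefE sE.
Qed.

Lemma homog_pos_ideal n (I : set {mpoly K[n]}) d p : is_ideal I ->
  (forall i, I 'X_i) -> p \is d.+1.-homog -> I p.
Proof.
move=> hI IX hp; have [_ _ IM] := hI; rewrite (mpolyE p) big_seq.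
apply: ideal_sum => // m /(homog_mdeg hp) dm; rewrite -mul_mpolyC; apply: (IM).
have [i mi] : exists i, m i != 0%N.
  apply: contrapT => H; have : mdeg m = 0%N.
    rewrite mdegE big1 // => i _; apply/eqP/negPn/negP => mi.
    by apply: H; exists i.
  by rewrite dm.
by rewrite -(submK (_ : (U_(i) <= m)%MM)) ?lep1mP // mpolyXD; apply: IM.
Qed.

Lemma elimination_ideal n (I : set {mpoly K[n.+1]}) :
  homogeneous_ideal I -> homogeneous_ideal (@mwiden n K @^-1` I).
Proof.
move=> [[I0 ID IM] Ih]; split; last first.
  by move=> p i /=; rewrite -pihomog_mwiden; apply: Ih.
split=> /=; first by rewrite mwiden0.
  by move=> a b; rewrite mwidenD; apply: ID.
by move=> c a; rewrite mwidenM; apply: IM.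
Qed.

Lemma resultant_map (S : nzRingType) (phi : {rmorphism S -> K}) (p q : {poly S}) :
  phi (lead_coef p) != 0 -> phi (lead_coef q) != 0 ->
  phi (resultant p q) = resultant (map_poly phi p) (map_poly phi q).
Proof.
move=> nz_p nz_q; rewrite /resultant /Sylvester_mx !size_map_poly_id0 //.
rewrite -det_map_mx /= map_col_mx; congr (\det (col_mx _ _));
  by apply: map_lin1_mx => v; rewrite map_poly_rV rmorphM /= map_rVpoly.
Qed.

(** The degree of P may drop under phi, and then the resultant does not
   commute with phi. Adding to P the multiple 'X^(size P) * G of G, whose
   leading coefficient survives, cures this without changing the ideal
   generated by G and P. *)
Lemma resultant_nonvanishing (S : idomainType) (phi : {rmorphism S -> K})
    (G P : {poly S}) :
  (1 < size G)%N -> phi (lead_coef G) != 0 -> map_poly phi P = 1 ->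
  exists U V b, b%:P = U * G + V * P /\ phi b != 0.
Proof.
move=> sG lG mP; pose XG := ('X^(size P) * G)%R; pose P' := P + XG.
have G0 : G != 0 by rewrite -size_poly_gt0 ltnW.
have sXG : size XG = (size P + size G)%N by rewrite /XG mulrC size_mulXn.
have ltk : (size P < size XG)%N by rewrite sXG; move: sG; lia.
have lP' : lead_coef P' = lead_coef G.
  by rewrite /P' addrC lead_coefDl // lead_coefM lead_coefXn mul1r.
have sP' : (1 < size P')%N.
  by rewrite /P' addrC size_polyDl // sXG; move: sG; lia.
have [[U V] /= _ E] := resultant_in_ideal sG sP'.
exists (U + V * 'X^(size P)), V, (resultant G P'); split.
  by rewrite E /P' /XG mulrDl mulrDr mulrA addrAC addrA.
rewrite resultant_map ?lP' // resultant_eq0 -leqNgt.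
have -> : map_poly phi P' = 'X^(size P) * map_poly phi G + 1.
  by rewrite rmorphD /= mP rmorphM /= map_polyXn addrC.
have := coprimep1 (map_poly phi G).
by rewrite -(coprimep_addl_mul 'X^(size P)) coprimep_def => /eqP->.
Qed.

Lemma elimination n (v : 'I_n -> K) (g p : {mpoly K[n.+1]}) :
  (1 < size (muni g))%N -> (lead_coef (muni g)).@[v] != 0 ->
  map_poly (meval v) (muni p) = 1 ->
  exists a b c, mwiden c = a * g + b * p /\ c.@[v] != 0.
Proof.
move=> sg lg mp.
have [U [V [c [cE c0]]]] := @resultant_nonvanishing _ (meval v) (muni g) (muni p) sg lg mp.
exists (mmult U), (mmult V), c; split; last exact: c0.
have E1 : mmult (U * muni g) = mmult U * mmult (muni g). exact: mmultM.
have E2 : mmult (V * muni p) = mmult V * mmult (muni p). exact: mmultM.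
rewrite (mmultK g) in E1.
rewrite (mmultK p) in E2.
by rewrite -E1 -E2 -mmultD -mmultC; congr mmult.
Qed.

(** Induction on n. By hypothesis at (0, ..., 0, 1), I contains a form g
   whose leading coefficient in the last variable is a constant. Given v <>
   0, the elements of I restricted to the line over v have no common zero,
   so that some p in I restricts to 1; the resultant of g and p is then an
   element of I without the last variable, nonzero at v. By induction the
   radical of I contains all variables but the last, and then also the last
   one because of g. *)
Lemma nullstellensatz_radical n (I : set {mpoly K[n]}) : homogeneous_ideal I ->
  (forall x : 'I_n -> K, (exists i, x i != 0) -> exists2 p, I p & p.@[x] != 0) ->
  forall i, radical I 'X_i.
Proof.
elim: n I => [|n IH] I hI nz; first by case.
have [hI' Ih] := hI; have [I0 ID IM] := hI'.
have hrad := radical_ideal hI'; have [rad0 radD radM] := hrad.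
pose e : 'I_n.+1 -> K := extend (fun=> 0) 1.
have [g [d [Ig hg ge]]] : exists g d, [/\ I g, g \is d.+1.-homog & g.@[e] != 0].
  have [|p Ip pe] := nz e; first by exists ord_max; rewrite /e extend_max oner_neq0.
  have [i ie] : exists i : 'I_(msize p), (pihomog mdeg i p).@[e] != 0.
    apply: contrapT => H; move: pe; rewrite [X in X.@[_]]mpoly_sum_pihomog.
    rewrite raddf_sum /= big1 ?eqxx // => i _; apply/eqP/negPn/negP => ie.
    by apply: H; exists i.
  exists ('X_ord_max * pihomog mdeg i p), i; split.
  - by apply: IM; apply: Ih.
  - by apply: (@dhomogM _ _ _ 1); [rewrite dhomogX /= mdeg1|apply: pihomogP].
  by rewrite mevalM mevalXU /e extend_max mul1r.
have [sg lg] := muni_homog_lead hg ge; rewrite -/e in lg.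
have radX j : radical I 'X_(widen_ord (leqnSn n) j).
  have [N] : radical (@mwiden n K @^-1` I) 'X_j.
    apply: IH; first exact: elimination_ideal.
    move=> v [i0 vi0]; pose phi := @meval n K v.
    pose Q : set {poly K} := [set q | exists2 p, I p & q = map_poly phi (muni p)].
    have Q1 : Q 1.
      apply: poly_ideal_unit.
      - split; first by exists 0; rewrite ?muni0 ?map_poly0.
          move=> _ _ [p Ip ->] [q Iq ->]; exists (p + q); first exact: ID.
          by rewrite !rmorphD.
        move=> c _ [p Ip ->]; exists (mmult (map_poly (@mpolyC n K) c) * p); first exact: IM.
        rewrite !rmorphM /= muniK -map_poly_comp; congr (_ * _).
        have phiC : phi \o @mpolyC n K =1 idfun by move=> x; exact: mevalC.
        by rewrite (eq_map_poly phiC) map_poly_id.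
      - by move=> p /closed_rootP.
      move=> a; have [|p Ip pa] := nz (extend v a).
        by exists (widen_ord (leqnSn n) i0); rewrite -[extend _ _ _]/((extend v a \o _) i0) extend_widen.
      by exists (map_poly phi (muni p)); [exists p|rewrite -meval_extend].
    have [p Ip mp] := Q1.
    have [||a [b [c [cE c0]]]] := @elimination _ v g p _ _ (esym mp).
    - by rewrite sg.
    - by rewrite lg mevalC.
    exists c; last exact: c0.
    suff : I (mwiden c) by [].
    by rewrite cE; apply: ID; apply: IM.
  by rewrite /= rmorphXn /= mwidenXU; exists N.
move=> i; have [->|[j ->]] := ord_widen_max i; last exact: radX.
apply: (@radical_expr _ _ _ d.+1).
have cU : g.@[e]%:MP_[n.+1] \is a GRing.unit by rewrite rmorph_unit // unitfE.
rewrite -[_ ^+ _](mulKr cU); apply: (radM).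
have Eg : g = \sum_(i < d.+2) mwiden (muni g)`_i * 'X_ord_max ^+ i.
  by apply: muni_expansion; rewrite sg.
have -> : (g.@[e])%:MP * 'X_ord_max ^+ d.+1 =
    g - \sum_(i < d.+1) mwiden (muni g)`_i * 'X_ord_max ^+ i.
  rewrite {2}Eg big_ord_recr /= addrC addrK; congr (_ * _).
  by rewrite -mwidenC -lg lead_coefE sg.
apply: idealB => //; first exact: sub_radical.
apply: ideal_sum => // k _; rewrite mulrC; apply: (radM).
apply: (@homog_pos_ideal _ (@mwiden n K @^-1` radical I) (d - k)).
- split=> /=; first by rewrite mwiden0.
    by move=> a b; rewrite mwidenD; apply: radD.
  by move=> c a; rewrite mwidenM; apply: radM.
- by move=> j /=; rewrite mwidenXU; apply: radX.
rewrite -subSn ?leq_ord //; apply: coef_muni_homog hg _.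
by rewrite ltnW.
Qed.

(** The largest homogeneous ideal contained in I. *)
Definition homog_part n (I : set {mpoly K[n]}) : set {mpoly K[n]} :=
  [set p | forall i, I (pihomog mdeg i p)].

Lemma homog_part_homogeneous n (I : set {mpoly K[n]}) :
  is_ideal I -> homogeneous_ideal (homog_part I).
Proof.
move=> hI; have [I0 ID IM] := hI; split; last first.
  move=> p i Ip j; have [->|ne] := eqVneq i j; first by rewrite pihomog_id.
  by rewrite (pihomog_ne0 ne (pihomogP _ _ _)).
split=> [i|a b Ia Ib i|c a Ia i]; first by rewrite pihomog0.
  by rewrite pihomogD; apply: ID.
by rewrite pihomogM; apply: ideal_sum => // j _; apply: IM.
Qed.

(** The homogeneous elements of I lie in homog_part I, so this follows from
   the case of homogeneous ideals; a common exponent exists as there are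
   finitely many variables. *)
Theorem projective_nullstellensatz n (I : set {mpoly K[n]}) : is_ideal I ->
  (forall x : 'I_n -> K, (exists i, x i != 0) ->
     exists2 p, I p & (exists d, p \is d.-homog) /\ p.@[x] != 0) ->
  exists N, forall i, I ('X_i ^+ N).
Proof.
move=> hI nz; have rX := nullstellensatz_radical (homog_part_homogeneous hI).
have {rX}/choice[N NP] : forall i, exists N, I ('X_i ^+ N).
  move=> i; have [|N IN] := rX _ i.
    move=> x /nz[p Ip [[d hp] px]]; exists p => // j.
    have [<-|ne] := eqVneq d j; first by rewrite pihomog_dE.
    by rewrite (pihomog_ne0 ne hp); case: hI.
  exists N; rewrite -[_ ^+ N](pihomog_dE (mf := mdeg) (d := 1 * N)) //.
  by apply: dhomogMn; rewrite dhomogX /= mdeg1.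
exists (\max_i N i) => i; apply: ideal_expr_le (NP i) _ => //.
exact: leq_bigmax.
Qed.

End ProjectiveNullstellensatz.

(** * Linear forms regular modulo the factors of a form *)

Section RegularSequences.
Context {S : idomainType}.

Lemma prime_power_regular (y z : S) M N a : prime_element y -> ~ divides y z ->
  divides (y ^+ M) (z ^+ N * a) -> divides (y ^+ M) a.
Proof.
move=> [y0 yu yM] nyz; elim: M => [|M IH] d.
  by exists a; rewrite expr0 mulr1.
have [|a' Ea] := IH.
  by apply: divides_trans d; exists y; rewrite exprS.
case: d => c; rewrite {}Ea exprS mulrA [c * _]mulrA => /(mulIf (expf_neq0 M y0)) E.
have : divides y (z ^+ N * a') by exists c.
have nyzN k : ~ divides y (z ^+ k).
  elim: k => [|k IHk]; last by rewrite exprS => /yM[].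
  by move=> d; move: (divides_unit (unitr1 S) d); apply/negP.
by case/yM => [/nyzN //|[e ->]]; exists e; rewrite -mulrA.
Qed.

Lemma divides_small (F C : {poly S}) :
  divides F C -> (size C < size F)%N -> C = 0.
Proof.
move=> [Q ->] lt; apply/eqP; apply: contraLR lt.
rewrite mulf_eq0 negb_or => /andP[Q0 F0]; rewrite size_mul //.
by move: Q0 F0; rewrite -!size_poly_gt0; lia.
Qed.

Lemma unit_lead_division (F A : {poly S}) : lead_coef F \is a GRing.unit ->
  exists Q R, A = Q * F + R /\ (size R < size F)%N.
Proof.
move=> uF; pose F' := (lead_coef F)^-1 *: F.
have uV : (lead_coef F)^-1 != 0.
  by apply: contraTneq uF => E; rewrite -[lead_coef F]invrK E invr0 unitr0.
have mF : F' \is monic by rewrite monicE lead_coefZ mulVr.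
exists ((lead_coef F)^-1 *: Pdiv.Ring.rdivp A F'), (Pdiv.Ring.rmodp A F'); split.
  rewrite {1}(Pdiv.RingMonic.rdivp_eq mF A); congr (_ + _).
  by rewrite -scalerAl -scalerAr.
by rewrite -(size_scale F uV) Pdiv.Ring.ltn_rmodpN0 // monic_neq0.
Qed.

Variables (F : {poly S}) (y z : S).
Hypotheses (unitF : lead_coef F \is a GRing.unit)
  (primey : prime_element y) (nyz : ~ divides y z).

Lemma monic_regular1 N A : divides F (y%:P ^+ N * A) -> divides F A.
Proof.
have [Q [R [-> ltR]]] := unit_lead_division A unitF.
have [y0 _ _] := primey; have yN0 : y ^+ N != 0 by rewrite expf_neq0.
rewrite mulrDr mulrA => [d].
have dR : divides F ((y ^+ N)%:P * R).
  have -> : (y ^+ N)%:P * R = (y%:P ^+ N * Q * F + y%:P ^+ N * R) - y%:P ^+ N * Q * F.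
    by rewrite addrC addKr polyC_exp.
  by apply: dividesB => //; exists (y%:P ^+ N * Q).
have sR : (size ((y ^+ N)%:P * R)%R < size F)%N by rewrite size_Cmul.
have /eqP := divides_small dR sR; rewrite mulf_eq0 polyC_eq0 (negbTE yN0) /=.
by move/eqP->; rewrite addr0; exists Q.
Qed.

(** Division by F makes {poly S} / (F) a free S-module, on which the regular
   sequence y ^ N, z ^ N of S remains regular. *)
Lemma monic_regular2 N A B : divides F (z%:P ^+ N * A - y%:P ^+ N * B) ->
  exists G, divides F (A - y%:P ^+ N * G).
Proof.
have [Q [R [-> ltR]]] := unit_lead_division A unitF.
have [Q' [R' [-> ltR']]] := unit_lead_division B unitF.
rewrite -!polyC_exp => d; set u := z ^+ N in d *; set w := y ^+ N in d *.
have dR : divides F (u%:P * R - w%:P * R').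
  have -> : u%:P * R - w%:P * R' =
      (u%:P * (Q * F + R) - w%:P * (Q' * F + R')) - (u%:P * Q - w%:P * Q') * F.
    by ring.
  by apply: dividesB => //; exists (u%:P * Q - w%:P * Q').
have E : u%:P * R - w%:P * R' = 0.
  apply: divides_small dR _; apply: leq_ltn_trans (size_polyD _ _) _.
  rewrite size_polyN gtn_max !mul_polyC.
  by rewrite !(leq_ltn_trans (size_scale_leq _ _)).
have dw i : divides w R`_i.
  have := congr1 (fun P : {poly S} => P`_i) E; rewrite coefB !coefCM coef0.
  move=> /eqP; rewrite subr_eq0 => /eqP Ei.
  by apply: (@prime_power_regular y z N N) => //; rewrite Ei; exists R'`_i; rewrite mulrC.
have [G RE] := divides_polyC dw.
by exists G; exists Q; rewrite RE [G * _]mulrC addrK.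
Qed.

End RegularSequences.

(** For all N, the powers L0 ^ N, L1 ^ N form a regular sequence on A / (F),
   in the weak sense that the quotient by them may be zero. *)
Definition regular_on (A : comNzRingType) (L0 L1 F : A) :=
  (forall N a, divides F (L0 ^+ N * a) -> divides F a) /\
  (forall N a b, divides F (L1 ^+ N * a - L0 ^+ N * b) ->
     exists c, divides F (a - L0 ^+ N * c)).

Lemma regular_transport (S P : idomainType) (phi : {rmorphism P -> {poly S}})
    (psi : {rmorphism {poly S} -> P}) (y z : S) (F : P) :
  cancel phi psi -> cancel psi phi -> lead_coef (phi F) \is a GRing.unit ->
  prime_element y -> ~ divides y z -> regular_on (psi y%:P) (psi z%:P) F.
Proof.
move=> phiK psiK uF py nyz.
have dE A : divides (phi F) (phi A) -> divides F A.
  by move=> [C E]; exists (psi C); rewrite -[A]phiK E rmorphM phiK.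
have dE' A : divides F A -> divides (phi F) (phi A).
  by move=> [C ->]; exists (phi C); rewrite rmorphM.
split=> [N A /dE'|N A B /dE'].
  by rewrite rmorphM rmorphXn psiK => /(monic_regular1 uF py)/dE.
rewrite rmorphB !rmorphM !rmorphXn !psiK => /(monic_regular2 uF py nyz)[G dG].
by exists (psi G); apply: dE; rewrite rmorphB rmorphM rmorphXn !psiK.
Qed.

Section LinearForms.
Context {K : numClosedFieldType} {n : nat}.
Implicit Types (p q : {mpoly K[n]}).

Lemma msize2_irreducible p : msize p = 2%N -> irreducible_element p.
Proof.
move=> sp; have p0 : p != 0 by rewrite -msize_poly_eq0 sp.
split=> //; first by rewrite mpoly_unitE sp.
move=> a b E; have /andP[a0 b0] : (a != 0) && (b != 0).
  by rewrite -negb_or -mulf_eq0 -E.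
move: sp; rewrite E msizeM // !mpoly_unitE.
have sa : (0 < msize a)%N by rewrite lt0n msize_poly_eq0.
have sb : (0 < msize b)%N by rewrite lt0n msize_poly_eq0.
move=> sab; have : msize a = 1%N \/ msize b = 1%N by lia.
by case=> ->; [left|right].
Qed.

Lemma homog1_irreducible p : p \is 1.-homog -> p != 0 -> irreducible_element p.
Proof.
move=> hp p0; apply: msize2_irreducible.
by rewrite -mlead_deg // (homog_mdeg hp) // mlead_supp.
Qed.

Definition subst (l : 'I_n -> {mpoly K[n]}) p := mmap (@mpolyC n K) l p.

HB.instance Definition _ l := GRing.RMorphism.copy (subst l) (subst l).

Lemma substC l c : subst l c%:MP = c%:MP.
Proof. by rewrite /subst mmapC. Qed.

Lemma substX l i : subst l 'X_i = l i.
Proof. by rewrite /subst mmapX mmap1U. Qed.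

Lemma substM l : {morph subst l : p q / p * q}.
Proof. exact: rmorphM. Qed.

Lemma substD l : {morph subst l : p q / p + q}.
Proof. exact: rmorphD. Qed.

Lemma substB l : {morph subst l : p q / p - q}.
Proof. exact: rmorphB. Qed.

Lemma meval_subst l p x : (subst l p).@[x] = p.@[fun i => (l i).@[x]].
Proof.
apply: (@mpoly_morph_ext _ _ _ (meval x \o subst l) (meval (fun i => (l i).@[x]))).
  by move=> c /=; rewrite substC !mevalC.
by move=> i /=; rewrite substX mevalXU.
Qed.

Lemma subst_homog l d p : (forall i, l i \is 1.-homog) -> p \is d.-homog ->
  subst l p \is d.-homog.
Proof.
move=> hl hp; rewrite /subst /mmap big_seq; apply: rpred_sum => m mp.
rewrite mul_mpolyC; apply: rpredZ; rewrite -(homog_mdeg hp mp) mdegE /mmap1.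
elim/big_ind2: _ => [|a i b j ha hb|i _]; first exact: dhomog1.
  exact: dhomogM.
by have := dhomogMn (m i) (hl i); rewrite mul1n.
Qed.

Lemma subst_id p : subst (fun i => 'X_i) p = p.
Proof.
apply: (@mpoly_morph_ext _ _ _ (subst (fun i => 'X_i)) idfun) => [c|i] /=.
  exact: substC.
exact: substX.
Qed.

Lemma subst_comp l l' p : subst l (subst l' p) = subst (fun i => subst l (l' i)) p.
Proof.
apply: (@mpoly_morph_ext _ _ _ (subst l \o subst l') (subst _)) => [c|i] /=.
  by rewrite !substC.
by rewrite !substX.
Qed.

End LinearForms.

Section RegularLines.
Context {K : numClosedFieldType} {m : nat}.
Local Notation S := {mpoly K[m.+2]}.
Local Notation P := {mpoly K[m.+3]}.

(** An invertible linear change of coordinates that sends (0, ..., 0, 1) to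
   p. *)
Lemma linear_change (p : 'I_m.+3 -> K) : p ord_max != 0 ->
  exists l l' : 'I_m.+3 -> P,
    [/\ forall i, l i \is 1.-homog, forall i, l' i \is 1.-homog,
        cancel (subst l) (subst l'), cancel (subst l') (subst l) &
        forall i, (l i).@[extend (fun=> 0) 1] = p i].
Proof.
move=> p0; pose Z : P := 'X_ord_max.
pose l i : P := if i == ord_max then p i *: Z else 'X_i + p i *: Z.
pose l' i : P := if i == ord_max then (p i)^-1 *: Z
                 else 'X_i - (p i / p ord_max) *: Z.
have hX i : 'X_i \is [in K[m.+3], 1.-homog] by rewrite dhomogX /= mdeg1.
have lZ : l ord_max = p ord_max *: Z by rewrite /l eqxx.
have l'Z : l' ord_max = (p ord_max)^-1 *: Z by rewrite /l' eqxx.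
exists l, l'; split.
- by move=> i; rewrite /l; case: eqP => _; [|apply: rpredD; first exact: hX]; apply: rpredZ; exact: hX.
- by move=> i; rewrite /l'; case: eqP => _; [|apply: rpredB; first exact: hX]; apply: rpredZ; exact: hX.
- move=> q; rewrite subst_comp -[RHS]subst_id; congr (subst _ q).
  apply/funext => i; rewrite /l; case: eqP => [->|/eqP ne].
    by rewrite -mul_mpolyC substM substC substX l'Z mul_mpolyC scalerA divff // scale1r.
  rewrite substD substX -mul_mpolyC substM substC substX l'Z mul_mpolyC scalerA.
  by rewrite /l' (negbTE ne) subrK.
- move=> q; rewrite subst_comp -[RHS]subst_id; congr (subst _ q).
  apply/funext => i; rewrite /l'; case: eqP => [->|/eqP ne].
    by rewrite -mul_mpolyC substM substC substX lZ mul_mpolyC scalerA mulVf // scale1r.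
  rewrite substB substX -mul_mpolyC substM substC substX lZ mul_mpolyC scalerA.
  by rewrite divfK // /l (negbTE ne) addrK.
move=> i; rewrite /l; case: eqP => [->|/eqP ne].
  by rewrite mevalZ mevalXU extend_max mulr1.
rewrite mevalD mevalZ !mevalXU extend_max mulr1.
have [E|[j ->]] := ord_widen_max i; first by rewrite E eqxx in ne.
by rewrite -[extend _ _ _]/((extend (fun=> 0) 1 \o _) j) extend_widen add0r.
Qed.

Lemma variable_prime n (i : 'I_n) : prime_element ('X_i : {mpoly K[n]}).
Proof.
apply/mpoly_irreducible_prime/msize2_irreducible.
by rewrite msizeX mdeg1.
Qed.

Lemma variable_ndivides n (i j : 'I_n) : i != j ->
  ~ divides ('X_i : {mpoly K[n]}) 'X_j.
Proof.
move=> ne [c /(congr1 (meval (fun k => (k == j)%:R)))].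
by rewrite mevalM !mevalXU eqxx (negbTE ne) mulr0 => /eqP; rewrite oner_eq0.
Qed.

(** A linear change of coordinates moves a point outside of f = 0 to (0, ...,
   0, 1). Then f has an invertible leading coefficient in the last variable,
   and so do its factors. Hence any two of the other coordinates are regular
   modulo all of them. *)
Lemma regular_lines d (f : P) : f != 0 -> f \is d.-homog ->
  exists L0 L1 : P, [/\ L0 \is 1.-homog, L1 \is 1.-homog, L0 != 0 &
    forall F, divides F f -> regular_on L0 L1 F].
Proof.
move=> f0 hf; have Z0 : 'X_ord_max != 0 :> P by have [] := variable_prime (@ord_max m.+2).
have [p] := mpoly_nonvanishing (mulf_neq0 f0 Z0).
rewrite mevalM mevalXU mulf_eq0 negb_or => /andP[fp /linear_change].
move=> [l [l' [hl hl' lK l'K le]]].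
have hlf := subst_homog hl hf.
have [] := muni_homog_lead hlf; rewrite meval_subst (meval_eq _ le) //.
move=> sf lf; pose phi := @muni m.+2 K \o subst l; pose psi := subst l' \o @mmult m.+2 K.
have phiK : cancel phi psi by move=> A; rewrite /phi /psi /= mmultK lK.
have psiK : cancel psi phi by move=> A; rewrite /phi /psi /= l'K muniK.
pose y : S := 'X_ord0; pose z : S := 'X_(lift ord0 ord0).
have nyz : ~ divides y z by apply: variable_ndivides.
have py : prime_element y := variable_prime _.
have psiC i : psi ('X_i)%:P = l' (widen_ord (leqnSn _) i).
  by rewrite /psi /= mmultC mwidenXU substX.
exists (psi y%:P), (psi z%:P); split; [by rewrite psiC|by rewrite psiC| |].
  have [y0 _ _] := py; rewrite -(rmorph0 psi).
  by rewrite (inj_eq (can_inj psiK)) polyC_eq0.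
move=> F [C fE]; apply: (@regular_transport _ _ phi psi) => //.
have : lead_coef (phi f) \is a GRing.unit.
  by rewrite /phi /= lf rmorph_unit // unitfE.
have -> : phi f = phi C * phi F by rewrite fE; exact: (rmorphM phi).
by rewrite lead_coefM unitrM => /andP[].
Qed.

End RegularLines.

(** * The components of a reduced hypersurface *)

Section Components.
Context {K : numClosedFieldType} {m : nat}.
Local Notation P := {mpoly K[m.+3]}.
Implicit Types (F f g p q : P) (Y : set (coords K m.+2)).

(** The affine statement also asks g to vanish at the origin; this holds for
   the products of g with the variables, and F cannot divide two of them. *)
Lemma projective_hypersurface_nullstellensatz F g : irreducible_element F ->
  (forall x : coords K m.+2, zero_locus F x -> g.@[x] = 0) -> divides F g.
Proof.
move=> irrF Fg; have [F0 Fu FM] := mpoly_irreducible_prime irrF.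
have dX i : divides F ('X_i * g).
  apply: irreducible_nullstellensatz => // v Fv; rewrite mevalM mevalXU.
  have [->|vi] := eqVneq (v i) 0; first by rewrite mul0r.
  by rewrite Fg ?mulr0 //; split=> //; exists i.
have [[c Ec]|//] := FM _ _ (dX ord0).
have [[c' Ec']|//] := FM _ _ (dX (lift ord0 ord0)).
have [_ _ irrX] : irreducible_element ('X_ord0 : P).
  by apply: msize2_irreducible; rewrite msizeX mdeg1.
have cu : c \is a GRing.unit.
  by case: (irrX _ _ Ec) => // Fu'; rewrite Fu' in Fu.
have [] := @variable_ndivides K _ (ord0 : 'I_m.+3) (lift ord0 ord0) isT.
by exists (c' / c); rewrite Ec Ec' mulrA divrK.
Qed.

(** The unit of the factorization is absorbed in one of the factors, of which
   there is at least one because d > 0. *)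
Lemma homog_irreducible_factors d f : (0 < d)%N -> f != 0 -> f \is d.-homog ->
  exists l : seq P, (forall q, q \in l -> irreducible_element q /\ exists e, q \is e.-homog)
    /\ f = \prod_(q <- l) q.
Proof.
move=> d0 f0 hf; have [u [l [uu lP Ef]]] := mpoly_irreducible_factors f0.
have hl q : q \in l -> exists e, q \is e.-homog.
  move=> ql; have E : q * (u * \prod_(p <- rem q l) p) = f.
    by rewrite Ef (big_rem q ql) /= mulrCA.
  by apply: (@homog_factor _ _ q (u * \prod_(p <- rem q l) p) d); rewrite E.
case: l lP hl Ef => [|q l] lP hl Ef.
  have := hf; rewrite Ef big_nil mulr1 => hu.
  have : (1 < msize u)%N.
    rewrite -mlead_deg ?(homog_mdeg hu) ?mlead_supp //; apply: contraTneq uu => ->; by rewrite unitr0.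
  by move: uu; rewrite mpoly_unitE => /eqP->.
exists ((u * q) :: l); rewrite Ef !big_cons mulrA; split=> // p.
rewrite inE => /orP[/eqP->|pl]; last by split; [apply: lP|apply: hl]; rewrite inE pl orbT.
have [] := lP q (mem_head _ _) => q0 qu irr.
have u0 : u != 0 by apply: contraTneq uu => ->; rewrite unitr0.
split.
  split; first by rewrite mulf_neq0.
    by rewrite unitrM uu.
  move=> a b E; have := irr (u^-1 * a) b.
  by rewrite -mulrA -E mulKr // unitrM unitrV uu; apply.
have [e he] := hl q (mem_head _ _).
have := uu; rewrite mpoly_unitE => /msize_poly1P[c c0 ->].
by exists e; rewrite mul_mpolyC; apply: rpredZ.
Qed.

Lemma squarefree_ndivides f (l : seq P) (i j : 'I_(size l)) : squarefree f ->
  (forall q, q \in l -> irreducible_element q) -> f = \prod_(q <- l) q ->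
  divides l`_i l`_j -> i = j.
Proof.
move=> [f0 sqf] lP Ef [c Ec]; apply: contrapT => /eqP ne.
have [|k Ek] := sqf l`_i (c * \prod_(k < size l | (k != i) && (k != j)) l`_k).
  rewrite Ef (big_nth 0) big_mkord (bigD1 i) //= (bigD1 j) ?(eq_sym j) //=.
  by rewrite Ec expr2; ring.
have [l0 lu _] := lP _ (mem_nth 0 (ltn_ord i)).
by move: lu l0; rewrite Ek mpolyC_eq0 mpoly_unitE msizeC => /[swap] ->.
Qed.

Lemma zariski_closedI Y p e : zariski_closed Y -> p \is e.-homog ->
  zariski_closed (Y `&` zero_locus p).
Proof.
move=> [S Sh ->] hp; exists (S `|` [set p]).
  by move=> q [/Sh //|->]; exists e.
apply/seteqP; split=> x /=.
  by move=> [[nx Sx] [_ px]]; split=> // q [/Sx //|->].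
by move=> [nx H]; do !split=> //; [move=> q Sq; apply: H; left|apply: H; right].
Qed.

Lemma zero_locusM p q x : zero_locus (p * q) x <-> zero_locus p x \/ zero_locus q x.
Proof.
rewrite /zero_locus /= mevalM; split=> [[nx /eqP]|[[nx ->]|[nx ->]]].
- by rewrite mulf_eq0 => /orP[/eqP|/eqP]; [left|right].
- by rewrite mul0r.
by rewrite mulr0.
Qed.

Lemma irreducible_closed_sub_factor Y (l : seq P) : irreducible_closed Y ->
  (forall q, q \in l -> exists e, q \is e.-homog) ->
  Y `<=` zero_locus (\prod_(q <- l) q) -> exists2 q, q \in l & Y `<=` zero_locus q.
Proof.
move=> [cY [y Yy] irrY]; elim: l => [|p l IH] hl.
  by move=> /(_ y Yy)[_]; rewrite big_nil meval1 => /eqP; rewrite oner_eq0.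
rewrite big_cons => YV; have [e he] := hl p (mem_head _ _).
have [e' he'] : exists e, \prod_(q <- l) q \is e.-homog.
  apply/homogP; apply: homog_prod; apply/allP => q ql; apply/homogP.
  by apply: hl; rewrite inE ql orbT.
have YE : Y = (Y `&` zero_locus p) `|` (Y `&` zero_locus (\prod_(q <- l) q)).
  apply/seteqP; split=> x /=; last by move=> [[]|[]].
  by move=> Yx; have /zero_locusM[] := YV x Yx; [left|right].
have [EY|EY] := irrY _ _ (zariski_closedI cY he) (zariski_closedI cY he') YE.
  by exists p; rewrite ?mem_head // EY => x [].
have [||q ql Yq] := IH.
- by move=> q ql; apply: hl; rewrite inE ql orbT.
- by rewrite EY => x [].
by exists q; rewrite // inE ql orbT.
Qed.

(** Were F = 0 a union of two smaller closed sets, there would be two forms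
   that do not vanish on it, although their product does: F would divide the
   product. *)
Lemma zero_locus_irreducible F e : irreducible_element F -> F \is e.-homog ->
  irreducible_closed (zero_locus F).
Proof.
move=> irrF hF; have [F0 Fu FM] := mpoly_irreducible_prime irrF.
split.
- exists [set F]; first by move=> p ->; exists e.
  apply/seteqP; split=> x /=; first by move=> [nx Fx]; split=> // p ->.
  by move=> [nx /(_ F erefl)].
- apply/set0P/negP => /eqP V0.
  have /(divides_unit (unitr1 _)) : divides F 1.
    by apply: projective_hypersurface_nullstellensatz => // x; rewrite V0.
  by rewrite (negbTE Fu).
move=> A B [SA hA EA] [SB hB EB] E.
have [HA|/existsNP[p /not_implyP[Sp /existsNP[x /not_implyP[Vx px]]]]] :=
    pselect (forall p, SA p -> forall x, zero_locus F x -> p.@[x] = 0).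
  left; apply/seteqP; split=> x; last by rewrite E; left.
  by move=> Vx; rewrite EA; split; [case: Vx|move=> p /HA; apply].
have [HB|/existsNP[q /not_implyP[Sq /existsNP[y /not_implyP[Vy qy]]]]] :=
    pselect (forall p, SB p -> forall x, zero_locus F x -> p.@[x] = 0).
  right; apply/seteqP; split=> z; last by rewrite E; right.
  by move=> Vz; rewrite EB; split; [case: Vz|move=> q /HB; apply].
have : divides F (p * q).
  apply: projective_hypersurface_nullstellensatz => // z; rewrite E mevalM EA EB.
  by move=> [[_ /(_ p Sp) ->]|[_ /(_ q Sq) ->]]; rewrite ?mul0r ?mulr0.
case/FM=> -[c Ec]; [case: px|case: qy]; rewrite Ec mevalM.
  by case: Vx => _ ->; rewrite mulr0.
by case: Vy => _ ->; rewrite mulr0.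
Qed.

Lemma zero_locus_sub_divides F F' : irreducible_element F ->
  zero_locus F `<=` zero_locus F' -> divides F F'.
Proof.
by move=> irrF sub; apply: projective_hypersurface_nullstellensatz => // x /sub[].
Qed.

Lemma divides_zero_locus F F' : divides F F' -> zero_locus F `<=` zero_locus F'.
Proof. by move=> [c ->] x [nx Fx]; split=> //; rewrite mevalM Fx mulr0. Qed.

(** By the Nullstellensatz, zero_locus is injective on irreducible forms up
   to associates, and no two factors of a squarefree f are associate. Hence
   the factors of f are in bijection with the components and can be indexed
   like them. *)
Lemma hypersurface_components d f s (X : 'I_s -> set (coords K m.+2)) :
  (0 < d)%N -> f \is d.-homog -> squarefree f -> injective X ->
  range X = irreducible_component (zero_locus f) ->
  exists F : 'I_s -> P,
    [/\ forall i, irreducible_element (F i), forall i, exists e, F i \is e.-homog,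
        f = \prod_i F i, forall i, X i = zero_locus (F i) &
        forall i j, divides (F i) (F j) -> i = j].
Proof.
move=> d0 hf sqf Xinj EX; have f0 : f != 0 by case: sqf.
have [l [lP Ef]] := homog_irreducible_factors d0 f0 hf.
have irr (j : 'I_(size l)) : irreducible_element l`_j by have [] := lP _ (mem_nth 0 (ltn_ord j)).
have hom (j : 'I_(size l)) : exists e, l`_j \is e.-homog by have [] := lP _ (mem_nth 0 (ltn_ord j)).
have indep (i j : 'I_(size l)) : divides l`_i l`_j -> i = j.
  by apply: squarefree_ndivides sqf _ Ef => q /lP[].
have Ef' : f = \prod_(j < size l) l`_j by rewrite Ef (big_nth 0) big_mkord.
have subf (j : 'I_(size l)) : zero_locus l`_j `<=` zero_locus f.
  apply: divides_zero_locus; rewrite Ef' (bigD1 j) //=.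
  by apply: divides_mulr; apply: dividesxx.
have sub_factor Y : irreducible_closed Y -> Y `<=` zero_locus f ->
    exists j : 'I_(size l), Y `<=` zero_locus l`_j.
  move=> irrY; rewrite Ef => /(irreducible_closed_sub_factor irrY)[q /lP[]//|q ql Yq].
  by exists (Ordinal (ltac:(by rewrite index_mem) : (index q l < size l)%N)); rewrite /= nth_index.
have comp (j : 'I_(size l)) : irreducible_component (zero_locus f) (zero_locus l`_j).
  have [e he] := hom j; split; [exact: zero_locus_irreducible he|exact: subf|].
  move=> Y irrY jY /(sub_factor Y irrY)[k Yk].
  have E : j = k.
    by apply: indep; apply: zero_locus_sub_divides => //; apply: subset_trans Yk.
  by apply/seteqP; split=> //; rewrite E.
have /choice[sg Xsg] : forall i, exists j : 'I_(size l), X i = zero_locus l`_j.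
  move=> i; have [irrX Xf maxX] : irreducible_component (zero_locus f) (X i) by rewrite -EX; exists i.
  have [j Xj] := sub_factor _ irrX Xf; exists j.
  by have [e he] := hom j; apply/esym/maxX => //; apply: zero_locus_irreducible he.
have /choice[tau tauK] : forall j, exists i, sg i = j.
  move=> j; have : irreducible_component (zero_locus f) (zero_locus l`_j) by [].
  rewrite -EX => -[i _ E]; exists i; apply: indep; apply: zero_locus_sub_divides => //.
  by rewrite -Xsg E.
have sginj : injective sg by move=> i j E; apply: Xinj; rewrite !Xsg E.
exists (fun i => l`_(sg i)); split=> // [|i j /indep /sginj //].
rewrite Ef' (reindex sg) //=; exists tau => i _; last exact: tauK.
by apply: sginj; rewrite tauK.
Qed.

End Components.

(** * The saturation of the jacobian ideal *)

Section SaturationCriterion.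
Context {K : numClosedFieldType} {n : nat}.
Local Notation P := {mpoly K[n]}.

(** A factor 'X^k of the expansion at 0 means that y has no term of degree
   less than k. *)
Lemma expand0_irrelevant k (y : {mpoly K[n.+1]}) :
  ideal_pow setT (irrelevant_ideal K n) k y ->
  exists B, expand (fun=> 0) y = 'X^k * B.
Proof.
move=> [N [c [a [_ ma ->]]]].
have aE j i : exists B, expand (fun=> 0) (a j i) = 'X * B.
  have [e _ ->] := ma j i; exists (\sum_l expand (fun=> 0) (e l) * ('X_l)%:P).
  rewrite rmorph_sum big_distrr; apply: eq_bigr => l _ /=.
  by rewrite expandM expandX mpolyC0 polyC0 add0r [_ * 'X]mulrC mulrCA.
have /choice[b bE] : forall j, exists b, forall i, expand (fun=> 0) (a j i) = 'X * b i.
  by move=> j; have [b bE] := choice (aE j); exists b.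
exists (\sum_j expand (fun=> 0) (c j) * \prod_i b j i).
rewrite rmorph_sum big_distrr; apply: eq_bigr => j _ /=.
rewrite expandM rmorph_prod /= mulrCA; congr (_ * _).
rewrite (eq_bigr _ (fun i _ => bE j i)) big_split /=.
by rewrite big_const_ord iter_mulr_1.
Qed.

Lemma big_degree_monomial (mon : 'X_{1..n}) N : (n * N < mdeg mon)%N ->
  exists i, (N <= mon i)%N.
Proof.
move=> lt; apply: contrapT => H; move: lt; rewrite ltnNge mdegE => /negP; apply.
rewrite -[n in (n * N)%N]card_ord -sum_nat_const; apply: leq_sum => i _.
by rewrite leqNgt; apply/negP => lt; apply: H; exists i; apply: ltnW.
Qed.

Lemma big_degree_ideal (I : set P) N D p : is_ideal I ->
  (forall i, I ('X_i ^+ N)) -> p \is D.-homog -> (n * N < D)%N -> I p.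
Proof.
move=> hI IX hp lt; have [_ _ IM] := hI; rewrite (mpolyE p) big_seq.
apply: ideal_sum => // mon /(homog_mdeg hp) Em; rewrite -mul_mpolyC; apply: (IM).
have [|i le] := @big_degree_monomial mon N; first by rewrite Em.
have Emon : mon = (U_(i) *+ N + (mon - U_(i) *+ N))%MM.
  rewrite addmC submK //; apply/mnm_lepP => j; rewrite mulmnE mnm1E.
  by case: eqP => [<-|_]; rewrite ?mul1n ?mul0n.
by rewrite Emon mpolyXD mulrC -mpolyXn; apply: IM.
Qed.

End SaturationCriterion.

(** In degrees greater than n.+1 * N, every monomial is divisible by some
   'X_i ^+ N. *)
Lemma saturation_crit (K : numClosedFieldType) n (I : set {mpoly K[n.+1]}) N g :
  is_ideal I -> (forall i, I ('X_i ^+ N * g)) ->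
  saturation I (irrelevant_ideal K n) g.
Proof.
move=> hI IX; have [I0 ID IM] := hI; exists (n.+1 * N).+1 => y /expand0_irrelevant[B EB].
rewrite (mpoly_sum_pihomog y) big_distrl; apply: ideal_sum => // i _ /=.
have [lt|le] := ltnP (n.+1 * N) i; last first.
  rewrite -coef_expand0 EB coefXnM ltnS le mul0r; exact: I0.
apply: (@big_degree_ideal _ _ [set q | I (q * g)] N i) => //; last exact: pihomogP.
split=> [|a b Ia Ib|c a Ia] /=; first by rewrite mul0r.
  by rewrite mulrDl; apply: ID.
by rewrite -mulrA; apply: IM.
Qed.

Lemma saturation_linear (K : numClosedFieldType) n (I : set {mpoly K[n.+1]}) L g :
  saturation I (irrelevant_ideal K n) g -> L \is 1.-homog ->
  exists N, I (L ^+ N * g).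
Proof.
move=> [k Ik] hL; exists k; apply: Ik; exists 1%N, (fun=> 1), (fun _ _ => L); split=> //.
  move=> _ _; apply: (@homog_pos_ideal _ _ _ 0) => //; first exact: ideal_gen_is_ideal.
  exact: ideal_gen_mem.
by rewrite big_ord1 mul1r prodr_const card_ord.
Qed.

Section Jacobian.
Context {K : numClosedFieldType} {m : nat}.
Local Notation P := {mpoly K[m.+3]}.

Lemma mderiv_prod s (F : 'I_s -> P) k :
  (\prod_i F i)^`M(k) = \sum_i (F i)^`M(k) * \prod_(j | j != i) F j.
Proof.
elim: s F => [|s IH] F; first by rewrite !big_ord0 mderivC.
rewrite big_ord_recl mderivM IH [RHS]big_ord_recl big_distrr; congr (_ + _).
  by rewrite [in RHS]big_mkcond big_ord_recl /= mul1r.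
apply: eq_bigr => i _; rewrite /= mulrCA; congr (_ * _).
rewrite [in RHS]big_mkcond big_ord_recl /= [in LHS]big_mkcond /=.
by congr (_ * _); apply: eq_bigr => j _; rewrite (inj_eq (@lift_inj _ ord0)).
Qed.

Lemma jacobian_low_degree d (f : P) p D : f \is d.-homog -> (D < d.-1)%N ->
  p \is D.-homog -> jacobian_ideal f p -> p = 0.
Proof.
move=> hf lt hp [c _ E]; rewrite -(pihomog_dE hp) E raddf_sum big1 //= => i _.
exact: pihomogM_homog_lt (dhomog_deriv i hf) lt.
Qed.

Lemma jacobian_ideal_self d (f : P) : f \is d.-homog -> (0 < d)%N ->
  jacobian_ideal f f.
Proof.
move=> hf d0; have dn0 : d%:R != 0 :> K by rewrite Num.Theory.pnatr_eq0 -lt0n.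
exists (fun i => (d%:R)^-1 *: 'X_i) => //.
rewrite (eq_bigr (fun i => (d%:R)^-1 *: ('X_i * f^`M(i)))); last first.
  by move=> i _; rewrite scalerAl.
by rewrite -scaler_sumr (euler_homog hf) -scaler_nat scalerA mulVf ?scale1r.
Qed.

Variables (s : nat) (F : 'I_s -> P).
Hypotheses (irrF : forall i, irreducible_element (F i))
  (indepF : forall i j, divides (F i) (F j) -> i = j).

Let f := \prod_i F i.
Let Q i := \prod_(j | j != i) F j.

Lemma cofactorE i : F i * Q i = f.
Proof. by rewrite /f (bigD1 i). Qed.

Lemma cofactor_divides i j : i != j -> divides (F i) (Q j).
Proof. by move=> ne; exists (\prod_(k | (k != j) && (k != i)) F k); rewrite /Q (bigD1 i) //= mulrC. Qed.

Lemma cofactor_ndivides i : ~ divides (F i) (Q i).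
Proof.
rewrite /Q -big_filter => /(prime_divides_prod (mpoly_irreducible_prime (irrF i)))[j].
by rewrite mem_filter => /andP[/negP ne _] /indepF E; apply: ne; rewrite E.
Qed.

(** F i divides all the Q j except Q i, and it is prime. *)
Lemma cofactor_relation (a : 'I_s -> P) i :
  divides (F i) (\sum_j a j * Q j) -> divides (F i) (a i).
Proof.
rewrite (bigD1 i) //= => d; have [_ _ FM] := mpoly_irreducible_prime (irrF i).
have : divides (F i) (a i * Q i).
  rewrite -[X in divides _ X](addrK (\sum_(j | j != i) a j * Q j)).
  apply: dividesB d _; apply: divides_sum => j ne; apply: divides_mull.
  by apply: cofactor_divides; rewrite eq_sym.
by case/FM => // /cofactor_ndivides.
Qed.

(** Comparing the two expressions of L0 ^ N * L1 ^ N * g shows that F i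
   divides L1 ^ N * a i - L0 ^ N * b i for all i. By regularity a i is L0 ^
   N * c i modulo F i, hence g is \sum_i c i * Q i modulo f, and multiples
   of f are multiples of Q i0. *)
Lemma cofactor_ideal_saturated (i0 : 'I_s) L0 L1 N g (a b : 'I_s -> P) :
  (forall G, divides G f -> regular_on L0 L1 G) ->
  L0 ^+ N * g = \sum_i a i * Q i -> L1 ^+ N * g = \sum_i b i * Q i ->
  exists c : 'I_s -> P, g = \sum_i c i * Q i.
Proof.
move=> reg Ea Eb; have Ff i : divides (F i) f by exists (Q i); rewrite mulrC cofactorE.
have /choice[c /choice[e cE]] : forall i, exists c e, a i - L0 ^+ N * c = e * F i.
  move=> i; have [_ reg2] := reg _ (Ff i); apply: (reg2 N _ (b i)).
  apply: (@cofactor_relation (fun i => L1 ^+ N * a i - L0 ^+ N * b i)).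
  have -> : \sum_j (L1 ^+ N * a j - L0 ^+ N * b j) * Q j = 0; last exact: divides0.
  transitivity (L1 ^+ N * (\sum_i a i * Q i) - L0 ^+ N * (\sum_i b i * Q i)).
    by rewrite !big_distrr -sumrB; apply: eq_bigr => j _ /=; ring.
  by rewrite -Ea -Eb; ring.
have : divides f (L0 ^+ N * (g - \sum_i c i * Q i)).
  exists (\sum_i e i); rewrite mulrBr Ea big_distrr -sumrB big_distrl /=.
  apply: eq_bigr => i _; rewrite -(cofactorE i) [in RHS]mulrA -cE; ring.
have [reg1 _] := reg _ (dividesxx f); case/reg1 => t /eqP.
rewrite subr_eq => /eqP ->.
exists (fun i => (if i == i0 then t * F i0 else 0) + c i).
rewrite [RHS](eq_bigr (fun i => (if i == i0 then t * F i0 else 0) * Q i + c i * Q i)); last first.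
  by move=> i _; rewrite mulrDl.
rewrite big_split /=; congr (_ + _); rewrite (bigD1 i0) //= eqxx -mulrA cofactorE.
by rewrite big1 ?addr0 // => i /negbTE->; rewrite mul0r.
Qed.

(** The linear independence of the differentials at x of those F i that
   vanish at x, witnessed by dual vectors. *)
Definition dual_vectors (x : coords K m.+2) :=
  forall i, (F i).@[x] = 0 -> exists xi : 'I_m.+3 -> K,
    forall l, (F l).@[x] = 0 -> \sum_k xi k * (F l)^`M(k).@[x] = (l == i)%:R.

Variables (e : 'I_s -> nat).
Hypothesis homF : forall i, F i \is (e i).-homog.

Lemma homog_det t (A : 'M[P]_t) (c : 'I_t -> nat) :
  (forall i j, A i j \is (c j).-homog) -> \det A \is (\sum_j c j).-homog.
Proof.
move=> hA; apply: rpred_sum => sg _.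
have -> : (-1) ^+ sg = ((-1) ^+ sg)%:MP :> P by rewrite rmorphXn rmorphN1.
have -> : (\sum_j c j = \sum_j c (sg j))%N.
  by rewrite (reindex_inj (@perm_inj _ sg)).
rewrite mul_mpolyC; apply: rpredZ.
elim/big_ind2: _ => [|a i b j ha hb|i _]; [exact: dhomog1|exact: dhomogM|exact: hA].
Qed.

Lemma homog_prodF (p : pred 'I_s) : \prod_(i | p i) F i \is (\sum_(i | p i) e i).-homog.
Proof.
elim/big_ind2: _ => [|a i b j ha hb|i _]; [exact: dhomog1|exact: dhomogM|exact: homF].
Qed.

(** Let D j be the derivation along the vector dual to the differential of F
   j at x, for F j through x. The elements D j f = \sum_l D j (F l) * Q l of
   J form a linear system in the Q l whose matrix is the identity at x, as
   far as the components through x are concerned. By Cramer's rule its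
   determinant carries Q l into J, after multiplication by the product u of
   the F i that do not vanish at x. *)
Lemma jacobian_colon_nonvanishing x : dual_vectors x -> (0 < \sum_i e i)%N ->
  exists q, [/\ exists D, q \is D.-homog, q.@[x] != 0 &
    forall i, jacobian_ideal f (q * Q i)].
Proof.
move=> dualx e0; pose M i := (F i).@[x] == 0.
pose J := jacobian_ideal f.
have hJ : is_ideal J by apply: ideal_gen_is_ideal.
have [J0 JD JM] := hJ.
have Jf : J f by apply: (jacobian_ideal_self (d := \sum_i e i)) => //; apply: homog_prodF.
have /choice[xi xiE] : forall i, exists xi : 'I_m.+3 -> K, M i ->
    forall l, M l -> \sum_k xi k * (F l)^`M(k).@[x] = (l == i)%:R.
  move=> i; have [/eqP Mi|nMi] := boolP (M i); last by exists (fun=> 0).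
  by have [xi xiE] := dualx i Mi; exists xi => _ l /eqP; apply: xiE.
pose D j (p : P) := \sum_k (xi j k)%:MP * p^`M(k).
have Df j : D j f = \sum_l D j (F l) * Q l.
  rewrite /D /f (eq_bigr (fun k => \sum_l (xi j k)%:MP * (F l)^`M(k) * Q l)); last first.
    by move=> k _; rewrite mderiv_prod big_distrr /=; apply: eq_bigr => l _; rewrite mulrA.
  by rewrite exchange_big; apply: eq_bigr => l _; rewrite big_distrl.
have JDf j : J (D j f).
  by apply: ideal_sum => // k _; apply: JM; apply: ideal_gen_mem.
pose u := \prod_(i | ~~ M i) F i.
have JuQ l : ~~ M l -> J (u * Q l).
  move=> nM; rewrite /u (bigD1 l) //= mulrAC cofactorE mulrC; exact: JM.
(* The rows and columns of the components that miss x are those of the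
   identity, so that the matrix is square over all the indices. *)
pose A := \matrix_(j, l) (if M j && M l then D j (F l) else (j == l)%:R).
have JA j : J (\sum_l A j l * (u * Q l)).
  have [Mj|nMj] := boolP (M j); last first.
    rewrite (bigD1 j) //= big1 => [|l nl].
      by rewrite mxE (negbTE nMj) /= eqxx mul1r addr0; apply: JuQ.
    by rewrite mxE (negbTE nMj) /= eq_sym (negbTE nl) mul0r.
  have -> : \sum_l A j l * (u * Q l) =
      u * D j f - \sum_l (if M l then 0 else D j (F l) * (u * Q l)).
    rewrite Df big_distrr -sumrB; apply: eq_bigr => l _; rewrite mxE Mj /=.
    have [Ml|nMl] := boolP (M l); first by ring.
    have -> : (j == l) = false by apply: contraNF nMl => /eqP <-.
    by rewrite /= mulr0n mul0r; ring.
  apply: idealB => //; first exact: JM.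
  apply: ideal_sum => // l _; have [//|nMl] := boolP (M l).
  by apply: JM; apply: JuQ.
pose w := \col_l (u * Q l).
have Jdet l : J (\det A * (u * Q l)).
  have -> : \det A * (u * Q l) = (\adj A *m (A *m w)) l 0.
    by rewrite mulmxA mul_adj_mx mul_scalar_mx !mxE.
  rewrite mxE; apply: ideal_sum => // j _; apply: JM.
  rewrite mxE; have := JA j; congr (J _); apply: eq_bigr => k _.
  by rewrite [w _ _]mxE.
exists (\det A * u); split; last by move=> i; rewrite -mulrA; apply: Jdet.
  exists (\sum_l (if M l then (e l).-1 else 0) + \sum_(i | ~~ M i) e i)%N.
  apply: dhomogM; last exact: homog_prodF.
  apply: homog_det => j l; rewrite mxE; have [Ml|nMl] := boolP (M l).
    have [Mj|nMj] := boolP (M j); last first.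
      have -> : (j == l) = false by apply: contraNF nMj => /eqP ->.
      exact: rpred0.
    apply: rpred_sum => k _; rewrite mul_mpolyC; apply: rpredZ.
    exact: dhomog_deriv.
  by rewrite andbF; case: (j == l); [exact: dhomog1|exact: rpred0].
have -> : (\det A * u).@[x] = u.@[x].
  rewrite mevalM -det_map_mx (_ : map_mx _ A = 1%:M) ?det1 ?mul1r //.
  apply/matrixP => j l; rewrite !mxE.
  have [Mj|nMj] := boolP (M j); last by rewrite /= rmorph_nat.
  have [Ml|nMl] := boolP (M l); last by rewrite /= rmorph_nat.
  rewrite /= raddf_sum (eq_bigr (fun k => xi j k * (F l)^`M(k).@[x])).
    by rewrite xiE // eq_sym.
  by move=> k _ /=; rewrite mevalM mevalC.
rewrite rmorph_prod /=; apply/prodf_neq0 => i; exact.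
Qed.

Lemma jacobian_saturation_cofactor : (0 < \sum_i e i)%N ->
  (forall x, nonzero x -> dual_vectors x) ->
  exists N, forall i k, jacobian_ideal f ('X_k ^+ N * Q i).
Proof.
move=> e0 dual; have hJ : is_ideal (jacobian_ideal f) by apply: ideal_gen_is_ideal.
have [J0 JD JM] := hJ.
have [||N NP] := @projective_nullstellensatz K _ [set q | forall i, jacobian_ideal f (q * Q i)].
- split=> [i|a b Ia Ib i|c a Ia i]; first by rewrite mul0r.
    by rewrite mulrDl; apply: JD.
  by rewrite -mulrA; apply: JM.
- by move=> x /dual dx; have [q [hq qx Jq]] := jacobian_colon_nonvanishing dx e0; exists q.
by exists N => i k; apply: NP.
Qed.

End Jacobian.

(** * Completions and formal coordinates *)

Section AdicFiltration.
Context {A : comNzRingType} (O M : set A).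
Hypotheses (O1 : O 1) (OB : forall a b, O a -> O b -> O (a - b))
  (OM : forall a b, O a -> O b -> O (a * b)).
Hypotheses (MO : M `<=` O) (MB : forall a b, M a -> M b -> M (a - b))
  (MM : forall c a, O c -> M a -> M (c * a)) (M0 : M 0).

Definition submodule (I : set A) :=
  [/\ I 0, forall a b, I a -> I b -> I (a - b) & forall c a, O c -> I a -> I (c * a)].

Lemma submoduleN I a : submodule I -> I a -> I (- a).
Proof. by move=> [I0 IB _] Ia; rewrite -sub0r; apply: IB. Qed.

Lemma submoduleD I a b : submodule I -> I a -> I b -> I (a + b).
Proof.
move=> hI Ia Ib; rewrite -[b]opprK; have [_ IB _] := hI.
by apply: IB => //; apply: submoduleN.
Qed.

Lemma submodule_sum I (T : Type) (s : seq T) (p : pred T) (F : T -> A) :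
  submodule I -> (forall i, p i -> I (F i)) -> I (\sum_(i <- s | p i) F i).
Proof.
move=> hI IF; elim/big_rec: _ => [|i x pi]; first by case: hI.
by apply: submoduleD => //; apply: IF.
Qed.

Lemma submoduleO : submodule O.
Proof. by split=> //; rewrite -(subrr 1); apply: OB. Qed.

Lemma submoduleM : submodule M.
Proof. by split. Qed.

Lemma submodule_gen_mem (T : finType) (t : T -> A) j : ideal_gen O t (t j).
Proof.
exists (fun i => (i == j)%:R).
  by move=> i; case: (i == j) => //; have [] := submoduleO.
rewrite (bigD1 j) //= eqxx mul1r big1 ?addr0 // => i /negbTE->.
by rewrite mul0r.
Qed.

Lemma ideal_gen_submodule (T : finType) (t : T -> A) : submodule (ideal_gen O t).
Proof.
have [O0 _ _] := submoduleO.
split=> [|x y [c Oc ->] [c' Oc' ->]|a x Oa [c Oc ->]].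
- by exists (fun=> 0) => //; rewrite big1 // => i _; rewrite mul0r.
- exists (fun i => c i - c' i) => [i|]; first exact: OB.
  by rewrite -sumrB; apply: eq_bigr => i _; rewrite mulrBl.
exists (fun i => a * c i) => [i|]; first exact: OM.
by rewrite big_distrr; apply: eq_bigr => i _; rewrite /= mulrA.
Qed.

Lemma O_prod (T : Type) (s : seq T) (p : pred T) (F : T -> A) :
  (forall i, p i -> O (F i)) -> O (\prod_(i <- s | p i) F i).
Proof. by move=> OF; elim/big_rec: _ => // i x pi; apply: OM; apply: OF. Qed.

Local Notation pow := (ideal_pow O M).

Lemma pow_submodule n : submodule (pow n).
Proof.
have [O0 _ _] := submoduleO.
split=> [|x y [N [c [a [Oc Ma ->]]]] [N' [c' [a' [Oc' Ma' ->]]]]|e x Oe [N [c [a [Oc Ma ->]]]]].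
- exists 0%N, (fun=> 0), (fun _ _ => 0); split=> //.
  by rewrite big_ord0.
- exists (N + N')%N, (fun i => match fintype.split i with inl j => c j | inr j => - c' j end),
    (fun i => match fintype.split i with inl j => a j | inr j => a' j end); split.
  + move=> i; case: (fintype.split i) => j //; rewrite -sub0r; exact: OB.
  + by move=> i k; case: (fintype.split i) => j.
  rewrite big_split_ord -sumrN; congr (_ + _); apply: eq_bigr => i _.
    by rewrite (unsplitK (inl i)).
  by rewrite (unsplitK (inr i)) mulNr.
exists N, (fun i => e * c i), a; split=> // [j|]; first exact: OM.
by rewrite big_distrr; apply: eq_bigr => j _; rewrite /= mulrA.
Qed.

Lemma powS n : pow n.+1 `<=` pow n.
Proof.
move=> x [N [c [a [Oc Ma ->]]]].
exists N, (fun j => c j * a j ord0), (fun j i => a j (lift ord0 i)); split=> //.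
  by move=> j; apply: OM => //; apply: MO.
by apply: eq_bigr => j _; rewrite big_ord_recl mulrA.
Qed.

Lemma pow_le k n : (k <= n)%N -> pow n `<=` pow k.
Proof.
move=> le; rewrite -(subnK le); elim: (n - k)%N => // j IH x /powS; exact: IH.
Qed.

Lemma pow1 : pow 1 `<=` M.
Proof.
move=> x [N [c [a [Oc Ma ->]]]]; apply: submodule_sum submoduleM _ => j _.
by rewrite big_ord1; apply: MM.
Qed.

Lemma pow_gen r (t : 'I_r -> A) n x : M `<=` ideal_gen O t -> pow n.+1 x ->
  exists2 e : 'I_r -> A, forall j, pow n (e j) & x = \sum_j t j * e j.
Proof.
move=> Mt [N [c [a [Oc Ma ->]]]].
have /choice[b bE] : forall j, exists b : 'I_r -> A, (forall l, O (b l)) /\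
    a j ord0 = \sum_l b l * t l.
  by move=> j; have [b Ob ->] := Mt _ (Ma j ord0); exists b.
exists (fun l => \sum_j (c j * b j l) * \prod_(i < n) a j (lift ord0 i)).
  move=> l; exists N, (fun j => c j * b j l), (fun j i => a j (lift ord0 i)).
  by split=> // j; apply: OM => //; have [] := bE j.
rewrite (eq_bigr (fun l => \sum_j c j * b j l * t l * \prod_(i < n) a j (lift ord0 i))).
  rewrite exchange_big; apply: eq_bigr => j _ /=.
  rewrite big_ord_recl -big_distrl /=; have [_ ->] := bE j.
  rewrite mulrA big_distrr /=; congr (_ * _); apply: eq_bigr => l _; exact: mulrA.
by move=> l _; rewrite big_distrr; apply: eq_bigr => j _ /=; ring.
Qed.

Local Notation Fil := (filtration O M).

Section OneIdeal.
Variable I : set A.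
Hypotheses (hI : submodule I) (IM : I `<=` M).

Lemma Fil_submodule n : submodule (Fil I n).
Proof.
have [I0 IB IC] := hI; have [p0 pB pC] := pow_submodule n.
split=> [|x y [i Ii pi] [j Ij pj]|c x Oc [i Ii pi]].
- by exists 0; rewrite ?subr0.
- by exists (i - j); [exact: IB|rewrite opprD addrACA -opprD; apply: pB].
by exists (c * i); [exact: IC|rewrite -mulrBr; apply: pC].
Qed.

Lemma Fil_le k n : (k <= n)%N -> Fil I n `<=` Fil I k.
Proof. by move=> le x [i Ii pi]; exists i => //; apply: pow_le pi. Qed.

Lemma Fil_max n : (0 < n)%N -> Fil I n `<=` M.
Proof.
move=> n0 x [i Ii pi]; rewrite -(subrK i x); apply: submoduleD submoduleM _ _.
  by apply: pow1; apply: pow_le pi.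
exact: IM.
Qed.

Lemma Fil_ideal n : I `<=` Fil I n.
Proof. by move=> x Ix; exists x; rewrite ?subrr //; have [] := pow_submodule n. Qed.

Lemma Fil_pow n : pow n `<=` Fil I n.
Proof. by move=> x px; exists 0; rewrite ?subr0 //; have [] := hI. Qed.

Local Notation coh := (coherent O M I).
Implicit Types u v w : nat -> A.

Lemma coherent_cst c : O c -> coh (fun=> c).
Proof. by move=> Oc; split=> // n; rewrite subrr; have [] := Fil_submodule n. Qed.

Lemma coherentB u v : coh u -> coh v -> coh (u \- v).
Proof.
move=> [Ou cu] [Ov cv]; split=> n /=; first exact: OB.
by rewrite opprD addrACA -opprD; have [_ FB _] := Fil_submodule n; apply: FB.
Qed.

Lemma coherentD u v : coh u -> coh v -> coh (u \+ v).
Proof.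
move=> cu cv; have c0 : coh (fun=> 0) by apply: coherent_cst; have [] := submoduleO.
have := coherentB cu (coherentB c0 cv).
by congr coherent; apply/funext => n /=; rewrite sub0r opprK.
Qed.

Lemma coherentM u v : coh u -> coh v -> coh (u \* v).
Proof.
move=> [Ou cu] [Ov cv]; split=> n /=; first exact: OM.
have hF := Fil_submodule n; have [_ _ FC] := hF.
have -> : u n.+1 * v n.+1 - u n * v n =
    u n.+1 * (v n.+1 - v n) + v n * (u n.+1 - u n) by ring.
by apply: submoduleD => //; apply: FC.
Qed.

Lemma coherent_diff u n k : coh u -> (n <= k)%N -> Fil I n (u k - u n).
Proof.
move=> [Ou cu] /subnK <-; have hF := Fil_submodule n.
elim: (k - n)%N => [|j IH]; first by rewrite subrr; case: hF.
rewrite addSn -[u _.+1](subrK (u (j + n)%N)) -addrA.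
by apply: submoduleD => //; apply: Fil_le (cu _); apply: leq_addl.
Qed.

Lemma coherent_max u n : coh u -> M (u 1) -> (0 < n)%N -> M (u n).
Proof.
move=> cu Mu n0; rewrite -(subrK (u 1%N) (u n)); apply: submoduleD submoduleM _ Mu.
by apply: (@Fil_max 1) => //; apply: coherent_diff.
Qed.

(** The terms of u of positive index are outside of M, hence invertible, but
   the term of index 0 is arbitrary. This is why w n is the inverse of u
   n.+1. *)
Lemma coherent_unit u : coh u -> (forall g, O g -> ~ M g -> exists2 h, O h & g * h = 1) ->
  ~ M (u 1) -> exists2 w, coh w & null O M I ((u \* w) \- (fun=> 1)).
Proof.
move=> cu unitO nM; have [Ou _] := cu.
have nMn n : ~ M (u n.+1).
  move=> Mun; apply: nM; rewrite -(subKr (u n.+1) (u 1%N)).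
  by apply: MB => //; apply: (@Fil_max 1) => //; apply: coherent_diff.
have /choice[w wE] : forall n, exists h, O h /\ u n.+1 * h = 1.
  by move=> n; have [h] := unitO _ (Ou n.+1) (nMn n); exists h.
have Ow n : O (w n) by have [] := wE n.
have uw n : u n.+1 * w n = 1 by have [] := wE n.
exists w; [split=> // n|move=> n /=]; have [_ _ FC] := Fil_submodule n.
  have -> : w n.+1 - w n = - (w n * w n.+1) * (u n.+2 - u n.+1).
    transitivity (w n.+1 * (u n.+1 * w n) - w n * (u n.+2 * w n.+1)); last by ring.
    by rewrite !uw !mulr1.
  apply: FC; last by apply: (@Fil_le n n.+1) => //; apply: coherent_diff.
  by apply: submoduleN submoduleO _; apply: OM.
rewrite -(uw n).
have -> : u n * w n - u n.+1 * w n = - w n * (u n.+1 - u n) by ring.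
by apply: FC; [exact: submoduleN submoduleO _|have [_] := cu].
Qed.

(** Each increment of w lies in I + M ^ n.+1, and is thus modulo I a
   combination of the t j with coefficients in M ^ n; the partial sums of
   these coefficients are coherent. *)
Lemma coherent_gen r (t : 'I_r -> A) w : M `<=` ideal_gen O t ->
  coh w -> M (w 1) ->
  exists2 c : 'I_r -> nat -> A, forall j, coh (c j) &
    forall n, Fil I n (w n - \sum_j t j * c j n).
Proof.
move=> Mt cw Mw; have [Ow cohw] := cw.
have [e0 Oe0 w1E] := Mt _ Mw.
have /choice[e eE] : forall n, exists e : 'I_r -> A, (forall j, pow n (e j)) /\
    I (w n.+2 - w n.+1 - \sum_j t j * e j).
  move=> n; have [i Ii pi] := cohw n.+1; have [e pe E] := pow_gen Mt pi.
  by exists e; split=> //; rewrite -E subKr.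
have Oe n j : O (e n j).
  have [pe _] := eE n; have [N [c [a [Oc Ma ->]]]] := pe j.
  apply: submodule_sum submoduleO _ => k _; apply: OM => //.
  by apply: O_prod => i _; apply: MO.
pose c j n := e0 j + \sum_(l < n) e l j.
have IE n : I (w n.+1 - \sum_j t j * c j n).
  elim: n => [|n IH].
    rewrite w1E -sumrB big1; first by case: hI.
    by move=> j _; rewrite /c big_ord0 addr0 mulrC subrr.
  have -> : w n.+2 - \sum_j t j * c j n.+1 =
     (w n.+1 - \sum_j t j * c j n) + (w n.+2 - w n.+1 - \sum_j t j * e n j).
    have -> : \sum_j t j * c j n.+1 = \sum_j t j * c j n + \sum_j t j * e n j.
      rewrite -big_split; apply: eq_bigr => j _.
      by rewrite /c big_ord_recr /= addrA mulrDr.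
    by ring.
  by apply: submoduleD => //; have [] := eE n.
exists c => [j|n]; first split=> n.
- by apply: submoduleD submoduleO _ _ => //; apply: submodule_sum submoduleO _.
- rewrite /c big_ord_recr /= addrA [X in X - _]addrC addrK.
  by apply: Fil_pow; have [] := eE n.
rewrite -(subrK (w n.+1) (w n)) -addrA; have hF := Fil_submodule n.
apply: submoduleD => //; last by apply: Fil_ideal; apply: IE.
by rewrite -opprB; apply: submoduleN => //; apply: cohw.
Qed.

End OneIdeal.
Section Congruence.
Variable I : set A.
Hypothesis (hI : submodule I).
Implicit Types u v w : nat -> A.

(** Equality in the completion of O / I. *)
Definition congruent u v := forall n, Fil I n (u n - v n).

Lemma congruent_refl u : congruent u u.
Proof. by move=> n; rewrite subrr; have [] := Fil_submodule hI n. Qed.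

Lemma congruent_sym u v : congruent u v -> congruent v u.
Proof.
by move=> uv n; rewrite -opprB; apply: submoduleN; [exact: Fil_submodule|].
Qed.

Lemma congruent_trans v u w : congruent u v -> congruent v w -> congruent u w.
Proof.
move=> uv vw n; rewrite -(subrK (v n) (u n)) -addrA.
by apply: submoduleD => //; apply: Fil_submodule.
Qed.

Lemma congruentD u u' v v' :
  congruent u u' -> congruent v v' -> congruent (u \+ v) (u' \+ v').
Proof.
move=> uv vw n /=; rewrite opprD addrACA.
by apply: submoduleD => //; apply: Fil_submodule.
Qed.

Lemma congruentM u u' v v' : (forall n, O (u' n)) -> (forall n, O (v n)) ->
  congruent u u' -> congruent v v' -> congruent (u \* v) (u' \* v').
Proof.
move=> Ou Ov uv vw n /=; have hF := Fil_submodule hI n; have [_ _ FC] := hF.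
have -> : u n * v n - u' n * v' n = v n * (u n - u' n) + u' n * (v n - v' n) by ring.
by apply: submoduleD => //; apply: FC.
Qed.

Lemma congruent_sum (T : Type) (s : seq T) (U V : T -> nat -> A) :
  (forall j, congruent (U j) (V j)) ->
  congruent (fun n => \sum_(j <- s) U j n) (fun n => \sum_(j <- s) V j n).
Proof.
move=> UV n; rewrite -sumrB; apply: submodule_sum => [|j _]; last exact: UV.
exact: Fil_submodule.
Qed.

Lemma congruent_prod (T : Type) (s : seq T) (p : pred T) (U V : T -> nat -> A) :
  (forall j n, O (U j n)) -> (forall j n, O (V j n)) ->
  (forall j, congruent (U j) (V j)) ->
  congruent (fun n => \prod_(j <- s | p j) U j n) (fun n => \prod_(j <- s | p j) V j n).
Proof.
move=> OU OV UV; elim: s => [|j s IH] n.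
  by rewrite !big_nil; apply: (congruent_refl (fun=> 1)).
rewrite !big_cons; case: (p j); last exact: IH.
apply: (@congruentM (U j) (V j) _ _ _ _ (UV j) IH n) => // k.
by apply: O_prod => i _; apply: OU.
Qed.

End Congruence.

Section FormalEquivalence.
Variables (K : fieldType) (iota : K -> A) (I J : set A).
Hypotheses (iota0 : iota 0 = 0) (iota1 : iota 1 = 1) (iotaN : forall c, iota (- c) = - iota c)
  (iotaV : forall c, c != 0 -> iota c * iota c^-1 = 1) (Oiota : forall c, O (iota c)).
Hypotheses (residue : forall g, O g -> exists c, M (g - iota c)) (M1 : ~ M 1)
  (unitO : forall g, O g -> ~ M g -> exists2 h, O h & g * h = 1).
Hypotheses (hI : submodule I) (hJ : submodule J) (IM : I `<=` M) (JM : J `<=` M).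

Lemma iota_notin_max c : M (iota c) -> c = 0.
Proof.
move=> Mc; apply: contrapT => /eqP c0; apply: M1.
by rewrite -(iotaV c0) mulrC; apply: MM.
Qed.

Variable Phi : (nat -> A) -> nat -> A.
Hypothesis PhiJ : forall u, coherent O M I u -> coherent O M J (Phi u).
Hypothesis PhiDM : forall u v, coherent O M I u -> coherent O M I v ->
  congruent J (Phi (u \+ v)) (Phi u \+ Phi v) /\
  congruent J (Phi (u \* v)) (Phi u \* Phi v).
Hypothesis Phic : forall c, congruent J (Phi (fun=> iota c)) (fun=> iota c).
Hypothesis Phi0 : forall u, coherent O M I u -> (null O M I u <-> null O M J (Phi u)).
Hypothesis Phi_surj : forall v, coherent O M J v ->
  exists2 u, coherent O M I u & congruent J v (Phi u).

Local Notation cohI := (coherent O M I).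
Local Notation cohJ := (coherent O M J).

Let cohIc c : cohI (fun=> iota c).
Proof. exact: coherent_cst. Qed.

Lemma Phi_difference u v : cohI u -> cohI v ->
  congruent J (Phi u) (Phi v \+ Phi (u \- v)) .
Proof.
move=> cu cv; have [D _] := PhiDM cv (coherentB hI cu cv).
have E : v \+ (u \- v) = u by apply/funext => n /=; rewrite addrC subrK.
by rewrite E in D.
Qed.

(** Phi is additive and kills only the null sequences. *)
Lemma Phi_congruent u v : cohI u -> cohI v ->
  congruent J (Phi u) (Phi v) <-> congruent I u v.
Proof.
move=> cu cv; have D := Phi_difference cu cv.
have [n0 n1] := Phi0 (coherentB hI cu cv); split=> [E|E].
  apply: n1 => n; have hF := Fil_submodule hJ n.
  have -> : Phi (u \- v) n = (Phi u n - Phi v n) -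
      (Phi u n - (Phi v \+ Phi (u \- v)) n) by rewrite /=; ring.
  by have [_ FB _] := hF; apply: FB.
move=> n; have hF := Fil_submodule hJ n.
have -> : Phi u n - Phi v n = (Phi u n - (Phi v \+ Phi (u \- v)) n) + Phi (u \- v) n.
  by rewrite /=; ring.
by apply: submoduleD => //; apply: n0.
Qed.

Lemma cohI_sum (T : Type) (s : seq T) (U : T -> nat -> A) :
  (forall j, cohI (U j)) -> cohI (fun n => \sum_(j <- s) U j n).
Proof.
move=> cU; elim: s => [|j s IH].
  rewrite (_ : (fun _ => _) = fun=> iota 0) //.
  by apply/funext => n; rewrite big_nil iota0.
rewrite (_ : (fun _ => _) = U j \+ (fun n => \sum_(j <- s) U j n)).
  exact: coherentD.
by apply/funext => n; rewrite big_cons.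
Qed.

Lemma cohI_prod (T : Type) (s : seq T) (p : pred T) (U : T -> nat -> A) :
  (forall j, cohI (U j)) -> cohI (fun n => \prod_(j <- s | p j) U j n).
Proof.
move=> cU; elim: s => [|j s IH].
  rewrite (_ : (fun _ => _) = fun=> iota 1) //.
  by apply/funext => n; rewrite big_nil iota1.
have [pj|pj] := boolP (p j); last first.
  rewrite (_ : (fun _ => _) = (fun n => \prod_(j <- s | p j) U j n)) //.
  by apply/funext => n; rewrite big_cons (negbTE pj).
rewrite (_ : (fun _ => _) = U j \* (fun n => \prod_(j <- s | p j) U j n)).
  exact: coherentM.
by apply/funext => n; rewrite big_cons pj.
Qed.

Lemma Phi_sum (T : Type) (s : seq T) (U : T -> nat -> A) : (forall j, cohI (U j)) ->
  congruent J (Phi (fun n => \sum_(j <- s) U j n)) (fun n => \sum_(j <- s) Phi (U j) n).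
Proof.
move=> cU; elim: s => [|j s IH].
  rewrite (_ : (fun _ => _) = fun=> iota 0).
    rewrite (_ : (fun n => \sum_(j <- [::]) Phi (U j) n) = fun=> iota 0) //.
    by apply/funext => n; rewrite big_nil iota0.
  by apply/funext => n; rewrite big_nil iota0.
rewrite (_ : (fun _ => _) = U j \+ (fun n => \sum_(j <- s) U j n)); last first.
  by apply/funext => n; rewrite big_cons.
have [D _] := PhiDM (cU j) (cohI_sum s cU).
apply: congruent_trans D _ => //.
rewrite (_ : (fun n => \sum_(_ <- _ :: _) _) = Phi (U j) \+ (fun n => \sum_(j <- s) Phi (U j) n)).
  by apply: congruentD => //; apply: congruent_refl.
by apply/funext => n; rewrite big_cons.
Qed.

Lemma Phi_prod (T : Type) (s : seq T) (p : pred T) (U : T -> nat -> A) :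
  (forall j, cohI (U j)) ->
  congruent J (Phi (fun n => \prod_(j <- s | p j) U j n))
              (fun n => \prod_(j <- s | p j) Phi (U j) n).
Proof.
move=> cU; elim: s => [|j s IH].
  rewrite (_ : (fun _ => _) = fun=> iota 1).
    rewrite (_ : (fun n => \prod_(j <- [::] | p j) Phi (U j) n) = fun=> iota 1) //.
    by apply/funext => n; rewrite big_nil iota1.
  by apply/funext => n; rewrite big_nil iota1.
have [pj|pj] := boolP (p j); last first.
  rewrite (_ : (fun _ => _) = (fun n => \prod_(j <- s | p j) U j n)); last first.
    by apply/funext => n; rewrite big_cons (negbTE pj).
  rewrite (_ : (fun n => \prod_(j <- _ :: _ | p j) Phi (U j) n) =
               (fun n => \prod_(j <- s | p j) Phi (U j) n)) //.
  by apply/funext => n; rewrite big_cons (negbTE pj).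
rewrite (_ : (fun _ => _) = U j \* (fun n => \prod_(j <- s | p j) U j n)); last first.
  by apply/funext => n; rewrite big_cons pj.
have [_ D] := PhiDM (cU j) (cohI_prod s p cU).
apply: congruent_trans D _ => //.
rewrite (_ : (fun n => \prod_(_ <- _ :: _ | _) _) =
             Phi (U j) \* (fun n => \prod_(j <- s | p j) Phi (U j) n)).
  apply: congruentM => //.
  - by have [] := PhiJ (cU j).
  - by have [] := PhiJ (cohI_prod s p cU).
  exact: congruent_refl.
by apply/funext => n; rewrite big_cons pj.
Qed.

Lemma congruent_mod_max u v : congruent J u v -> M (u 1) -> M (v 1).
Proof.
move=> /(_ 1%N)/(Fil_max JM (ltn0Sn 0)) Muv Mu.
by rewrite -(subKr (u 1%N) (v 1%N)); apply: MB.
Qed.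

Lemma Phi_shift u c : cohI u ->
  congruent J (Phi (u \+ fun=> iota c)) (Phi u \+ fun=> iota c).
Proof.
move=> cu; have [D _] := PhiDM cu (cohIc c).
apply: congruent_trans D _ => //; apply: congruentD => //; exact: congruent_refl.
Qed.

(** Were c <> 0 the residue of Phi u, then the unit u - c of the completion
   would be sent to an element of the maximal ideal. *)
Lemma Phi_local u : cohI u -> M (u 1) -> M (Phi u 1).
Proof.
move=> cu Mu; have [Oz _] := PhiJ cu.
have [c Mc] := residue (Oz 1%N).
have [c0|c0] := eqVneq c 0; first by rewrite c0 iota0 subr0 in Mc.
exfalso; apply: M1.
pose u' := u \+ fun=> iota (- c).
have cu' : cohI u' by apply: coherentD.
have nMu' : ~ M (u' 1%N).
  rewrite /u' /= => Mu'; have : M (iota (- c)) by rewrite -(addKr (u 1%N) (iota _)) addrC; apply: MB.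
  by move/iota_notin_max/eqP; rewrite oppr_eq0 (negbTE c0).
have [w cw uw1] := coherent_unit hI IM cu' unitO nMu'.
have c1 : cohI (fun=> 1) by apply: coherent_cst.
have E1 : congruent J (Phi (u' \* w)) (fun=> 1).
  have := Phic 1; rewrite iota1; apply: congruent_trans => //.
  by apply/(Phi_congruent (coherentM hI cu' cw) c1).
have [_ E2] := PhiDM cu' cw.
apply: (congruent_mod_max E1); apply: (congruent_mod_max (congruent_sym hJ E2)).
rewrite /= mulrC; apply: MM; first by have [] := PhiJ cw.
apply: (congruent_mod_max (congruent_sym hJ (Phi_shift (- c) cu))).
by rewrite /= iotaN.
Qed.

Lemma Phi_local_inv u : cohI u -> M (Phi u 1) -> M (u 1).
Proof.
move=> cu Mz; have [Ou _] := cu.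
have [c Mc] := residue (Ou 1%N).
have [c0|c0] := eqVneq c 0; first by rewrite c0 iota0 subr0 in Mc.
have cu' : cohI (u \+ fun=> iota (- c)) by apply: coherentD.
have : M (Phi (u \+ fun=> iota (- c)) 1%N) by apply: Phi_local; rewrite //= iotaN.
move/(congruent_mod_max (Phi_shift (- c) cu)) => /= Ms.
have : M (iota (- c)) by rewrite -(addKr (Phi u 1%N) (iota _)) addrC; apply: MB.
by move/iota_notin_max/eqP; rewrite oppr_eq0 (negbTE c0).
Qed.

(** The coordinates t j are images by Phi of elements V j of the completion
   of O / I, of which v j is an approximation. Phi being an isomorphism of
   local rings, the V j generate the maximal ideal because the t j do, and a
   product of the V j is zero if the product of the t j lies in J. *)
Lemma formal_coordinates r (t : 'I_r -> A) n : M = ideal_gen O t -> (0 < n)%N ->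
  exists v : 'I_r -> A,
    [/\ forall j, M (v j),
        forall g, M g -> exists2 e : 'I_r -> A, forall j, O (e j) &
          Fil I n (g - \sum_j v j * e j) &
        forall p : pred 'I_r, J (\prod_(j | p j) t j) -> Fil I n (\prod_(j | p j) v j)].
Proof.
move=> Mt n0; have Mtj j : M (t j) by rewrite Mt; apply: submodule_gen_mem.
have ctJ j : cohJ (fun=> t j) by apply: coherent_cst => //; apply: MO.
have /choice[V VE] : forall j, exists V, cohI V /\ congruent J (fun=> t j) (Phi V).
  by move=> j; have [V cV E] := Phi_surj (ctJ j); exists V.
have cV j : cohI (V j) by have [] := VE j.
have tV j : congruent J (fun=> t j) (Phi (V j)) by have [] := VE j.
have MV j : M (V j 1%N).
  by apply: Phi_local_inv => //; apply: (congruent_mod_max (tV j)).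
exists (fun j => V j n); split=> [j|g Mg|p Jp].
- exact: (coherent_max hI IM (cV j)).
- have cg : cohI (fun=> g) by apply: coherent_cst => //; apply: MO.
  have Mw : M (Phi (fun=> g) 1%N) by apply: Phi_local.
  have Mt' : M `<=` ideal_gen O t by rewrite -Mt.
  have [c cc wE] := coherent_gen hJ Mt' (PhiJ cg) Mw.
  have /choice[e eE] : forall j, exists e, cohI e /\ congruent J (c j) (Phi e).
    by move=> j; have [e ce E] := Phi_surj (cc j); exists e.
  have ce j : cohI (e j) by have [] := eE j.
  exists (fun j => e j n); first by move=> j; have [] := ce j.
  have cVe j : cohI (V j \* e j) by apply: coherentM.
  suff : congruent I (fun=> g) (fun n => \sum_j (V j \* e j) n) by apply.
  apply/Phi_congruent => //; first exact: cohI_sum.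
  apply: congruent_trans wE _ => //; apply: congruent_sym => //.
  apply: congruent_trans (Phi_sum _ cVe) _ => //; apply: congruent_sum => // j.
  have [_ D] := PhiDM (cV j) (ce j).
  apply: congruent_trans D _ => //; apply: congruentM => //.
  - by move=> k; apply: MO.
  - by have [] := PhiJ (ce j).
  - exact: congruent_sym.
  by apply: congruent_sym => //; have [] := eE j.
suff /(_ n) : null O M I (fun n => \prod_(j | p j) V j n) by [].
apply/Phi0; first exact: cohI_prod.
have tP : congruent J (fun=> \prod_(j | p j) t j) (Phi (fun n => \prod_(j | p j) V j n)).
  apply: congruent_trans (congruent_sym hJ (Phi_prod _ p cV)) => //.
  apply: congruent_prod => // j k; first exact: MO.
  by have [] := PhiJ (cV j).
move=> k; have hF := Fil_submodule hJ k; have [_ FB _] := hF.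
rewrite -[Phi _ k](subKr (\prod_(j | p j) t j)); apply: FB; last exact: tP.
exact: Fil_ideal.
Qed.

End FormalEquivalence.

End AdicFiltration.

(** * Lowest order terms of rational functions at a point *)

Lemma mpoly_ring_ind (n : nat) (R : comNzRingType) (Pr : {mpoly R[n]} -> Prop) :
  (forall c, Pr c%:MP) -> (forall i, Pr 'X_i) ->
  (forall p q, Pr p -> Pr q -> Pr (p + q)) ->
  (forall p q, Pr p -> Pr q -> Pr (p * q)) -> forall p, Pr p.
Proof.
move=> PC PX PD PM p; rewrite (mpolyE p).
elim/big_rec: _ => [|m q _ Pq]; first by rewrite -mpolyC0; apply: PC.
apply: PD => //; rewrite -mul_mpolyC; apply: (PM) => //.
rewrite mpolyXE_id; elim/big_rec: _ => [|i y _ Py]; first by rewrite -mpolyC1; apply: PC.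
apply: (PM) => //; elim: (m i) => [|k IH]; first by rewrite expr0 -mpolyC1; apply: PC.
by rewrite exprS; apply: PM.
Qed.

Lemma poly_coef0_factor (R : nzRingType) (P : {poly R}) : P`_0 = 0 -> exists Q, P = 'X * Q.
Proof.
move=> P0; have /factor_theorem[Q] : root P 0 by rewrite /root horner_coef0 P0.
by rewrite subr0 => ->; exists Q; rewrite commr_polyX.
Qed.

Lemma poly_Xn_cancel (R : idomainType) (d : nat) (A L W : {poly R}) :
  L`_0 != 0 -> 'X^d * A = L * W -> exists V, W = 'X^d * V.
Proof.
move=> L0; elim: d A W => [|d IH] A W E.
  by exists W; rewrite expr0 mul1r.
have : (L * W)`_0 = 0 by rewrite -E exprS -mulrA coefXM.
rewrite coef0M => /eqP; rewrite mulf_eq0 (negbTE L0) => /eqP /poly_coef0_factor[V EV].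
have [|V' EV'] := IH A V.
  apply: (@mulfI _ 'X); first by rewrite polyX_eq0.
  by rewrite mulrA -exprS E EV mulrCA.
by exists V'; rewrite EV EV' exprS mulrA.
Qed.

Lemma coef0_cross (R : comNzRingType) (B B' E E' : {poly R}) :
  (B * E' + B' * E)`_0 = B`_0 * E'`_0 + B'`_0 * E`_0.
Proof. by rewrite coefD !coef0M. Qed.

Section Jets.
Context {n : nat} {K : fieldType} (x : 'I_n -> K).
Local Notation P := {mpoly K[n]}.
Local Notation Fr := {fraction P}.
Implicit Types (p q b : P) (g h : Fr).

(** The differential of p at x, as a linear form in the direction. *)
Definition linear_part p : P := \sum_i p^`M(i).@[x] *: 'X_i.

Lemma linear_part_homog p : linear_part p \is 1.-homog.
Proof. by apply: rpred_sum => i _; apply: rpredZ; rewrite dhomogX /= mdeg1. Qed.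

Lemma expand_coef1 p : (expand x p)`_1 = linear_part p.
Proof.
elim/mpoly_ring_ind: p => [c|i|p q Ep Eq|p q Ep Eq].
- rewrite expandC coefC /= /linear_part big1 // => i _.
  by rewrite mderivC meval0 scale0r.
- rewrite expandX coefD coefC add0r coefCM coefX mulr1 /linear_part (bigD1 i) //=.
  have U0 : (U_(i) - U_(i))%MM = 0%MM by apply/mnmP => k; rewrite mnmBE subnn mnm0E.
  rewrite mderivX mnm1E eqxx scale1r U0 mpolyX0 meval1 scale1r big1 ?addr0 // => j ne.
  by rewrite mderivX mnm1E eq_sym (negbTE ne) scale0r meval0 scale0r.
- have -> : (expand x (p + q))`_1 = linear_part p + linear_part q.
    by rewrite expandD coefD -Ep -Eq.
  rewrite /linear_part -big_split.
  by apply: eq_bigr => i _; rewrite mderivD mevalD scalerDl.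
have -> : (expand x (p * q))`_1 =
    (p.@[x])%:MP * linear_part q + linear_part p * (q.@[x])%:MP.
  rewrite expandM coefM big_ord_recl big_ord1 -Ep -Eq.
  by congr (_ * _ + _ * _); exact: expand_coef0.
rewrite /linear_part big_distrr big_distrl -big_split; apply: eq_bigr => i _ /=.
rewrite mderivM mevalD !mevalM scalerDl -!mul_mpolyC !mpolyCM; ring.
Qed.

(** The function g, written p / q with q(x) <> 0, vanishes at x to order at
   least k, and b is the term of order k of its expansion at x, possibly
   zero. *)
Definition jet k g b := exists p q B,
  [/\ q.@[x] != 0, expand x p = 'X^k * B, B`_0 = (q.@[x])%:MP * b &
      g * tofrac q = tofrac p].

Lemma tofrac_neq0 q : q.@[x] != 0 -> tofrac q != 0.
Proof. by move=> qx; rewrite tofrac_eq0; apply: contra_neq qx => ->; rewrite meval0. Qed.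

Lemma jetD k g h b c : jet k g b -> jet k h c -> jet k (g + h) (b + c).
Proof.
move=> [p [q [B [qx pE BE gE]]]] [p' [q' [B' [qx' pE' BE' hE]]]].
exists (p * q' + p' * q), (q * q'), (B * expand x q' + B' * expand x q); split.
- by rewrite mevalM mulf_neq0.
- by rewrite expandD expandM pE expandM pE' mulrDr; congr (_ + _); exact: esym (mulrA _ _ _).
- have E0 a : (expand x a)`_0 = a.@[x]%:MP := expand_coef0 x a.
  rewrite coef0_cross BE BE' (E0 q) (E0 q') mevalM mpolyCM; ring.
by rewrite tofracM tofracD !tofracM -gE -hE; ring.
Qed.

Lemma jetM k l g h b c : jet k g b -> jet l h c -> jet (k + l) (g * h) (b * c).
Proof.
move=> [p [q [B [qx pE BE gE]]]] [p' [q' [B' [qx' pE' BE' hE]]]].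
exists (p * p'), (q * q'), (B * B'); split.
- by rewrite mevalM mulf_neq0.
- by rewrite expandM pE pE' exprD; exact: mulrACA.
- by rewrite coef0M BE BE' mevalM mpolyCM; ring.
by rewrite !tofracM -gE -hE; ring.
Qed.

Lemma jetC c : jet 0 (tofrac c%:MP) c%:MP.
Proof.
exists c%:MP, 1, c%:MP%:P; rewrite meval1 expr0 mul1r mpolyC1 mul1r tofrac1 mulr1 expandC.
by rewrite coefC oner_neq0.
Qed.

Lemma jet0 k : jet k 0 0.
Proof.
exists 0, 1, 0; split; rewrite ?meval1 ?oner_neq0 ?mulr0 ?coef0 ?mul0r //.
by rewrite -mpolyC0 expandC mpolyC0.
Qed.

Lemma jetB k g h b c : jet k g b -> jet k h c -> jet k (g - h) (b - c).
Proof.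
move=> jg jh; apply: jetD jg _.
have := jetM (jetC (-1)) jh.
by rewrite mpolyCN mpolyC1 tofracN tofrac1 !mulN1r.
Qed.

Lemma jet_lower k g b : jet k.+1 g b -> jet k g 0.
Proof.
move=> [p [q [B [qx pE BE gE]]]]; exists p, q, ('X * B); split=> //.
  by rewrite pE exprSr mulrA.
by rewrite coefXM mulr0.
Qed.

(** Cross multiply the two fractions and compare the terms of order k. *)
Lemma jet_uniq k g b c : jet k g b -> jet k g c -> b = c.
Proof.
move=> [p [q [B [qx pE BE gE]]]] [p' [q' [B' [qx' pE' BE' gE']]]].
have : p * q' = p' * q.
  by apply/eqP; rewrite -tofrac_eq !tofracM -gE -gE'; apply/eqP; ring.
move/(congr1 (expand x)); rewrite !expandM pE pE' -!mulrA.
have Xk0 : 'X^k != 0 :> {poly P} by rewrite -size_poly_gt0 size_polyXn.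
move/(mulfI Xk0).
move/(congr1 (fun A : {poly P} => A`_0)); rewrite /= !coef0M !expand_coef0 BE BE'.
move=> E; have qq : (q.@[x] * q'.@[x])%:MP_[n] != 0 by rewrite mpolyC_eq0 mulf_neq0.
by apply: (mulfI qq); rewrite mpolyCM; move: E; rewrite mulrAC [RHS]mulrAC [_ * q.@[x]%:MP]mulrC.
Qed.

Definition has_jet k g := exists b, jet k g b.

Lemma has_jet_sum k (T : Type) (s : seq T) (F : T -> Fr) :
  (forall j, has_jet k (F j)) -> has_jet k (\sum_(j <- s) F j).
Proof.
move=> H; elim/big_rec: _ => [|j y _ [c jc]]; first by exists 0; apply: jet0.
by have [b jb] := H j; exists (b + c); apply: jetD.
Qed.

Lemma has_jet_lower k l g : (k < l)%N -> has_jet l g -> jet k g 0.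
Proof.
move=> lt [b]; rewrite -(subnKC lt) addnC; move: (l - k.+1)%N => d.
by elim: d b => [|d IH] b; [exact: jet_lower|rewrite addSn => /jet_lower/IH].
Qed.

Lemma jet_prod (T : Type) (s : seq T) (pr : pred T) (v : T -> Fr) (b : T -> P) :
  (forall j, jet 1 (v j) (b j)) ->
  jet (\sum_(j <- s | pr j) 1) (\prod_(j <- s | pr j) v j) (\prod_(j <- s | pr j) b j).
Proof.
move=> vb; elim: s => [|j s IH]; first by rewrite !big_nil -mpolyC1 -tofrac1 -mpolyC1; apply: jetC.
by rewrite !big_cons; case: (pr j) => //; apply: jetM.
Qed.

End Jets.

(** * Products of linear forms *)

Section LinearAlgebra.
Context {K : numClosedFieldType} {n : nat}.
Local Notation P := {mpoly K[n]}.

Lemma homog1E (p : P) : p \is 1.-homog -> p = \sum_k p@_U_(k) *: 'X_k.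
Proof.
move=> hp; rewrite -[LHS]mulr1n -(euler_homog hp); apply: eq_bigr => k _.
have /homog0_const -> := dhomog_deriv k hp.
by rewrite mcoeff_deriv mnm0E mulr1n add0m mulrC mul_mpolyC.
Qed.

Lemma meval_homog1 (p : P) z : p \is 1.-homog -> p.@[z] = \sum_k p@_U_(k) * z k.
Proof.
move=> /homog1E {1}->; rewrite raddf_sum; apply: eq_bigr => k _ /=.
by rewrite mevalZ mevalXU.
Qed.

Definition coef_mx e (b : 'I_e -> P) := \matrix_(j, k) (b j)@_U_(k).

Lemma dual_basis e (b : 'I_e -> P) : (forall j, b j \is 1.-homog) ->
  row_free (coef_mx b) ->
  exists z : 'I_e -> 'I_n -> K, forall l j, (b l).@[z j] = (l == j)%:R.
Proof.
move=> hb /row_freeP[C BC]; exists (fun j k => C k j) => l j.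
rewrite meval_homog1 //; have := congr1 (fun A : 'M_e => A l j) BC.
by rewrite !mxE => <-; apply: eq_bigr => k _; rewrite mxE.
Qed.

Lemma homog1_divides (l b : P) : l \is 1.-homog -> b \is 1.-homog -> b != 0 ->
  divides l b -> exists2 c : K, c != 0 & b = c *: l.
Proof.
move=> hl hb b0 [e E].
have e0 : e != 0 by apply: contra_neq b0 => h; rewrite E h mul0r.
have l0 : l != 0 by apply: contra_neq b0 => h; rewrite E h mulr0.
have s1 (p : P) : p \is 1.-homog -> p != 0 -> msize p = 2%N.
  by move=> hp p0; rewrite -mlead_deg // (homog_mdeg hp) // mlead_supp.
have se : msize e = 1%N.
  have := s1 b hb b0; rewrite E msizeM // (s1 l hl l0).
  have : (0 < msize e)%N by rewrite lt0n msize_poly_eq0.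
  by move=> _; rewrite addn2 => -[].
have /eqP/msize_poly1P[c c0 Ec] := se.
by exists c; rewrite // E Ec mul_mpolyC.
Qed.

(** By unique factorization each l i is proportional to some b j. Two of them
   cannot be proportional to the same b j, whose square would divide a
   product of distinct independent linear forms. So vectors dual to the l i
   are multiples of vectors dual to the b j. *)
Lemma linear_factor_matching e s (b : 'I_e -> P) (S : pred 'I_e)
    (z : 'I_e -> 'I_n -> K) (l : 'I_s -> P) (M : pred 'I_s) :
  (forall j, b j \is 1.-homog) -> (forall i j, (b i).@[z j] = (i == j)%:R) ->
  (forall i, l i \is 1.-homog) -> (forall i, M i -> l i != 0) ->
  divides (\prod_(i | M i) l i) (\prod_(j | S j) b j) ->
  exists xi : 'I_s -> 'I_n -> K, forall i, M i -> forall k, M k ->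
    (l k).@[xi i] = (k == i)%:R.
Proof.
move=> hb bz hl l0 dlb.
have b0 j : b j != 0.
  apply/eqP => bj; have := bz j j; rewrite bj meval0 eqxx => /eqP.
  by rewrite eq_sym oner_eq0.
have lprime i : M i -> prime_element (l i).
  by move=> Mi; apply/mpoly_irreducible_prime/homog1_irreducible; rewrite ?l0.
have lb i : M i -> exists j, S j /\ exists2 c : K, c != 0 & b j = c *: l i.
  move=> Mi.
  have : divides (l i) (\prod_(j <- [seq j <- index_enum 'I_e | S j]) b j).
    rewrite big_filter; apply: divides_trans dlb.
    by rewrite (bigD1 i) //=; apply: divides_mulr; apply: dividesxx.
  case/(prime_divides_prod (lprime i Mi)) => j; rewrite mem_filter => /andP[Sj _] d.
  by exists j; split=> //; apply: homog1_divides.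
have distinct i k j (c c' : K) : M i -> M k -> S j -> c != 0 -> c' != 0 ->
    b j = c *: l i -> b j = c' *: l k -> i = k.
  move=> Mi Mk Sj c0 c'0 Ei Ek; apply: contrapT => /eqP ne.
  have bprime : prime_element (b j).
    by apply/mpoly_irreducible_prime/homog1_irreducible.
  have bl i' c'' : c'' != 0 -> b j = c'' *: l i' -> divides (b j) (l i').
    move=> c''0 ->; exists (c''^-1)%:MP.
    by rewrite mul_mpolyC scalerA mulVf // scale1r.
  have [w Ew] : divides (b j * b j) (\prod_(j' | S j') b j').
    apply: divides_trans dlb; rewrite (bigD1 i) //= (bigD1 k) /=; last by rewrite Mk eq_sym.
    have [e1 ->] := bl _ _ c0 Ei; have [e2 ->] := bl _ _ c'0 Ek.
    set R' := \prod_(_ | _) _; exists (e1 * e2 * R'); ring.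
  have : divides (b j) (\prod_(j' <- [seq j' <- index_enum 'I_e | S j' && (j' != j)]) b j').
    rewrite big_filter; exists w; apply: (mulfI (b0 j)).
    by rewrite -[LHS](bigD1 j Sj) Ew; ring.
  case/(prime_divides_prod bprime) => j'; rewrite mem_filter => /andP[/andP[_ ne'] _].
  case=> q /(congr1 (meval (z j'))); rewrite mevalM !bz eqxx (eq_sym j) (negbTE ne') mulr0.
  by move/eqP; rewrite oner_eq0.
have /choice[xi xiE] : forall i, exists xi : 'I_n -> K, M i -> forall k, M k ->
    (l k).@[xi] = (k == i)%:R.
  move=> i; have [Mi|nMi] := boolP (M i); last by exists (fun=> 0).
  have [j [Sj [c c0 Ec]]] := lb i Mi.
  exists (fun x => c * z j x) => _ k Mk.
  rewrite (meval_homogZ _ _ (hl k)) expr1.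
  have [j' [Sj' [c' c'0 Ec']]] := lb k Mk.
  have bk : c' * (l k).@[z j] = (j' == j)%:R by rewrite -bz Ec' mevalZ.
  have lk : (l k).@[z j] = c'^-1 * (j' == j)%:R by rewrite -bk mulKf.
  rewrite lk; have [Ej|ne] := eqVneq j' j.
    rewrite Ej in Ec' Sj'; have E := distinct i k j c c' Mi Mk Sj c0 c'0 Ec Ec'.
    rewrite E eqxx mulr1; suff -> : c = c' by rewrite divff.
    have lk0 := l0 k Mk; move: Ec; rewrite Ec' E => /eqP.
    by rewrite -subr_eq0 -scalerBl mscalerI subr_eq0 (negbTE lk0) orbF => /eqP.
  rewrite mulr0 mulr0; case: eqP => // E.
  have := bz j j; rewrite Ec -E mevalZ lk (negbTE ne) !mulr0 eqxx => /eqP.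
  by rewrite eq_sym oner_eq0.
by exists xi => i Mi; apply: xiE.
Qed.

End LinearAlgebra.

(** * The local ring of a point of the projective space *)

Section LocalRing.
Context {K : numClosedFieldType} {r : nat} (x : coords K r).
Local Notation P := {mpoly K[r.+1]}.
Local Notation Fr := {fraction P}.
Local Notation O := (local_ring x).
Local Notation M := (local_max x).
Implicit Types (I : set P) (g h : Fr) (p q : P).

Lemma ideal_atP I g : ideal_at I x g <-> exists d p q,
  [/\ p \is d.-homog, q \is d.-homog, I p, q.@[x] != 0 & g * tofrac q = tofrac p].
Proof.
split=> [[[d p q hp hq] /= [Ip qx ->]]|[d [p [q [hp hq Ip qx gE]]]]].
  by exists d, p, q; split=> //; apply: divfK; apply: tofrac_neq0 qx.
exists (HFrac hp hq); split=> //.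
exact: (canRL (mulfK (tofrac_neq0 qx)) gE).
Qed.

Lemma ideal_at_sub I I' : I `<=` I' -> ideal_at I x `<=` ideal_at I' x.
Proof. by move=> II' g [u [Iu ux ->]]; exists u; split=> //; apply: II'. Qed.

Lemma ideal_atB I g h : is_ideal I -> ideal_at I x g -> ideal_at I x h ->
  ideal_at I x (g - h).
Proof.
move=> hI /ideal_atP[d [p [q [hp hq Ip qx gE]]]] /ideal_atP[d' [p' [q' [hp' hq' Ip' qx' hE]]]].
have [_ _ IM] := hI; apply/ideal_atP.
exists (d + d')%N, (q' * p - q * p'), (q * q'); split.
- apply: rpredB; last exact: dhomogM.
  by rewrite addnC; apply: dhomogM.
- exact: dhomogM.
- by apply: idealB => //; apply: IM.
- by rewrite mevalM mulf_neq0.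
by rewrite tofracB !tofracM -gE -hE; ring.
Qed.

Lemma ideal_atM I g h : is_ideal I -> O g -> ideal_at I x h -> ideal_at I x (g * h).
Proof.
move=> [_ _ IM] /ideal_atP[d [p [q [hp hq _ qx gE]]]] /ideal_atP[d' [p' [q' [hp' hq' Ip' qx' hE]]]].
apply/ideal_atP; exists (d + d')%N, (p * p'), (q * q'); split.
- exact: dhomogM.
- exact: dhomogM.
- exact: IM.
- by rewrite mevalM mulf_neq0.
by rewrite !tofracM -gE -hE; ring.
Qed.

Lemma ideal_at0 I : is_ideal I -> ideal_at I x 0.
Proof.
move=> [I0 _ _]; apply/ideal_atP; exists 0%N, 0, 1.
by rewrite mul0r tofrac0 meval1 oner_neq0 dhomog1 rpred0.
Qed.

Lemma setT_ideal : is_ideal (setT : set P).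
Proof. by []. Qed.

Lemma point_ideal : is_ideal [set p : P | p.@[x] = 0].
Proof.
split=> [|a b|c a] /=; rewrite ?meval0 ?mevalD ?mevalM //.
  by move=> -> ->; rewrite addr0.
by move=> ->; rewrite mulr0.
Qed.

Lemma local_ring_const c : O (const_frac c).
Proof.
apply/ideal_atP; exists 0%N, c%:MP, 1; rewrite tofrac1 mulr1 meval1 oner_neq0 dhomog1.
by split=> //; rewrite -[c%:MP]mulr1 mul_mpolyC; apply: rpredZ; apply: dhomog1.
Qed.

Lemma local_ring1 : O 1.
Proof. by have := local_ring_const 1; rewrite /const_frac mpolyC1 tofrac1. Qed.

Lemma local_residue g : O g -> exists c, M (g - const_frac c).
Proof.
move=> /ideal_atP[d [p [q [hp hq _ qx gE]]]]; exists (p.@[x] / q.@[x]).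
apply/ideal_atP; exists d, (p - (p.@[x] / q.@[x])%:MP * q), q; split=> //=.
- by apply: rpredB => //; rewrite mul_mpolyC; apply: rpredZ.
- by rewrite mevalB mevalM mevalC divfK ?subrr.
by rewrite tofracB tofracM mulrBl gE.
Qed.

Lemma local_unit g : O g -> ~ M g -> exists2 h, O h & g * h = 1.
Proof.
move=> /ideal_atP[d [p [q [hp hq _ qx gE]]]] nM.
have px : p.@[x] != 0.
  by apply/eqP => px; apply: nM; apply/ideal_atP; exists d, p, q.
have qF := tofrac_neq0 qx; have pF := tofrac_neq0 px.
exists (tofrac q / tofrac p); last by rewrite mulrA gE divff.
by apply/ideal_atP; exists d, q, p; rewrite divfK.
Qed.

Lemma local_max1 : ~ M 1.
Proof.
move=> /ideal_atP[d [p [q [_ _ /= px qx]]]]; rewrite mul1r => /eqP.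
by rewrite tofrac_eq => /eqP E; rewrite E px eqxx in qx.
Qed.

Lemma local_jet0 g : O g -> exists c, jet x 0 g c%:MP.
Proof.
move=> /ideal_atP[d [p [q [hp hq _ qx gE]]]]; exists (p.@[x] / q.@[x]).
exists p, q, (expand x p); split=> //; first by rewrite expr0 mul1r.
by rewrite expand_coef0 -mpolyCM mulrC divfK.
Qed.

Lemma point_expansion p : p.@[x] = 0 ->
  exists B, expand x p = 'X * B /\ B`_0 = linear_part x p.
Proof.
move=> px; have /poly_coef0_factor[B EB] : (expand x p)`_0 = 0.
  by rewrite expand_coef0 px mpolyC0.
by exists B; split=> //; rewrite -expand_coef1 EB coefXM.
Qed.

Lemma local_jet1 g : M g -> exists b, b \is 1.-homog /\ jet x 1 g b.
Proof.
move=> /ideal_atP[d [p [q [hp hq /= px qx gE]]]].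
have [B [EB B0]] := point_expansion px.
exists (q.@[x]^-1 *: linear_part x p); split; first exact/rpredZ/linear_part_homog.
exists p, q, B; split=> //.
by rewrite B0 mul_mpolyC scalerA divff // scale1r.
Qed.

Lemma ideal_pow_jet k g : ideal_pow O M k g -> has_jet x k g.
Proof.
move=> [N [c [a [Oc Ma ->]]]]; apply: has_jet_sum => j.
have [e je] := local_jet0 (Oc j).
have /choice[b jb] : forall i, exists b, jet x 1 (a j i) b.
  by move=> i; have [b [_ jb]] := local_jet1 (Ma j i); exists b.
have := jetM je (jet_prod (index_enum 'I_k) xpredT jb).
rewrite sum_nat_const card_ord muln1 add0n => jj; by eexists; exact: jj.
Qed.

(** Up to the factor x a ^+ 2, the differential at x of the affine coordinate
   'X_(lift a k) / 'X_a. *)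
Definition coordinate_form a (k : 'I_r) : P :=
  x a *: 'X_(lift a k) - x (lift a k) *: 'X_a.

Lemma local_coordinate_jet a k : x a != 0 ->
  exists2 g, M g & jet x 1 g ((x a ^+ 2)^-1 *: coordinate_form a k).
Proof.
move=> xa; pose q : P := x a *: 'X_a; pose p := coordinate_form a k.
have hX i : ('X_i : P) \is 1.-homog by rewrite dhomogX /= mdeg1.
have qx : q.@[x] = x a ^+ 2 by rewrite mevalZ mevalXU expr2.
have qx0 : q.@[x] != 0 by rewrite qx expf_neq0.
have px : p.@[x] = 0 by rewrite mevalB !mevalZ !mevalXU mulrC subrr.
have gE : tofrac p / tofrac q * tofrac q = tofrac p by rewrite divfK // (tofrac_neq0 qx0).
exists (tofrac p / tofrac q).
  apply/ideal_atP; exists 1%N, p, q; split=> //; last by apply: rpredZ.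
  by apply: rpredB; apply: rpredZ.
have [B [EB B0]] := point_expansion px.
exists p, q, B; split=> //.
rewrite B0 qx mul_mpolyC scalerA divff ?expf_neq0 // scale1r.
have hp : p \is 1.-homog by apply: rpredB; apply: rpredZ.
rewrite [RHS](homog1E hp); apply: eq_bigr => i _; congr (_ *: _).
have /homog0_const -> := dhomog_deriv i hp.
by rewrite mevalC mcoeff_deriv mnm0E mulr1n add0m.
Qed.

(** The differentials of the r affine coordinates around x are independent,
   and they are combinations of the tau j by hypothesis. *)
Lemma differential_span e (tau : 'I_e -> P) : nonzero x ->
  (forall g b, M g -> jet x 1 g b -> exists c : 'I_e -> K, b = \sum_j c j *: tau j) ->
  (r <= \rank (coef_mx tau))%N.
Proof.
move=> [a xa] span; pose T := coef_mx (fun k => (x a ^+ 2)^-1 *: coordinate_form a k).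
have /choice[c cE] : forall k, exists c : 'I_e -> K,
    (x a ^+ 2)^-1 *: coordinate_form a k = \sum_j c j *: tau j.
  by move=> k; have [g Mg jg] := local_coordinate_jet k xa; apply: span jg.
have TE : T = (\matrix_(k, j) c k j) *m coef_mx tau.
  apply/matrixP => k l; rewrite !mxE cE raddf_sum; apply: eq_bigr => j _.
  by rewrite /= mcoeffZ !mxE.
have freeT : row_free T.
  apply/row_freeP; exists (\matrix_(l, k) (x a * (l == lift a k)%:R)).
  apply/matrixP => k k'; rewrite !mxE (bigD1 (lift a k')) //= big1 ?addr0.
    rewrite !mxE eqxx mulr1 mcoeffZ mcoeffB !mcoeffZ !mcoeffXU.
    rewrite (inj_eq (@lift_inj _ a)) (negbTE (neq_lift a k')) mulr0 subr0.
    case: (k == k'); last by rewrite !mulr0 mul0r.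
    by rewrite mulr1 -mulrA -expr2 mulVf ?expf_neq0.
  by move=> l /negbTE ne; rewrite !mxE ne mulr0 mulr0.
have /eqP rT := freeT; rewrite -[X in (X <= _)%N]rT TE; exact: mxrankM_maxr.
Qed.

Lemma jet_combination e (v c : 'I_e -> Fr) (b : 'I_e -> P) :
  (forall j, jet x 1 (v j) (b j)) -> (forall j, O (c j)) ->
  exists a : 'I_e -> K, jet x 1 (\sum_j v j * c j) (\sum_j a j *: b j).
Proof.
move=> vb Oc; have /choice[a aE] : forall j, exists a : K, jet x 0 (c j) a%:MP.
  by move=> j; apply: local_jet0.
exists a; elim/big_ind2: _ => [|g1 b1 g2 b2|j _]; [exact: jet0|exact: jetD|].
by have := jetM (vb j) (aE j); rewrite addn0 [b j * _]mulrC mul_mpolyC.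
Qed.

End LocalRing.

(** * Differentials of the components of a normal crossing divisor *)

(** The left side has order exactly k in 'X, so that mu <= k and W is
   divisible by 'X^(k - mu); it remains to compare the terms of order k. *)
Lemma leading_divides (R : idomainType) (B E L W : {poly R}) (k mu : nat) :
  L`_0 != 0 -> B`_0 != 0 -> E`_0 != 0 -> 'X^k * (B * E) = 'X^mu * (L * W) ->
  divides L`_0 (B`_0 * E`_0).
Proof.
move=> L0 B0 E0 EQ; have X0 d : 'X^d != 0 :> {poly R} by rewrite -size_poly_gt0 size_polyXn.
have [lt|le] := ltnP k mu.
  move: EQ; rewrite -(subnKC (ltnW lt)) exprD -mulrA => /(mulfI (X0 k)).
  rewrite -(prednK (_ : 0 < mu - k)%N) ?subn_gt0 // exprS -mulrA.
  move/(congr1 (fun A : {poly R} => A`_0)); rewrite /= coefXM coef0M => /eqP.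
  by rewrite mulf_eq0 (negbTE B0) (negbTE E0).
move: EQ; rewrite -(subnKC le) exprD -mulrA => /(mulfI (X0 mu)) EQ.
have [V WE] := poly_Xn_cancel L0 EQ.
move: EQ; rewrite WE [L * _]mulrCA => /(mulfI (X0 (k - mu)%N)) EQ.
by exists V`_0; rewrite -coef0M EQ coef0M mulrC.
Qed.

Lemma has_jetI n (K : fieldType) (x : 'I_n -> K) k g (p q : {mpoly K[n]}) B :
  q.@[x] != 0 -> expand x p = 'X^k * B -> g * tofrac q = tofrac p -> has_jet x k g.
Proof.
move=> qx EB gE; exists ((q.@[x])^-1%:MP * B`_0); exists p, q, B; split=> //.
by rewrite mulrA -mpolyCM divff // mpolyC1 mul1r.
Qed.

Section Gradients.
Context {K : numClosedFieldType} {m : nat} (x : coords K m.+2).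
Local Notation P := {mpoly K[m.+3]}.
Hypothesis x0 : nonzero x.

Lemma meval_linear_part (F : P) z :
  (linear_part x F).@[z] = \sum_k z k * F^`M(k).@[x].
Proof.
rewrite raddf_sum; apply: eq_bigr => k _ /=.
by rewrite mevalZ mevalXU mulrC.
Qed.

(** If the differential of F vanished at x, the elements of the ideal of
   zero_locus F would vanish to order 2 at x, and the differentials of the r
   - 1 generators of the maximal ideal would span the cotangent space of the
   projective space, of dimension r. *)
Lemma nonsingular_gradient (F : P) : irreducible_element F ->
  nonsingular m.+1 (zero_locus F) -> F.@[x] = 0 -> linear_part x F != 0.
Proof.
move=> irrF smooth Fx; apply/eqP => lF0.
have [t [Mt gen]] := smooth x (conj x0 Fx).
have /choice[tau tauE] : forall j, exists b, b \is 1.-homog /\ jet x 1 (t j) b.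
  by move=> j; apply: local_jet1.
suff : (m.+2 <= \rank (coef_mx tau))%N.
  by rewrite leqNgt ltnS rank_leq_row.
apply: differential_span x0 _ => g b Mg jg.
have [h /ideal_atP[d [p [q [_ _ Vp qx hE]]]] [c Oc ghE]] := gen g Mg.
have [e pE] : divides F p by apply: projective_hypersurface_nullstellensatz => // z; apply: Vp.
have [B [EB B0]] := point_expansion Fx.
have /poly_coef0_factor[B' EB'] : B`_0 = 0 by rewrite B0.
have jh : jet x 1 h 0.
  apply: (@has_jet_lower _ _ _ 1 2) => //.
  apply: (has_jetI (B := B' * expand x e) qx _ hE).
  by rewrite pE mulrC expandM EB EB' expr2 !mulrA.
have [a ja] := jet_combination (fun j => (tauE j).2) Oc.
exists a; have := jetB jg jh; rewrite subr0.
have -> : g - h = \sum_j t j * c j by rewrite ghE; apply: eq_bigr => j _; exact: mulrC.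
by move/jet_uniq/(_ ja).
Qed.

(** Let mu be the number of the F i through x. If mu <= 1, smoothness
   suffices. Otherwise f vanishes to order 2 at x, so that working modulo f
   does not affect differentials: the approximations v j of the pulled back
   formal coordinates have differentials b j that span the cotangent space,
   hence form a basis of it. Since v 0 * ... * v (k - 1) is a multiple of f
   up to order k + 1, the term of lowest order of f, the product of the
   linear parts of the F i through x, divides b 0 * ... * b (k - 1);
   linear_factor_matching concludes. *)
Lemma normal_crossing_dual_vectors s (F : 'I_s -> P) :
  (forall i, (F i).@[x] = 0 -> linear_part x (F i) != 0) ->
  (exists (k : nat) (t : 'I_m.+2 -> {fraction P}),
      [/\ (1 <= k <= m.+2)%N, local_coordinates x t &
          formally_equivalent const_frac (local_ring x) (local_max x)
            (ideal_at (ideal_gen setT (fun _ : 'I_1 => \prod_i F i)) x)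
            (ideal_gen (local_ring x)
               (fun _ : 'I_1 => \prod_(i < m.+2 | (i < k)%N) t i))]) ->
  dual_vectors F x.
Proof.
move=> smooth [k [t [/andP[k1 kr] tM [Phi [PhiJ PhiDM Phic Phi0 Phis]]]]].
set f := \prod_i F i in PhiJ PhiDM Phic Phi0 Phis.
set I := ideal_at _ x in PhiJ PhiDM Phic Phi0 Phis.
set J := ideal_gen _ _ in PhiJ PhiDM Phic Phi0 Phis.
pose Z i := (F i).@[x] == 0.
pose mu := (\sum_(i | Z i) 1)%N.
have /choice[B BE] : forall i, exists B, Z i ->
    expand x (F i) = 'X * B /\ B`_0 = linear_part x (F i).
  move=> i; have [/eqP Zi|nZ] := boolP (Z i); last by exists 0.
  by have [B [EB B0]] := point_expansion Zi; exists B.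
have Ef : expand x f = 'X^mu * ((\prod_(i | Z i) B i) * \prod_(i | ~~ Z i) expand x (F i)).
  rewrite /f rmorph_prod (bigID Z) /= mulrA; congr (_ * _).
  rewrite expr_sum -big_split /=; apply: eq_bigr => i Zi.
  by rewrite expr1; have [] := BE i Zi.
have L0 : (\prod_(i | Z i) B i)`_0 = \prod_(i | Z i) linear_part x (F i).
  elim/big_rec2: _ => [|i a b Zi E]; first by rewrite coefC.
  by rewrite coef0M E; have [_ ->] := BE i Zi.
(* A single component through x: its nonzero differential has a dual vector. *)
have [le|gt] := leqP mu 1.
  move=> i /eqP Zi.
  have uniq l : Z l -> l = i.
    move=> Zl; apply: contrapT => /eqP ne; move: le.
    by rewrite /mu (bigD1 i) //= (bigD1 l) //= Zl.
  have li := smooth i (eqP Zi).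
  have [z zi] := mpoly_nonvanishing li.
  exists (fun k => (linear_part x (F i)).@[z]^-1 * z k) => l /eqP/uniq ->.
  rewrite eqxx -meval_linear_part (meval_homogZ _ _ (linear_part_homog _ _)).
  by rewrite expr1 mulVf.
have I1 : is_ideal (ideal_gen setT (fun _ : 'I_1 => f)) by apply: ideal_gen_is_ideal.
have Ijet2 y : I y -> jet x 1 y 0.
  move=> /ideal_atP[d [p [q [_ _ [c _ pE] qx yE]]]].
  apply: (@has_jet_lower _ _ _ 1 2) => //; rewrite big_ord1 in pE.
  set C := (\prod_(i | Z i) B i) * \prod_(i | ~~ Z i) expand x (F i) in Ef.
  apply: (has_jetI (B := expand x (c ord0) * ('X^(mu - 2) * C)) qx _ yE).
  have Xmu : 'X^mu = 'X^2 * 'X^(mu - 2) :> {poly P} by rewrite -exprD subnKC.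
  by rewrite pE expandM Ef Xmu -mulrA mulrCA.
have subI : submodule (local_ring x) I.
  by split=> [|g h|g h]; [apply: ideal_at0|apply: ideal_atB|apply: ideal_atM].
have localOB (g h : {fraction P}) : local_ring x g -> local_ring x h -> local_ring x (g - h).
  by apply: ideal_atB; apply: setT_ideal.
have localOM (g h : {fraction P}) : local_ring x g -> local_ring x h -> local_ring x (g * h).
  by apply: ideal_atM; apply: setT_ideal.
have maxO : local_max x `<=` local_ring x by apply: ideal_at_sub.
have subM : submodule (local_ring x) (local_max x).
  have hp := point_ideal x.
  by split=> [|g h|g h]; [apply: ideal_at0|apply: ideal_atB|apply: ideal_atM].
have [M0 MB MM] := subM.
have subJ : submodule (local_ring x) J.
  exact: ideal_gen_submodule (local_ring1 x) localOB localOM _ _.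
have IsubM : I `<=` local_max x.
  apply: ideal_at_sub => p [c _ ->] /=; rewrite big_ord1 mevalM.
  have [i Zi] : exists i, Z i.
    apply: contrapT => H; move: gt; rewrite /mu big1 // => i Zi.
    by case: H; exists i.
  by rewrite /f (bigD1 i) //= mevalM (eqP Zi) mul0r mulr0.
have Mt j : local_max x (t j).
  by rewrite tM; exact: (submodule_gen_mem (local_ring1 x) localOB localOM t j).
have JsubM : J `<=` local_max x.
  move=> y [c Oc ->]; rewrite big_ord1; apply: (MM); first exact: Oc.
  pose j0 : 'I_m.+2 := ord0.
  rewrite (bigD1 j0) //= mulrC; apply: MM; last exact: Mt.
  by elim/big_ind: _ => [|a b|j _]; [exact: local_ring1|exact: localOM|exact: maxO].
have iotaV c : c != 0 -> @const_frac K m.+2 c * const_frac c^-1 = 1.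
  by move=> c0; rewrite /const_frac -tofracM -mpolyCM divff // mpolyC1 tofrac1.
have iota0 : @const_frac K m.+2 0 = 0 by rewrite /const_frac mpolyC0 tofrac0.
have iota1 : @const_frac K m.+2 1 = 1 by rewrite /const_frac mpolyC1 tofrac1.
have iotaN c : @const_frac K m.+2 (- c) = - const_frac c.
  by rewrite /const_frac mpolyCN tofracN.
have [v [Mv vgen vprod]] := formal_coordinates (local_ring1 x) localOB localOM maxO MB MM M0
  iota0 iota1 iotaN iotaV (local_ring_const x) (@local_residue _ _ x) (@local_max1 _ _ x)
  (@local_unit _ _ x) subI subJ IsubM JsubM PhiJ PhiDM Phic Phi0 Phis tM (ltn0Sn k).
have /choice[b bE] : forall j, exists b, b \is 1.-homog /\ jet x 1 (v j) b.
  by move=> j; apply: local_jet1.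
have hb j : b j \is 1.-homog by have [] := bE j.
have jb j : jet x 1 (v j) (b j) by have [] := bE j.
have rk : (m.+2 <= \rank (coef_mx b))%N.
  apply: differential_span x0 _ => g c Mg jg.
  have [e Oe [y Iy py]] := vgen g Mg.
  have [a ja] := jet_combination jb Oe.
  exists a; apply: (jet_uniq jg).
  have jy : jet x 1 (g - \sum_j v j * e j - y) 0.
    by apply: has_jet_lower (ideal_pow_jet py).
  have -> : g = (g - \sum_j v j * e j - y) + y + \sum_j v j * e j by ring.
  have := jetD (jetD jy (Ijet2 y Iy)) ja.
  by rewrite !add0r.
have bfree : row_free (coef_mx b) by rewrite /row_free eqn_leq rank_leq_row.
have [z bz] := dual_basis hb bfree.
have b0 j : b j != 0.
  apply/eqP => bj; have := bz j j; rewrite bj meval0 eqxx => /eqP.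
  by rewrite eq_sym oner_eq0.
(* Up to an element of order k + 1, the product of the first k of the v j is
   a multiple y of f. *)
have [y Iy py] := vprod (fun j : 'I_m.+2 => (j < k)%N)
  (submodule_gen_mem (local_ring1 x) localOB localOM (fun _ : 'I_1 => \prod_(i < m.+2 | (i < k)%N) t i) ord0).
have card_k : (\sum_(j < m.+2 | (j < k)%N) 1)%N = k.
  by rewrite -(big_ord_widen _ (fun=> 1%N) kr) sum_nat_const card_ord muln1.
have jprod := jet_prod (index_enum _) (fun j : 'I_m.+2 => (j < k)%N) jb.
rewrite card_k in jprod.
have jrem := has_jet_lower (ltnSn k) (ideal_pow_jet py).
have := jetB jprod jrem; rewrite subr0 subKr => -[p' [q' [B' [qx' EB' B0' yE']]]].
have [d [p [q [_ _ [c _ pE] qx yE]]]] := (iffLR (ideal_atP _ _ _)) Iy.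
rewrite big_ord1 in pE.
have pq : p' * q = f * (c ord0 * q').
  apply/eqP; rewrite -tofrac_eq !tofracM -yE' mulrAC yE pE tofracM.
  by apply/eqP; ring.
(* Compare the expansions at x of y as a product of the v j and as a multiple
   of f. *)
have EQ : 'X^k * (B' * expand x q) = 'X^mu * ((\prod_(i | Z i) B i) *
    ((\prod_(i | ~~ Z i) expand x (F i)) * expand x (c ord0 * q'))).
  by rewrite mulrA -EB' -expandM pq expandM Ef -!mulrA.
have bprod0 : \prod_(j < m.+2 | (j < k)%N) b j != 0 by apply/prodf_neq0 => j _.
have lprod0 : \prod_(i | Z i) linear_part x (F i) != 0.
  by apply/prodf_neq0 => i /eqP; apply: smooth.
have [|||e Ee] := leading_divides _ _ _ EQ.
- by rewrite L0.
- by rewrite B0' mulf_neq0 // mpolyC_eq0.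
- by rewrite expand_coef0 mpolyC_eq0.
rewrite L0 B0' expand_coef0 in Ee.
have dlb : divides (\prod_(i | Z i) linear_part x (F i)) (\prod_(j < m.+2 | (j < k)%N) b j).
  exists ((q'.@[x] * q.@[x])^-1%:MP * e).
  rewrite -mulrA -Ee [X in _ * X]mulrAC -mpolyCM mulrA -mpolyCM mulVf ?mulf_neq0 //.
  by rewrite mpolyC1 mul1r.
have hl i : linear_part x (F i) \is 1.-homog by apply: linear_part_homog.
have [|xi xiE] := linear_factor_matching hb bz hl _ dlb.
  by move=> i /eqP; apply: smooth.
move=> i /eqP Zi; exists (xi i) => l /eqP Zl.
by rewrite -meval_linear_part; apply: xiE.
Qed.

End Gradients.

(** * Determinants and exterior products of differentials *)

Section Frames.
Context {R : comNzRingType} {m : nat}.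
Implicit Types (a b c : 'I_m.+3 -> R) (v : 'I_m.+1 -> 'I_m.+3 -> R).

Definition frame_row a v c (i : 'I_m.+3) : 'I_m.+3 -> R :=
  if unlift ord0 i is Some j then
    if unlift ord_max j is Some l then v l else c
  else a.

Definition frame a v c : 'M[R]_m.+3 := \matrix_(i, k) frame_row a v c i k.

Definition dot a b := \sum_k a k * b k.

Lemma frame_row0 a v c : frame_row a v c ord0 = a.
Proof. by rewrite /frame_row unlift_none. Qed.

Lemma frame_row_max a v c : frame_row a v c (lift ord0 ord_max) = c.
Proof. by rewrite /frame_row liftK unlift_none. Qed.

Lemma frame_row_mid a v c l : frame_row a v c (lift ord0 (lift ord_max l)) = v l.
Proof. by rewrite /frame_row !liftK. Qed.

Lemma frame_row_cases (i : 'I_m.+3) :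
  [\/ i = ord0, i = lift ord0 ord_max | exists l, i = lift ord0 (lift ord_max l)].
Proof.
case: (unliftP ord0 i) => [j ->|->]; last by constructor 1.
by case: (unliftP ord_max j) => [l ->|->]; [constructor 3; exists l|constructor 2].
Qed.

Lemma det_first_row n (A : 'M[R]_n.+1) : (forall j, j != ord0 -> A ord0 j = 0) ->
  \det A = A ord0 ord0 * \det (row' ord0 (col' ord0 A)).
Proof.
move=> A0; rewrite (expand_det_row A ord0) (bigD1 ord0) //= big1 ?addr0.
  by rewrite /cofactor addn0 expr0 mul1r.
by move=> j ne; rewrite A0 ?mul0r.
Qed.

Lemma det_last_column n (A : 'M[R]_n.+1) : (forall i, i != ord_max -> A i ord_max = 0) ->
  \det A = A ord_max ord_max * \det (row' ord_max (col' ord_max A)).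
Proof.
move=> A0; rewrite (expand_det_col A ord_max) (bigD1 ord_max) //= big1 ?addr0.
  by rewrite /cofactor addnn -signr_odd odd_double expr0 mul1r.
by move=> j ne; rewrite A0 ?mul0r.
Qed.

(** In the product of the first matrix with the transpose of the second, the
   first row and the last column are zero but for the diagonal entries. *)
Lemma frame_det_pairing y v c a l b :
  (forall k, dot y (l k) = 0) -> dot y b = 0 -> (forall k, dot (v k) b = 0) ->
  \det (frame y v c) * \det (frame a l b) =
  dot y a * \det (\matrix_(k, j) dot (v j) (l k)) * dot c b.
Proof.
move=> yl yb vb; rewrite -[\det (frame a l b)]det_tr -det_mulmx.
set A : 'M[R]_m.+3 := _ *m _.
have AE i j : A i j = dot (frame_row y v c i) (frame_row a l b j).
  by rewrite mxE; apply: eq_bigr => k _; rewrite !mxE.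
move: (A) AE => {}A AE; rewrite (@det_first_row _ A) => [|j]; last first.
  rewrite AE frame_row0 => j0; case: (frame_row_cases j) => [E|->|[k ->]].
  - by rewrite E eqxx in j0.
  - by rewrite frame_row_max.
  by rewrite frame_row_mid.
rewrite (@det_last_column _ (row' ord0 (col' ord0 A))) => [|i im]; last first.
  rewrite !mxE AE !frame_row_max.
  case: (unliftP ord_max i) im => [k ->|->] im; last by rewrite eqxx in im.
  by rewrite frame_row_mid.
transitivity (dot y a * (dot c b * \det (\matrix_(k, j) dot (v j) (l k)))); last by ring.
rewrite !mxE !AE !frame_row0 !frame_row_max; congr (_ * (_ * _)).
rewrite -det_tr; congr (\det _); apply/matrixP => k j.
by rewrite !mxE AE !frame_row_mid.
Qed.

(** The matrix frame y v c sends the column b to dot c b times a basis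
   vector; apply its adjugate. *)
Lemma frame_det_cofactor y v c b i : dot y b = 0 -> (forall k, dot (v k) b = 0) ->
  \det (frame y v c) * b i = cofactor (frame y v (fun=> 0)) (lift ord0 ord_max) i * dot c b.
Proof.
move=> yb vb; pose B := \col_k b k.
have FB : frame y v c *m B = dot c b *: delta_mx (lift ord0 ord_max) 0.
  apply/matrixP => k j; rewrite !mxE ord1 eqxx andbT.
  rewrite (eq_bigr (fun k' => frame_row y v c k k' * b k')); last by move=> k' _; rewrite !mxE.
  case: (frame_row_cases k) => [->|->|[l ->]].
  - by rewrite frame_row0 -/(dot _ _) yb mulr0.
  - by rewrite frame_row_max eqxx mulr1.
  rewrite frame_row_mid -/(dot _ _) vb (inj_eq (@lift_inj _ ord0)).
  by rewrite eq_sym (negbTE (neq_lift _ _)) mulr0.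
have := congr1 (fun A : 'cV_m.+3 => (\adj (frame y v c) *m A) i 0) FB.
rewrite mulmxA mul_adj_mx mul_scalar_mx -scalemxAr !mxE => ->.
rewrite (bigD1 (lift ord0 ord_max)) //= big1 ?addr0; last first.
  by move=> k ne; rewrite !mxE (negbTE ne) mulr0.
rewrite !mxE !eqxx mulr1 mulrC; congr (_ * _).
rewrite /cofactor; congr (_ * \det _); apply/matrixP => k j; rewrite !mxE.
congr (_ _); case: (unliftP ord0 (lift (lift ord0 ord_max) k)) => [k' E|E].
  rewrite /frame_row E liftK; case: (unliftP ord_max k') => [//|E'].
  by have := neq_lift (lift ord0 ord_max) k; rewrite E E' eqxx.
by rewrite /frame_row E unlift_none.
Qed.

End Frames.

Section FrameEvaluation.
Context {K : numClosedFieldType} {m : nat}.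
Local Notation P := {mpoly K[m.+3]}.

Lemma meval_frame_det (a : 'I_m.+3 -> P) l b y :
  (\det (frame a l b)).@[y] =
  \det (frame (fun k => (a k).@[y]) (fun j k => (l j k).@[y]) (fun k => (b k).@[y])).
Proof.
rewrite -det_map_mx; congr (\det _); apply/matrixP => i k; rewrite !mxE.
case: (frame_row_cases i) => [->|->|[j ->]].
- by rewrite !frame_row0.
- by rewrite !frame_row_max.
by rewrite !frame_row_mid.
Qed.

Lemma homog_frame_det (a : 'I_m.+3 -> P) l b da dl db :
  (forall k, a k \is da.-homog) -> (forall j k, l j k \is (dl j).-homog) ->
  (forall k, b k \is db.-homog) ->
  \det (frame a l b) \is (da + (\sum_j dl j + db)).-homog.
Proof.
move=> ha hl hb; rewrite -det_tr.
pose c (j : 'I_m.+3) := if unlift ord0 j is Some j' then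
   if unlift ord_max j' is Some k then dl k else db else da.
have -> : (da + (\sum_j dl j + db) = \sum_j c j)%N.
  rewrite [RHS]big_ord_recl [X in (_ = _ + X)%N]big_ord_recr /=; congr (_ + _)%N; first by rewrite /c unlift_none.
  congr (_ + _)%N; last by rewrite /c liftK unlift_none.
  apply: eq_bigr => j _; rewrite /c liftK.
  have -> : widen_ord (leqnSn m.+1) j = lift ord_max j.
    by apply/val_inj; rewrite /= /bump leqNgt ltn_ord.
  by rewrite liftK.
apply: homog_det => i j; rewrite !mxE /c /frame_row.
by case: (unlift ord0 j) => [j'|//]; case: (unlift ord_max j').
Qed.

Lemma frame_det_neq0 (a : 'I_m.+3 -> K) l b :
  (forall z, dot a z = 0 -> (forall j, dot (l j) z = 0) -> dot b z = 0 -> z = fun=> 0) ->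
  \det (frame a l b) != 0.
Proof.
move=> H; rewrite -det_tr; apply/det0P => -[z z0 zA].
have E i : dot (frame_row a l b i) (z 0) = 0.
  have := congr1 (fun A : 'rV_m.+3 => A 0 i) zA; rewrite !mxE => <-.
  by apply: eq_bigr => k _; rewrite !mxE mulrC.
have zE : z 0 = fun=> 0.
  apply: H => [|j|].
  - by have := E ord0; rewrite frame_row0.
  - by have := E (lift ord0 (lift ord_max j)); rewrite frame_row_mid.
  by have := E (lift ord0 ord_max); rewrite frame_row_max.
by move/eqP: z0; apply; apply/rowP => k; rewrite mxE zE.
Qed.

Lemma complementary_indices (a b : 'I_m.+3) : a != b ->
  exists kap : 'I_m.+1 -> 'I_m.+3,
    [/\ forall k, kap k != a, forall k, kap k != b, injective kap &
        forall i, [\/ i = a, i = b | exists k, i = kap k]].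
Proof.
move=> ab; case: (unliftP a b) => [b' Eb|Eb]; last by rewrite Eb eqxx in ab.
exists (fun k => lift a (lift b' k)); split.
- by move=> k; rewrite eq_sym neq_lift.
- by move=> k; rewrite Eb (inj_eq lift_inj) eq_sym neq_lift.
- by move=> k k' /lift_inj/lift_inj.
move=> i; case: (unliftP a i) => [i' ->|->]; last by constructor 1.
case: (unliftP b' i') => [k ->|->]; last by constructor 2.
by constructor 3; exists k.
Qed.

Lemma dot_delta (i : 'I_m.+3) (z : 'I_m.+3 -> K) : dot (fun k => (k == i)%:R) z = z i.
Proof.
rewrite /dot (bigD1 i) //= eqxx mul1r big1 ?addr0 // => k /negbTE->.
by rewrite mul0r.
Qed.

Lemma dotDl (a b c : 'I_m.+3 -> K) : dot (fun k => a k + b k) c = dot a c + dot b c.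
Proof. by rewrite /dot -big_split; apply: eq_bigr => k _; rewrite mulrDl. Qed.

Lemma dotZl t (a c : 'I_m.+3 -> K) : dot (fun k => t * a k) c = t * dot a c.
Proof. by rewrite /dot big_distrr; apply: eq_bigr => k _; rewrite /= mulrA. Qed.

(** The numerator of the differential of u, whose denominator is the square
   of that of u. *)
Definition hgrad (u : @hfrac K m.+2) (k : 'I_m.+3) : P :=
  (hnum u)^`M(k) * hden u - hnum u * (hden u)^`M(k).

Lemma hdiffE u y v :
  hdiff u y v = (hden u).@[y] ^- 2 * dot v (fun k => (hgrad u k).@[y]).
Proof.
rewrite /hdiff mulrC; congr (_ * _); apply: eq_bigr => k _.
by rewrite mulrC /hgrad mevalB !mevalM.
Qed.

Lemma det_hdiff (h : 'I_m.+1 -> @hfrac K m.+2) y v :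
  \det (\matrix_(k, j) hdiff (h k) y (v j)) =
  (\prod_k (hden (h k)).@[y] ^- 2) *
  \det (\matrix_(k, j) dot (v j) (fun i => (hgrad (h k) i).@[y])).
Proof.
have -> : \matrix_(k, j) hdiff (h k) y (v j) =
    diag_mx (\row_k (hden (h k)).@[y] ^- 2) *m
    \matrix_(k, j) dot (v j) (fun i => (hgrad (h k) i).@[y]).
  by apply/matrixP => k j; rewrite mul_diag_mx !mxE hdiffE.
rewrite det_mulmx det_diag; congr (_ * _); apply: eq_bigr => k _.
by rewrite mxE.
Qed.

(** Euler's relation for the numerator and the denominator, of equal degrees. *)
Lemma dot_hgrad_euler u y : dot y (fun k => (hgrad u k).@[y]) = 0.
Proof.
have E (p : P) d : p \is d.-homog -> \sum_k y k * p^`M(k).@[y] = p.@[y] *+ d.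
  move=> hp; rewrite -mevalMn -(euler_homog hp) raddf_sum; apply: eq_bigr => k _ /=.
  by rewrite mevalM mevalXU.
transitivity ((\sum_k y k * (hnum u)^`M(k).@[y]) * (hden u).@[y] -
              (hnum u).@[y] * \sum_k y k * (hden u)^`M(k).@[y]).
  rewrite big_distrl big_distrr -sumrB; apply: eq_bigr => k _ /=.
  by rewrite /hgrad mevalB !mevalM; ring.
by rewrite (E _ _ (hnum_homog u)) (E _ _ (hden_homog u)) mulrnAl mulrnAr subrr.
Qed.

Lemma hgrad_homog u k : hgrad u k \is ((hdeg u).*2.-1).-homog.
Proof.
have [d0|d0] := posnP (hdeg u).
  have C (p : P) : p \is 0.-homog -> p^`M(k) = 0.
    by move=> /homog0_const ->; rewrite mderivC.
  have hn := hnum_homog u; have hd := hden_homog u; rewrite d0 in hn hd.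
  by rewrite /hgrad (C _ hn) (C _ hd) mul0r mulr0 subrr rpred0.
have -> : ((hdeg u).*2.-1 = (hdeg u).-1 + hdeg u)%N by lia.
apply: rpredB.
  by apply: dhomogM; [apply/dhomog_deriv/hnum_homog|apply: hden_homog].
rewrite addnC; apply: dhomogM; first by apply: hnum_homog.
by apply/dhomog_deriv/hden_homog.
Qed.

End FrameEvaluation.

(** * Residue forms on a smooth hypersurface *)

Lemma meval_derivX (R : comNzRingType) n (i j : 'I_n) (y : 'I_n -> R) :
  (('X_j : {mpoly R[n]})^`M(i)).@[y] = (i == j)%:R.
Proof.
rewrite mderivX mnm1E mevalZ eq_sym; case: eqP => [->|_]; last by rewrite mul0r.
have -> : (U_(j) - U_(j))%MM = 0%MM by apply/mnmP => k; rewrite mnmBE subnn mnm0E.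
by rewrite mpolyX0 meval1 mulr1.
Qed.

Section ResidueForms.
Context {K : numClosedFieldType} {m : nat}.
Local Notation P := {mpoly K[m.+3]}.
Local Notation delta i := (fun k => (k == i)%:R).
Variables (F : P) (e : nat).
Hypotheses (irrF : irreducible_element F) (hF : F \is e.-homog).
Local Notation Y := (zero_locus F : set (coords K m.+2)).
Hypothesis smoothF : forall x : coords K m.+2, Y x -> linear_part x F != 0.
Implicit Types (x y z xi : coords K m.+2) (v : 'I_m.+1 -> coords K m.+2) (G A B : P).

Definition grad y : coords K m.+2 := fun k => F^`M(k).@[y].

Lemma grad_neq0 y : Y y -> exists b, grad y b != 0.
Proof.
move=> Yy; apply: contrapT => H; have := smoothF Yy.
rewrite /linear_part big1 ?eqxx // => k _.
have [gk|gk] := eqVneq (grad y k) 0; last by case: H; exists k.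
by rewrite [X in X *: _]gk scale0r.
Qed.

Lemma dot_grad_euler y : Y y -> dot y (grad y) = 0.
Proof.
move=> [_ Fy]; rewrite /dot.
transitivity ((\sum_k 'X_k * F^`M(k)).@[y]).
  by rewrite raddf_sum; apply: eq_bigr => k _ /=; rewrite mevalM mevalXU.
by rewrite (euler_homog hF) mevalMn Fy mul0rn.
Qed.

Lemma tangentE y z : Y y -> tangent Y y z <-> dot z (grad y) = 0.
Proof.
move=> [y0 Fy]; split=> [T|zg p Vp].
  rewrite -[RHS](T F) => [|w []//]; apply: eq_bigr => k _; exact: mulrC.
have [c ->] : divides F p by apply: projective_hypersurface_nullstellensatz => // w; apply: Vp.
transitivity (c.@[y] * dot z (grad y)); last by rewrite zg mulr0.
rewrite big_distrr; apply: eq_bigr => k _ /=.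
by rewrite mderivM mevalD !mevalM Fy mulr0 add0r /grad; ring.
Qed.

Lemma degree_gt0 : (0 < e)%N.
Proof.
rewrite lt0n; apply/eqP => e0; have [F0 Fu _] := irrF.
move: (hF) Fu F0; rewrite e0 => /homog0_const ->.
by rewrite mpolyC_eq0 => /negP Fu c0; apply: Fu; rewrite rmorph_unit // unitfE.
Qed.

(** By Euler's relation, the vector y cannot have b as its only nonzero
   coordinate. *)
Lemma pivots y : Y y -> exists a b, [/\ a != b, y a != 0 & grad y b != 0].
Proof.
move=> Yy; have [b gb] := grad_neq0 Yy; have [[i yi] _] := Yy.
have [Ei|ne] := eqVneq i b; last by exists i, b.
have [a [ab ya]] : exists a, a != b /\ y a != 0.
  apply: contrapT => H; have := dot_grad_euler Yy.
  rewrite /dot (bigD1 b) //= big1 ?addr0 => [/eqP|k ne].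
    by rewrite mulf_eq0 (negbTE gb) orbF -Ei (negbTE yi).
  have [->|yk] := eqVneq (y k) 0; first by rewrite mul0r.
  by case: H; exists k.
by exists a, b.
Qed.

(** The equation of the tangent space is solved for the coordinate b, and the
   coordinate a is left out because y already has a component along it. *)
Lemma adapted_frame y : Y y -> exists v xi,
  (forall k, tangent Y y (v k)) /\ \det (frame y v xi) != 0.
Proof.
move=> Yy; have [a [b [ab ya gb]]] := pivots Yy.
have [kap [kapa kapb kapI cover]] := complementary_indices ab.
pose v k : coords K m.+2 := fun i => delta (kap k) i + (- (grad y (kap k) / grad y b)) * delta b i.
exists v, (delta b); split=> [k|].
  apply/(tangentE _ Yy); rewrite dotDl dotZl !dot_delta.
  by rewrite mulNr divfK // subrr.
apply: frame_det_neq0 => z yz vz bz; rewrite dot_delta in bz.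
have kz k : z (kap k) = 0.
  by have := vz k; rewrite dotDl dotZl !dot_delta bz mulr0 addr0.
have az : z a = 0.
  move: yz; rewrite /dot (bigD1 a) //= big1 ?addr0 => [/eqP|i ne].
    by rewrite mulf_eq0 (negbTE ya) /= => /eqP.
  by have [E|->|[k ->]] := cover i; rewrite ?bz ?kz ?mulr0 // E eqxx in ne *.
by apply/funext => i; have [->|->|[k ->]] := cover i.
Qed.

(** The Poincare residue of G * Omega / F along Y, where Omega y v xi is the
   determinant of y, v and xi. The quotient of Omega by dF is computed as a
   cofactor, b being an index where dF has a nonzero coefficient. *)
Definition residue G y v : K^o :=
  if `[< Y y /\ forall k, tangent Y y (v k) >] then
    let b := odflt ord0 [pick b | grad y b != 0] in
    G.@[y] * cofactor (frame y v (fun=> 0)) (lift ord0 ord_max) b / grad y b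
  else 0.

(** The defining property of the residue: its product with dF is G * Omega. *)
Lemma residueP G y v xi : Y y -> (forall k, tangent Y y (v k)) ->
  residue G y v * dot xi (grad y) = G.@[y] * \det (frame y v xi).
Proof.
move=> Yy Tv; rewrite /residue asboolT //; case: pickP => [b /= gb|H]; last first.
  by have [b] := grad_neq0 Yy; rewrite H.
have vg k : dot (v k) (grad y) = 0 by apply/(tangentE _ Yy).
apply: (mulIf gb); rewrite -[RHS]mulrA (frame_det_cofactor xi b (dot_grad_euler Yy) vg).
by rewrite mulrAC divfK // -mulrA.
Qed.

Lemma grad_cancel y c c' : Y y -> (forall xi, c * dot xi (grad y) = c' * dot xi (grad y)) ->
  c = c'.
Proof.
move=> Yy H; have [b gb] := grad_neq0 Yy.
by have := H (delta b); rewrite dot_delta => /(mulIf gb).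
Qed.

Lemma residueD c G G' y v : residue (c *: G + G') y v = c * residue G y v + residue G' y v.
Proof.
rewrite /residue; case: asboolP => _; last by rewrite mulr0 addr0.
by rewrite mevalD mevalZ !mulrDl !mulrA.
Qed.

Lemma residue_eq0 G : (forall y v, residue G y v = 0) -> divides F G.
Proof.
move=> G0; apply: projective_hypersurface_nullstellensatz => // y Yy.
have [v [xi [Tv det0]]] := adapted_frame Yy.
have := residueP G xi Yy Tv; rewrite G0 mul0r => /esym/eqP.
by rewrite mulf_eq0 (negbTE det0) orbF => /eqP.
Qed.

(** G is a form of degree e - r - 1, hence zero if this integer is negative;
   here r = m + 2. *)
Definition adjoint G : Prop :=
  if (m.+3 <= e)%N then is_true (G \is (e - m.+3).-homog) else G = 0.

(** Near a point x where the coordinate a is nonzero and dF has a nonzero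
   coefficient b, take for h the affine coordinates other than b. By
   frame_det_pairing, dh_1 /\ ... /\ dh_(r-1) is the residue of C * Omega /
   F up to a power of 'X_a, where the determinant C of delta a, of the
   gradients of the h k and of dF is invertible at x. *)
Lemma residue_regular G : adjoint G -> regular_form Y (residue G).
Proof.
move=> adjG; split=> [y v nT|x Yx]; first by rewrite /residue asboolF.
have [a [b [ab xa gb]]] := pivots Yx.
have [kap [kapa kapb kapI cover]] := complementary_indices ab.
pose num k : P := 'X_(kap k); pose den : P := 'X_a.
have hX i : ('X_i : P) \is 1.-homog by rewrite dhomogX /= mdeg1.
pose h k : @hfrac K m.+2 := @HFrac K m.+2 1 (num k) den (hX _) (hX _).
pose C := \det (frame (delta a : 'I_m.+3 -> P) (fun k => hgrad (h k)) (fun k => F^`M(k))).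
have hC : C \is (m.+1 + e.-1).-homog.
  have := @homog_frame_det K m (delta a) (fun k => hgrad (h k)) (fun k => F^`M(k)) 0 (fun=> 1%N) e.-1.
  rewrite sum_nat_const card_ord muln1 add0n; apply.
  - by move=> k; case: (k == a); [exact: dhomog1|exact: rpred0].
  - by move=> k i; apply: (hgrad_homog (h k)).
  by move=> k; apply: dhomog_deriv.
have CE y : C.@[y] = \det (frame (delta a) (fun k i => (hgrad (h k) i).@[y]) (grad y)).
  rewrite meval_frame_det; congr (\det (frame _ _ _)).
  by apply/funext => k; rewrite rmorph_nat.
have hgE k y : (fun i => (hgrad (h k) i).@[y]) =
    (fun i => y a * delta (kap k) i + (- y (kap k)) * delta a i).
  apply/funext => i; rewrite /hgrad /= mevalB !mevalM !mevalXU !meval_derivX.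
  by rewrite mulrC mulNr.
have Cx : C.@[x] != 0.
  rewrite CE; apply: frame_det_neq0 => z; rewrite dot_delta => az lz gz.
  have kz k : z (kap k) = 0.
    have := lz k; rewrite hgE dotDl !dotZl !dot_delta az mulr0 addr0 => /eqP.
    by rewrite mulf_eq0 (negbTE xa) /= => /eqP.
  have bz : z b = 0.
    move: gz; rewrite /dot (bigD1 b) //= big1 ?addr0 => [/eqP|i ne].
      by rewrite mulf_eq0 (negbTE gb) /= => /eqP.
    by have [->|E|[k ->]] := cover i; rewrite ?az ?kz ?mulr0 // E eqxx in ne *.
  by apply/funext => i; have [->|->|[k ->]] := cover i.
(* The power of 'X_a clears the squares of the m.+1 denominators in the
   differentials of the h k, and one more factor in frame_det_pairing; it
   brings G, of degree e - r - 1, to the degree of C. *)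
have hnumG : G * 'X_a ^+ (m.+1.*2.+1) \is (m.+1 + e.-1).-homog.
  move: adjG; rewrite /adjoint; case: (leqP m.+3 e) => [le hG|_ ->]; last first.
    by rewrite mul0r rpred0.
  have -> : (m.+1 + e.-1 = (e - m.+3) + 1 * m.+1.*2.+1)%N by lia.
  by apply: dhomogM => //; apply: dhomogMn.
pose g : @hfrac K m.+2 := HFrac hnumG hC.
exists (1 + (m.+1 + e.-1))%N, ('X_a * C), 1%N, (fun=> g), (fun=> h); split.
- exact: dhomogM.
- by rewrite mevalM mevalXU mulf_neq0.
move=> y Yy; rewrite mevalM mevalXU mulf_eq0 negb_or => /andP[ya Cy].
have hy k : (hden (h k)).@[y] = y a by exact: mevalXU.
split=> [//|_ k|v Tv].
  exact: ya.
have vg k : dot (v k) (grad y) = 0 by apply/(tangentE _ Yy).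
apply: (grad_cancel Yy) => xi; rewrite (residueP G xi Yy Tv) big_ord1 det_hdiff.
pose D := \det (\matrix_(k, j) dot (v j) (fun i => (hgrad (h k) i).@[y])).
rewrite -/D.
have pairing : \det (frame y v xi) * C.@[y] = y a * D * dot xi (grad y).
  have dy : dot y (delta a) = y a.
    by rewrite -[RHS](dot_delta a y); apply: eq_bigr => k _; rewrite mulrC.
  rewrite CE frame_det_pairing ?dot_grad_euler //; last first.
    by move=> k; apply: dot_hgrad_euler.
  by rewrite dy.
rewrite (eq_bigr (fun=> y a ^- 2)) => [|k _]; last by rewrite hy.
have -> : hval g y = G.@[y] * y a ^+ m.+1.*2.+1 / C.@[y].
  by rewrite /hval /= mevalM rmorphXn /= mevalXU.
rewrite prodr_const card_ord; apply: (mulIf Cy); rewrite -[LHS]mulrA pairing.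
have Ey : y a ^+ m.+1.*2.+1 * (y a ^- 2) ^+ m.+1 = y a.
  by rewrite exprVn -exprM exprS mul2n mulfK // expf_neq0.
by rewrite -[in LHS]Ey; field; exact: Cy.
Qed.

(** Where B does not vanish, w is A / B times the residue of Omega / F. *)
Definition fraction_of_residue (w : coords K m.+2 -> ('I_m.+1 -> coords K m.+2) -> K^o) A B :=
  forall y v xi, Y y -> (forall k, tangent Y y (v k)) ->
    w y v * dot xi (grad y) * B.@[y] = A.@[y] * \det (frame y v xi).

(** By frame_det_pairing each term g * dh_1 /\ ... /\ dh_(r-1) of a local
   expression of w is a fraction, with numerator hnum g * C, times the
   residue of Omega / F; these fractions are put over a common denominator.
   The degree of the gradient of h is 2 * hdeg h - 1, whence the degree of
   A. *)
Lemma regular_form_local w x : regular_form Y w -> Y x ->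
  exists A B dA dB, [/\ A \is dA.-homog, B \is dB.-homog, B.@[x] != 0,
    A = 0 \/ (dA + m.+3 = dB + e)%N & fraction_of_residue w A B].
Proof.
move=> [_ /(_ x) loc] Yx; have [dq [q [N [g [h [hq qx H]]]]]] := loc Yx.
have [[a xa] _] := Yx.
pose C j := \det (frame (delta a : 'I_m.+3 -> P) (fun k => hgrad (h j k)) (fun k => F^`M(k))).
pose D j := hden (g j) * \prod_k hden (h j k) ^+ 2.
pose R j := \prod_(i | i != j) D i.
pose T j := hnum (g j) * C j * R j.
have CE j y : (C j).@[y] = \det (frame (delta a) (fun k i => (hgrad (h j k) i).@[y]) (grad y)).
  rewrite meval_frame_det; congr (\det (frame _ _ _)).
  by apply/funext => k; rewrite rmorph_nat.
pose sd j := (\sum_k 2 * hdeg (h j k))%N.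
have hD j : D j \is (hdeg (g j) + sd j).-homog.
  apply: dhomogM; first exact: hden_homog.
  rewrite /sd; elim/big_ind2: _ => [|u i v i' hu hv|k _]; [exact: dhomog1|exact: dhomogM|].
  by rewrite mulnC; apply: dhomogMn; apply: hden_homog.
pose tot := (\sum_j (hdeg (g j) + sd j))%N.
have hprod (p : pred 'I_N) : \prod_(i | p i) D i \is (\sum_(i | p i) (hdeg (g i) + sd i))%N.-homog.
  by elim/big_ind2: _ => [|u i v i' hu hv|k _]; [exact: dhomog1|exact: dhomogM|exact: hD].
have hC j : C j \is (\sum_k (hdeg (h j k)).*2.-1 + e.-1).-homog.
  have := @homog_frame_det K m (delta a) (fun k => hgrad (h j k)) (fun k => F^`M(k)) 0
    (fun k => (hdeg (h j k)).*2.-1) e.-1.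
  rewrite add0n; apply.
  - by move=> k; case: (k == a); [exact: dhomog1|exact: rpred0].
  - by move=> k i; apply: hgrad_homog.
  by move=> k; apply: dhomog_deriv.
(* A quotient of constants has differential 0; the degree 2 * 0 - 1 would be
   truncated, so this case is set apart. *)
have C0 j k : hdeg (h j k) = 0%N -> C j = 0.
  move=> d0; rewrite /C (expand_det_row _ (lift ord0 (lift ord_max k))) big1 // => i _.
  rewrite mxE frame_row_mid.
  have Z (p : P) : p \is 0.-homog -> p^`M(i) = 0.
    by move=> /homog0_const ->; rewrite mderivC.
  have hn := hnum_homog (h j k); have hd := hden_homog (h j k); rewrite d0 in hn hd.
  by rewrite /hgrad (Z _ hn) (Z _ hd) !(mul0r, mulr0) subr0 mul0r.
have e0 := degree_gt0.
have hT j : T j != 0 -> (m.+3 <= tot + 1 + e)%N /\ T j \is (tot + 1 + e - m.+3).-homog.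
  move=> Tj0.
  have dpos k : (0 < hdeg (h j k))%N.
    rewrite lt0n; apply: contra_neqN Tj0 => /eqP d0.
    by rewrite /T (C0 j k d0) mulr0 mul0r.
  have Esd : (\sum_k (hdeg (h j k)).*2.-1 + m.+1 = sd j)%N.
    rewrite /sd -[X in (_ + X)%N]card_ord -sum1_card -big_split.
    by apply: eq_bigr => k _; have := dpos k; rewrite /=; lia.
  have Etot : tot = (hdeg (g j) + sd j + \sum_(i | i != j) (hdeg (g i) + sd i))%N.
    by rewrite /tot (bigD1 j).
  have hTj : T j \is (hdeg (g j) + (\sum_k (hdeg (h j k)).*2.-1 + e.-1) +
      \sum_(i | i != j) (hdeg (g i) + sd i)).-homog.
    by apply: dhomogM (hprod _); apply: dhomogM (hC j); apply: hnum_homog.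
  split; first by move: Etot Esd e0; lia.
  have -> : (tot + 1 + e - m.+3 = hdeg (g j) + (\sum_k (hdeg (h j k)).*2.-1 + e.-1) +
      \sum_(i | i != j) (hdeg (g i) + sd i))%N by move: Etot Esd e0; lia.
  exact: hTj.
pose A := q * \sum_j T j; pose B := q * 'X_a * \prod_j D j.
exists A, B, (dq + (tot + 1 + e - m.+3))%N, (dq + 1 + tot)%N; split.
- apply: dhomogM => //; apply: rpred_sum => j _.
  by have [->|/hT[]] := eqVneq (T j) 0; first exact: rpred0.
- by apply: dhomogM (hprod _); apply: dhomogM => //; rewrite dhomogX /= mdeg1.
- have [gx hx _] := H x Yx qx.
  rewrite !mevalM mevalXU rmorph_prod /= !mulf_neq0 //.
  apply/prodf_neq0 => j _; rewrite mevalM rmorph_prod mulf_neq0 //=.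
  by apply/prodf_neq0 => k _; rewrite rmorphXn expf_neq0 //=; apply: hx.
- have [T0|/existsNP[j /eqP Tj]] := pselect (forall j, T j = 0).
    by left; rewrite /A big1 ?mulr0.
  by right; have [le _] := hT j Tj; lia.
move=> y v xi Yy Tv; rewrite /A /B !mevalM mevalXU.
have [q0|qy] := eqVneq q.@[y] 0; first by rewrite q0 !(mul0r, mulr0).
have [gy hy wE] := H y Yy qy; rewrite (wE v Tv).
have vg k : dot (v k) (grad y) = 0 by apply/(tangentE _ Yy).
have Dy j : (D j).@[y] != 0.
  rewrite mevalM rmorph_prod mulf_neq0 //=.
  by apply/prodf_neq0 => k _; rewrite rmorphXn expf_neq0 //=; apply: hy.
have dy : dot y (delta a) = y a.
  by rewrite -[RHS](dot_delta a y); apply: eq_bigr => k _; rewrite mulrC.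
have term j : hval (g j) y * \det (\matrix_(k, l) hdiff (h j k) y (v l)) *
    dot xi (grad y) * y a * (\prod_i D i).@[y] = (T j).@[y] * \det (frame y v xi).
  rewrite det_hdiff; set M := \det (\matrix_(k, l) dot (v l) _).
  have pairing : \det (frame y v xi) * (C j).@[y] = y a * M * dot xi (grad y).
    rewrite CE frame_det_pairing ?dot_grad_euler //; last first.
      by move=> k; apply: dot_hgrad_euler.
    by rewrite dy.
  rewrite /T (bigD1 j) //= -/(R j) !mevalM.
  have -> : (\prod_k hden (h j k) ^+ 2).@[y] = \prod_k (hden (h j k)).@[y] ^+ 2.
    by rewrite rmorph_prod; apply: eq_bigr => k _; rewrite rmorphXn.
  rewrite /hval; set u := \prod_k _ ^+ 2; rewrite prodfV -/u.
  have u0 : u != 0 by apply/prodf_neq0 => k _; rewrite expf_neq0.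
  transitivity ((hnum (g j)).@[y] * (R j).@[y] * (y a * M * dot xi (grad y))).
    by field; rewrite u0; apply: gy.
  by rewrite -pairing; ring.
set S := \sum_j _; set W := \det _.
have SE : S * dot xi (grad y) * y a * (\prod_i D i).@[y] = \sum_j (T j).@[y] * W.
  by rewrite !big_distrl; apply: eq_bigr => j _; apply: term.
transitivity (q.@[y] * (S * dot xi (grad y) * y a * (\prod_i D i).@[y])); first by ring.
by rewrite SE -big_distrl raddf_sum mulrA.
Qed.

(** Both fractions represent w, and the residue of Omega / F vanishes nowhere
   on Y. *)
Lemma fraction_of_residue_cross w A B A' B' : fraction_of_residue w A B ->
  fraction_of_residue w A' B' -> divides F (B' * A - B * A').
Proof.
move=> H H'; apply: projective_hypersurface_nullstellensatz => // y Yy.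
have [v [xi [Tv det0]]] := adapted_frame Yy.
apply: (mulIf det0); rewrite mul0r mevalB !mevalM mulrBl -!mulrA.
by rewrite -(H y v xi Yy Tv) -(H' y v xi Yy Tv); ring.
Qed.

Lemma fraction_of_residue_ideal w :
  is_ideal [set B | exists A, fraction_of_residue w A B].
Proof.
split=> [|B B' [A H] [A' H']|c B [A H]].
- by exists 0 => y v xi Yy Tv; rewrite meval0 mulr0 mul0r.
- exists (A + A') => y v xi Yy Tv.
  by rewrite !mevalD mulrDr mulrDl (H y v xi Yy Tv) (H' y v xi Yy Tv).
exists (c * A) => y v xi Yy Tv.
by rewrite !mevalM mulrCA (H y v xi Yy Tv) mulrA.
Qed.

(** The denominators of w form an ideal. At a point of Y a local expression
   provides a denominator that does not vanish there, and outside of Y the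
   form F itself is a denominator, with numerator 0. The Nullstellensatz
   applies. *)
Lemma regular_form_denominator w : regular_form Y w ->
  exists N, forall i, exists A, fraction_of_residue w A ('X_i ^+ N).
Proof.
move=> regw; have [||N NP] := @projective_nullstellensatz K _ [set B | exists A, fraction_of_residue w A B].
- exact: fraction_of_residue_ideal.
- move=> x x0; have [Fx|Fx] := eqVneq F.@[x] 0.
    have [A [B [dA [dB [_ hB Bx _ H]]]]] := regular_form_local regw (conj x0 Fx : Y x).
    by exists B; [exists A|split=> //; exists dB].
  exists F; last by split=> //; exists e.
  by exists 0 => y v xi [_ Fy] Tv; rewrite Fy meval0 mulr0 mul0r.
by exists N.
Qed.

(** High powers of two linear forms regular modulo F are denominators of w.
   The corresponding numerators satisfy a relation that, by regularity,
   makes the fraction A0 / L0 ^ M a polynomial G modulo F. To compare w with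
   G at y, divide by a variable that is nonzero at y. *)
Lemma regular_form_numerator w : regular_form Y w ->
  exists G, fraction_of_residue w G 1.
Proof.
move=> regw; have [N NP] := regular_form_denominator regw.
have F0 : F != 0 by case: irrF.
have [L0 [L1 [hL0 hL1 _ /(_ F (dividesxx F))[reg1 reg2]]]] := regular_lines F0 hF.
pose M := (m.+3 * N).+1.
have fracL L : L \is 1.-homog -> exists A, fraction_of_residue w A (L ^+ M).
  move=> hL; apply: (big_degree_ideal (fraction_of_residue_ideal w) NP _ (ltnSn _)).
  by rewrite -[X in X.-homog]mul1n; apply: dhomogMn.
have [A0 H0] := fracL L0 hL0; have [A1 H1] := fracL L1 hL1.
have [G dG] := reg2 _ _ _ (fraction_of_residue_cross H0 H1).
exists G => y v xi Yy Tv; have [[i yi] _] := Yy; have [A HA] := NP i.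
have : divides F (A - 'X_i ^+ N * G).
  apply: (reg1 M).
  have -> : L0 ^+ M * (A - 'X_i ^+ N * G) =
    'X_i ^+ N * (A0 - L0 ^+ M * G) - ('X_i ^+ N * A0 - L0 ^+ M * A) by ring.
  by apply: dividesB (fraction_of_residue_cross H0 HA); apply: divides_mull.
move=> [c Ec]; have {Ec} : (A - 'X_i ^+ N * G).@[y] = 0.
  by rewrite Ec mevalM Yy.2 mulr0.
rewrite mevalB mevalM => /eqP; rewrite subr_eq0 => /eqP EA.
have XN : ('X_i ^+ N : P).@[y] = y i ^+ N by rewrite rmorphXn /= mevalXU.
apply: (mulIf (expf_neq0 N yi)); rewrite meval1 mulr1 -{1}XN (HA y v xi Yy Tv) EA XN.
by ring.
Qed.

Lemma divides_pihomog p k : divides F p -> divides F (pihomog mdeg k p).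
Proof.
move=> [c ->]; have [lt|le] := ltnP k e.
  by rewrite (pihomogM_homog_lt _ hF lt); apply: divides0.
by exists (pihomog mdeg (k - e) c); rewrite -(pihomogM_homog _ _ hF) subnK.
Qed.

Definition adjoint_part G := if (m.+3 <= e)%N then pihomog mdeg (e - m.+3) G else 0.

Lemma adjoint_partP G : adjoint (adjoint_part G).
Proof. by rewrite /adjoint /adjoint_part; case: leqP => // _; apply: pihomogP. Qed.

(** Locally w is A / B times the residue of Omega / F, so the polynomial G of
   regular_form_numerator satisfies B * G = A modulo F. The degree of A
   being that of B plus e - r - 1, only the component of G of degree e - r -
   1 matters on Y. *)
Lemma regular_form_residue w : regular_form Y w ->
  exists2 G, adjoint G & w = residue G.
Proof.
move=> regw; have [G HG] := regular_form_numerator regw.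
exists (adjoint_part G); first exact: adjoint_partP.
have GE x : Y x -> (adjoint_part G).@[x] = G.@[x].
  move=> Yx; have [A [B [dA [dB [hA hB Bx deg H]]]]] := regular_form_local regw Yx.
  have dBG := fraction_of_residue_cross HG H; rewrite mul1r in dBG.
  have van p : divides F p -> p.@[x] = 0 by move=> [c ->]; rewrite mevalM Yx.2 mulr0.
  have := van _ dBG; rewrite mevalB mevalM => /eqP; rewrite subr_eq0 => /eqP BG.
  apply: (mulfI Bx); rewrite BG /adjoint_part; case: (leqP m.+3 e) => [le|gt].
    have /van := divides_pihomog (e - m.+3 + dB) dBG.
    rewrite raddfB /= [B * G]mulrC (pihomogM_homog _ _ hB).
    have -> : pihomog mdeg (e - m.+3 + dB) A = A.
      case: deg => [->|deg]; first by rewrite raddf0.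
      by rewrite (_ : (e - m.+3 + dB)%N = dA) ?pihomog_dE //; lia.
    by rewrite mevalB mevalM => /eqP; rewrite subr_eq0 mulrC => /eqP.
  rewrite meval0 mulr0; case: deg => [->|deg]; first by rewrite meval0.
  have /van := divides_pihomog dA dBG.
  rewrite raddfB /= [B * G]mulrC (pihomogM_homog_lt _ hB) ?pihomog_dE //; last by lia.
  by rewrite sub0r mevalN => /eqP; rewrite oppr_eq0 => /eqP.
apply/funext => y; apply/funext => v.
have [[Yy Tv]|nYT] := pselect (Y y /\ forall k, tangent Y y (v k)); last first.
  by rewrite /residue asboolF // (regw.1 _ _ nYT).
apply: (grad_cancel Yy) => xi; rewrite (residueP _ _ Yy Tv) (GE y Yy).
by rewrite -(HG y v xi Yy Tv) meval1 mulr1.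
Qed.

End ResidueForms.

(** * Adjoint forms and the saturation *)

Lemma graded_piece_adjoint (K : numClosedFieldType) m (I : set {mpoly K[m.+3]}) d p :
  graded_piece I (d%:Z - m.+2%:Z - 1) p <-> I p /\ adjoint d p.
Proof.
rewrite /graded_piece /adjoint /=; case: (leqP m.+3 _) => [le|gt].
  have -> // : (d%:Z - m.+2%:Z - 1 = (d - m.+3)%N%:Z)%R.
  by rewrite subzn ?(ltnW le) // subzn ?subn_gt0 // -subnDA addn1.
have -> : (d%:Z - m.+2%:Z - 1 = Negz (m.+2 - d))%R.
  by rewrite [RHS]NegzE [in RHS]intS -subzn // opprD opprB addrC.
by split=> -[Ip /eqP p0].
Qed.

(** The degree of an adjoint form is less than that of F. *)
Lemma adjoint_divides_eq0 (K : numClosedFieldType) m (F G : {mpoly K[m.+3]}) e :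
  F \is e.-homog -> adjoint e G -> divides F G -> G = 0.
Proof.
move=> hF; rewrite /adjoint; case: (leqP m.+3 _) => // le hG [c E].
by rewrite -(pihomog_dE hG) E (pihomogM_homog_lt _ hF) //; lia.
Qed.

Lemma adjoint_linear (K : numClosedFieldType) m (G G' : {mpoly K[m.+3]}) e c :
  adjoint e G -> adjoint e G' -> adjoint e (c *: G + G').
Proof.
rewrite /adjoint; case: (leqP m.+3 _) => [_ hG hG'|_ -> ->]; last by rewrite scaler0 addr0.
by apply: rpredD hG'; apply: rpredZ.
Qed.

Section AdjointDecomposition.
Context {K : numClosedFieldType} {m s : nat}.
Local Notation P := {mpoly K[m.+3]}.
Variables (F : 'I_s -> P) (e : 'I_s -> nat).
Hypotheses (irrF : forall i, irreducible_element (F i))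
  (homF : forall i, F i \is (e i).-homog)
  (indepF : forall i j, divides (F i) (F j) -> i = j).
Let f := \prod_i F i.
Let Q i := \prod_(j | j != i) F j.
Let d := (\sum_i e i)%N.
Hypotheses (d_gt0 : (0 < d)%N) (dualF : forall x, nonzero x -> dual_vectors F x).
Local Notation Jsat := (saturation (jacobian_ideal f) (irrelevant_ideal K m.+2)).

Lemma degree_cofactor i : d = (e i + \sum_(j | j != i) e j)%N.
Proof. by rewrite /d (bigD1 i). Qed.

Lemma homog_cofactor i : Q i \is (\sum_(j | j != i) e j)%N.-homog.
Proof. exact: homog_prodF. Qed.

Lemma homog_f : f \is d.-homog.
Proof. exact: homog_prodF. Qed.

Lemma adjoint_sum (G : 'I_s -> P) : (forall i, adjoint (e i) (G i)) ->
  adjoint d (\sum_i G i * Q i).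
Proof.
move=> adjG; rewrite /adjoint; case: (leqP m.+3 _) => [le|gt].
  apply: rpred_sum => i _; have := adjG i; rewrite /adjoint.
  case: (leqP m.+3 _) => [lei hG|_ ->]; last by rewrite mul0r rpred0.
  have -> : (d - m.+3 = (e i - m.+3) + \sum_(j | j != i) e j)%N.
    by have := degree_cofactor i; lia.
  by apply: dhomogM hG (homog_cofactor i).
apply: big1 => i _; have := adjG i; rewrite /adjoint.
case: (leqP m.+3 _) => [lei hG|_ ->]; last by rewrite mul0r.
by have := degree_cofactor i; lia.
Qed.

Lemma adjoint_sum_inj (G G' : 'I_s -> P) : (forall i, adjoint (e i) (G i)) ->
  (forall i, adjoint (e i) (G' i)) -> \sum_i G i * Q i = \sum_i G' i * Q i ->
  forall i, G i = G' i.
Proof.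
move=> adjG adjG' E i; apply/eqP; rewrite -subr_eq0; apply/eqP.
apply: (adjoint_divides_eq0 (homF i)).
  by rewrite addrC -scaleN1r; apply: adjoint_linear.
apply: (@cofactor_relation _ _ _ F irrF indepF (fun i => G i - G' i)).
rewrite (_ : \sum_j _ = 0); first exact: divides0.
transitivity (\sum_i G i * Q i - \sum_i G' i * Q i); last by rewrite E subrr.
by rewrite -sumrB; apply: eq_bigr => j _; rewrite mulrBl.
Qed.

(** By the product rule J(f) lies in the ideal of the Q i, which is
   saturated. *)
Lemma saturation_cofactor p : Jsat p -> exists c : 'I_s -> P, p = \sum_i c i * Q i.
Proof.
move=> satp; have hf := homog_f.
have f0 : f != 0 by apply/prodf_neq0 => i _; case: (irrF i).
have [L0 [L1 [hL0 hL1 _ reg]]] := regular_lines f0 hf.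
have [i0 _] : exists i, (0 < e i)%N.
  apply: contrapT => H; have := d_gt0; rewrite /d big1 // => i _; apply/eqP.
  by rewrite -leqn0 leqNgt; apply/negP => ei; apply: H; exists i.
have cofideal q : jacobian_ideal f q -> exists a : 'I_s -> P, q = \sum_i a i * Q i.
  move=> [a _ ->]; exists (fun i => \sum_k a k * (F i)^`M(k)).
  rewrite (eq_bigr (fun k => \sum_i a k * (F i)^`M(k) * Q i)) => [|k _].
    by rewrite exchange_big; apply: eq_bigr => i _ /=; rewrite big_distrl.
  by rewrite /f mderiv_prod big_distrr; apply: eq_bigr => i _ /=; rewrite mulrA.
have [N0 J0] := saturation_linear satp hL0; have [N1 J1] := saturation_linear satp hL1.
have [_ _ JM] : is_ideal (jacobian_ideal f) by apply: ideal_gen_is_ideal.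
have power L N N' : jacobian_ideal f (L ^+ N * p) -> jacobian_ideal f (L ^+ (N' + N) * p).
  by rewrite exprD -mulrA; apply: JM.
have [a Ea] := cofideal _ (power _ _ N1 J0); have [b Eb] := cofideal _ (power _ _ N0 J1).
rewrite addnC in Ea.
exact: (cofactor_ideal_saturated irrF indepF i0 reg Ea Eb).
Qed.

(** Take the components of the right degree in an arbitrary expression of p
   by the Q i. *)
Lemma saturation_adjoint p : Jsat p -> adjoint d p ->
  exists2 G : 'I_s -> P, (forall i, adjoint (e i) (G i)) & p = \sum_i G i * Q i.
Proof.
move=> /saturation_cofactor[c E] adjp; exists (fun i => adjoint_part (e i) (c i)).
  by move=> i; apply: adjoint_partP.
move: adjp; rewrite {1}/adjoint; case: (leqP m.+3 _) => [le hp|gt ->]; last first.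
  rewrite big1 // => i _; rewrite /adjoint_part.
  case: (leqP m.+3 _) => [lei|_]; last by rewrite mul0r.
  by have := degree_cofactor i; lia.
rewrite -(pihomog_dE hp) E raddf_sum; apply: eq_bigr => i _ /=.
have Ed := degree_cofactor i; rewrite /adjoint_part; case: (leqP m.+3 _) => [lei|gti].
  rewrite -(pihomogM_homog _ _ (homog_cofactor i)); congr (pihomog _ _ _); lia.
by rewrite (pihomogM_homog_lt _ (homog_cofactor i)) ?mul0r //; lia.
Qed.

Lemma adjoint_saturation (G : 'I_s -> P) : Jsat (\sum_i G i * Q i).
Proof.
have [N NP] := jacobian_saturation_cofactor homF d_gt0 dualF.
have hJ : is_ideal (jacobian_ideal f) by apply: ideal_gen_is_ideal.
have [_ _ JM] := hJ.
apply: (saturation_crit (N := N) hJ) => k; rewrite big_distrr /=.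
apply: ideal_sum => // i _; rewrite mulrCA; apply: JM; exact: NP.
Qed.

(** The generators of J(f) have degree d - 1. *)
Lemma jacobian_adjoint p : adjoint d p -> jacobian_ideal f p -> p = 0.
Proof.
rewrite /adjoint; case: (leqP m.+3 _) => [le hp|_ -> //].
by apply: jacobian_low_degree homog_f _ hp; lia.
Qed.

End AdjointDecomposition.

(** * The isomorphism *)

(** The map phi sends \sum_i G i * Q i to the residues of the G i. It is
   linear because G is unique, injective because a residue is zero only if F
   i divides G i, and surjective by regular_form_residue and the fact that
   all the sums \sum_i G i * Q i lie in the saturation. *)
Lemma adjoint_residue_iso (K : numClosedFieldType) m s (F : 'I_s -> {mpoly K[m.+3]}) e :
  (forall i, irreducible_element (F i)) -> (forall i, F i \is (e i).-homog) ->
  (forall i j, divides (F i) (F j) -> i = j) -> (0 < \sum_i e i)%N ->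
  (forall i (x : coords K m.+2), zero_locus (F i) x -> linear_part x (F i) != 0) ->
  (forall x : coords K m.+2, nonzero x -> dual_vectors F x) ->
  let D := (\sum_i e i)%N%:Z - m.+2%:Z - 1 in
  let J := jacobian_ideal (\prod_i F i) in
  subquotient_iso (graded_piece (saturation J (irrelevant_ideal K m.+2)) D)
    (graded_piece J D)
    [set w : 'I_s -> coords K m.+2 -> ('I_m.+1 -> coords K m.+2) -> K^o |
       forall i, regular_form (zero_locus (F i)) (w i)]
    [set 0].
Proof.
move=> irrF homF indepF d0 smooth dualF D J.
have hJ : is_ideal J by apply: ideal_gen_is_ideal.
have [J0 _ _] := hJ.
pose Q i := \prod_(j | j != i) F j.
pose V := graded_piece (saturation J (irrelevant_ideal K m.+2)) D.
have /choice[G GP] : forall p, exists G : 'I_s -> {mpoly K[m.+3]}, V p ->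
    (forall i, adjoint (e i) (G i)) /\ p = \sum_i G i * Q i.
  move=> p; have [/graded_piece_adjoint[satp adjp]|nV] := pselect (V p); last by exists (fun=> 0).
  by have [G adjG E] := saturation_adjoint irrF homF indepF d0 satp adjp; exists G.
have sumV H : (forall i, adjoint (e i) (H i)) -> V (\sum_i H i * Q i).
  move=> adjH; apply/graded_piece_adjoint; split; first exact: adjoint_saturation.
  exact: adjoint_sum.
have Gsum H : (forall i, adjoint (e i) (H i)) -> G (\sum_i H i * Q i) = H.
  move=> adjH; have [adjG E] := GP _ (sumV H adjH).
  by apply/funext; apply: (adjoint_sum_inj irrF homF indepF adjG adjH (esym E)).
exists (fun p i => residue (F i) (G p i)); split=> [p Vp i|a p q Vp Vq|p Vp|w regw].
- apply: (residue_regular (irrF i) (homF i) (smooth i)).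
  by have [adjG _] := GP p Vp.
- have [adjp Ep] := GP p Vp; have [adjq Eq] := GP q Vq.
  have GE : G (a *: p + q) = (fun i => a *: G p i + G q i).
    rewrite -[RHS]Gsum => [|i]; last exact: adjoint_linear.
    apply: (congr1 G); rewrite {1}Ep {1}Eq scaler_sumr -big_split.
    by apply: eq_bigr => i _; rewrite mulrDl scalerAl.
  rewrite GE; apply/eqP; rewrite subr_eq0; apply/eqP.
  apply/funext => i; apply/funext => y; apply/funext => v.
  exact: residueD.
- have [adjG E] := GP p Vp; split.
    move=> /graded_piece_adjoint[Jp adjp].
    have p0 : p = 0 by apply: (jacobian_adjoint homF d0 adjp Jp).
    have G0 : G p = (fun=> 0).
      rewrite -[RHS]Gsum => [|i]; last by rewrite /adjoint; case: ifP => // _; apply: rpred0.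
      by apply: (congr1 G); rewrite p0 big1 // => i _; rewrite mul0r.
    rewrite G0; apply/funext => i; apply/funext => y; apply/funext => v.
    by rewrite /residue; case: asboolP => // _; rewrite meval0 !mul0r.
  move=> res0; have Gi0 i : G p i = 0.
    apply: (adjoint_divides_eq0 (homF i)) => //.
    apply: (residue_eq0 (irrF i) (homF i) (smooth i)) => y v.
    exact: (congr1 (fun w => w i y v) res0).
  have p0 : p = 0 by rewrite E big1 // => i _; rewrite Gi0 mul0r.
  apply/graded_piece_adjoint; split; first by rewrite p0.
  by move/graded_piece_adjoint: Vp => [].
have /choice[H HP] : forall i, exists G, adjoint (e i) G /\ w i = residue (F i) G.
  by move=> i; have [G' adjG' wE] := regular_form_residue (irrF i) (homF i) (smooth i) (regw i); exists G'.
have adjH i : adjoint (e i) (H i) by have [] := HP i.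
exists (\sum_i H i * Q i); first exact: sumV.
rewrite Gsum //; apply/eqP; rewrite subr_eq0; apply/eqP/funext => i.
by have [] := HP i.
Qed.

Theorem theorem5p1 (R : realType) (r d s : nat) (f : {mpoly R[i][r.+1]})
    (X : 'I_s -> set (coords R[i] r))
    (r_ge2 : (2 <= r)%N) (d_gt0 : (0 < d)%N)
    (f_homog : f \is d.-homog) (f_reduced : squarefree f)
    (f_snc : strictly_normal_crossing f)
    (X_inj : injective X)
    (X_components : range X = irreducible_component (zero_locus f)) :
  subquotient_iso
    (graded_piece (saturation (jacobian_ideal f) (irrelevant_ideal R[i] r))
       (d%:Z - r%:Z - 1))
    (graded_piece (jacobian_ideal f) (d%:Z - r%:Z - 1))
    [set w : 'I_s -> coords R[i] r -> ('I_r.-1 -> coords R[i] r) -> R[i]^o |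
       forall i, regular_form (X i) (w i)]
    [set 0].
Proof.
case: r r_ge2 => [|[|m]] // _ in f X f_homog f_reduced f_snc X_inj X_components *.
have [F [irrF /choice[e homF] fE XE indepF]] :=
  hypersurface_components d_gt0 f_homog f_reduced X_inj X_components.
have dE : d = (\sum_i e i)%N.
  have [f0 _] := f_reduced; apply: (dhomog_uniq f0 f_homog).
  by rewrite fE; apply: homog_prodF.
have smooth i (x : coords R[i] m.+2) : zero_locus (F i) x -> linear_part x (F i) != 0.
  move=> [x0 Fx]; apply: nonsingular_gradient => //.
  apply: f_snc.2; rewrite -X_components; exists i => //; exact: XE.
have dual (x : coords R[i] m.+2) : nonzero x -> dual_vectors F x.
  move=> x0 i Fx; apply: (normal_crossing_dual_vectors x0) (Fx).
    by move=> j Fx'; apply: smooth.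
  rewrite -fE; apply: f_snc.1; split=> //.
  by rewrite fE rmorph_prod /= (bigD1 i) //= Fx mul0r.
have := adjoint_residue_iso irrF homF indepF _ smooth dual.
rewrite -dE -fE => /(_ d_gt0); congr (subquotient_iso _ _ _ _).
by apply/funext => w; apply/propext; split=> H i; have := H i; rewrite XE.
Qed.
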